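(* Let D be the class of sets of reals decidable by a (deterministic) infinite time Turing machine, ND the class of sets of reals recognizable by a nondeterministic infinite time Turing machine, and coND the class of sets of reals whose complement is in ND. Then $\mathrm{D} \ne \mathrm{ND} \cap \mathrm{coND}$.
   Context: Reals are identified with infinite binary sequences. An infinite time Turing machine (ITTM) in the sense of Hamkins–Lewis has input, scratch and output tapes indexed by $\mathbb{N}$ with values in $\{0,1\}$, a head, finitely many states including start, halt and limit states; a set is ITTM-decidable if some ITTM program halts on every input and outputs $1$ exactly on members of the set. With $A_0$ the set of pairs (state, cell value) and $B_0$ the set of triples (state, cell value, head-movement instruction), an ITTM program is a function $A_0\to B_0$, while a nondeterministic ITTM (NITTM) program is a relation $R\subseteq A_0\times B_0$. A computation sequence of program $p$ on input $x$ is a transfinite sequence of snapshots (program, tape contents, head position, state) starting from the input configuration, where each successor snapshot results from applying one of the instructions $p$ relates to the current (state, cell value), and at limit stages the state is the limit state, each cell takes the $\limsup$ of its previous values, and the head returns to the first cell. It is halting if its final snapshot is in the halt state. A set $A$ is recognizable (in ND) if there is an NITTM program $p$ such that $x\in A$ if and only if some halting computation sequence of $p$ on input $x$ ends with output $1$. *)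

(* Defs.v *)
From mathcomp Require Import all_boot.
Set Implicit Arguments. Unset Strict Implicit. Unset Printing Implicit Defensive.

Definition real := nat -> bool.

(** The value under the head: the triple of bits (input, scratch, output). *)
Definition cell := (bool * bool * bool)%type.

(** Head movement instruction: [true] = right, [false] = left. *)
Definition move := bool.

Record nittm := NITTM {
  nst : nat;
  st_start : 'I_nst;
  st_halt : 'I_nst;
  st_limit : 'I_nst;
  ntrans : ('I_nst * cell) -> ('I_nst * cell * move) -> Prop }.

Record ittm := ITTM {
  dst : nat;
  dst_start : 'I_dst;
  dst_halt : 'I_dst;
  dst_limit : 'I_dst;
  dtrans : ('I_dst * cell) -> ('I_dst * cell * move) }.
Arguments dtrans : clear implicits.
Arguments ntrans : clear implicits.

Definition ittm_as_nittm (p : ittm) : nittm :=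
  @NITTM (dst p) (dst_start p) (dst_halt p) (dst_limit p)
    (fun a b => dtrans p a = b).

(** Snapshots (the program is constant along a computation and omitted). *)
Record snapshot (n : nat) := Snap {
  s_in : real; s_scr : real; s_out : real; s_head : nat; s_state : 'I_n }.

Definition cell_at n (s : snapshot n) : cell :=
  (s_in s (s_head s), s_scr s (s_head s), s_out s (s_head s)).

Definition upd (f : real) (i : nat) (v : bool) : real :=
  fun k => if k == i then v else f k.

(** Applying an instruction; moving left from cell 0 stays at cell 0. *)
Definition apply_instr n (s : snapshot n) (ins : 'I_n * cell * move) : snapshot n :=
  let: (q, (a, b, c), mv) := ins in
  let h := s_head s in
  @Snap n (upd (s_in s) h a) (upd (s_scr s) h b) (upd (s_out s) h c)
    (if mv then h.+1 else h.-1) q.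

Definition initial (p : nittm) (x : real) : snapshot (nst p) :=
  @Snap (nst p) x (fun _ => false) (fun _ => false) 0 (st_start p).

Definition is_wellorder (W : Type) (lt : W -> W -> Prop) : Prop :=
  (forall a, ~ lt a a) /\
  (forall a b c, lt a b -> lt b c -> lt a c) /\
  (forall a b, lt a b \/ a = b \/ lt b a) /\
  well_founded lt.

Definition succ_of (W : Type) (lt : W -> W -> Prop) (a b : W) : Prop :=
  lt a b /\ ~ (exists c, lt a c /\ lt c b).

Definition is_limit (W : Type) (lt : W -> W -> Prop) (b : W) : Prop :=
  (exists a, lt a b) /\ ~ (exists a, succ_of lt a b).

Definition limsup_at (W : Type) (lt : W -> W -> Prop) n (c : W -> snapshot n)
    (f : snapshot n -> real) (b : W) (k : nat) : Prop :=
  forall a, lt a b -> exists a', lt a a' /\ lt a' b /\ f (c a') k = true.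

Definition halting_computation (p : nittm) (x : real)
    (W : Type) (lt : W -> W -> Prop) (c : W -> snapshot (nst p)) (top : W) : Prop :=
  is_wellorder lt /\
  (forall a, a = top \/ lt a top) /\
  (forall a, (forall b, ~ lt b a) -> c a = initial p x) /\
  (forall a b, succ_of lt a b ->
     exists ins, ntrans p (s_state (c a), cell_at (c a)) ins /\
                 c b = apply_instr (c a) ins) /\
  (forall b, is_limit lt b ->
     s_state (c b) = st_limit p /\ s_head (c b) = 0 /\
     (forall k, s_in (c b) k = true <-> limsup_at lt c (@s_in _) b k) /\
     (forall k, s_scr (c b) k = true <-> limsup_at lt c (@s_scr _) b k) /\
     (forall k, s_out (c b) k = true <-> limsup_at lt c (@s_out _) b k)) /\
  (forall a, lt a top -> s_state (c a) <> st_halt p) /\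
  s_state (c top) = st_halt p.

Arguments halting_computation p x {W} lt c top.

Definition outputs_one n (s : snapshot n) : Prop := s_out s 0 = true.

Definition ittm_decidable (A : real -> Prop) : Prop :=
  exists p : ittm, forall x : real,
    (exists (W : Type) (lt : W -> W -> Prop) c top,
        halting_computation (ittm_as_nittm p) x lt c top) /\
    (forall (W : Type) (lt : W -> W -> Prop) c top,
        halting_computation (ittm_as_nittm p) x lt c top ->
        (outputs_one (c top) <-> A x)).

Definition nittm_recognizable (A : real -> Prop) : Prop :=
  exists p : nittm, forall x : real,
    A x <-> exists (W : Type) (lt : W -> W -> Prop) c top,
        halting_computation p x lt c top /\ outputs_one (c top).

Definition co_nittm_recognizable (A : real -> Prop) : Prop :=
  nittm_recognizable (fun x => ~ A x).

(* Main.v *)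
Require Import Defs.
From mathcomp Require Import all_boot.
From mathcomp Require Import boolp.
Set Implicit Arguments. Unset Strict Implicit. Unset Printing Implicit Defensive.

(* For a deterministic machine [U] let [A] be the set of inputs that [U] accepts.
   Simulating [U] shows that [A] is in ND.  If [U] does not halt, then its
   configuration at some countable limit stage recurs at a later limit stage,
   and no cell that is 0 in this configuration becomes 1 in between; conversely,
   by the limsup rule, such a recurrence makes [U] run forever.  A
   nondeterministic machine can guess at which limit to save a copy of the tape
   and at which later limit to compare, so the complement of [A] is in ND too.
   For a universal [U] a diagonal argument shows that [A] is not decidable.

   Existence of computations is handled without ordinals, through the inductive
   relation [tpath] of countable computations, closed under omega-limits; every
   computation on a well-order can be thinned out to one of these, and these
   can be realized on well-ordered sets of finite sequences. *)

(** The limsup rule makes limits fragile: a bit that flashes to 1 in auxiliary steps may be 1 at the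
    limit. The forward simulations therefore keep one discipline: while a step from [s] to [t] is
    imitated, a coded bit is 1 only if it is 1 in [s] or in [t]. Limits also erase head positions
    and the state, so whatever a simulation must remember across a limit is kept in cells, as
    constants or flags. Three tapes have to hold a program, a work tape, a saved copy and flags;
    hence a simulated cell is a block of tape cells, one per slot. While a block is rewritten cell
    by cell, old and new content mix, and most of the work in the soundness of the compilation is to
    show that limits do not notice this. Self-reference comes from a self-similar real: for a
    program [p] the blocks of [diag p] contain the table of [p] and, in one slot, [diag p] itself.
    The universal machine on this real imitates [p] on input [diag p] and reverses its answer, so
    [p] cannot decide acceptance. *)

Lemma dep_choice (T : Type) (P : T -> Prop) (R : nat -> T -> T -> Prop) (x0 : T) :
  P x0 -> (forall n x, P x -> exists y, P y /\ R n x y) ->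
  exists f : nat -> T, f 0 = x0 /\ forall n, P (f n) /\ R n (f n) (f n.+1).
Proof.
move=> P0 H.
have [g gP] : exists g : nat * {x | P x} -> {x | P x},
    forall y, R y.1 (sval y.2) (sval (g y)).
  suff /choice [g gP] : forall y : nat * {x | P x}, exists z : {x | P x},
      R y.1 (sval y.2) (sval z) by exists g.
  move=> [n [x Px]].
  by have [y [Py Rxy]] := H n x Px; exists (exist _ y Py).
pose h := fix h n := if n is m.+1 then g (m, h m) else exist _ x0 P0.
exists (fun n => sval (h n)); split=> // n; split; first exact: (svalP (h n)).
exact: (gP (n, h n)).
Qed.

(** The pairs [(k, j)] give [k] infinitely many codes, and only finitely many lie below [N].
    Decoding 0, 1, 2, ... thus brings up every index infinitely often, which is how bits are
    scheduled along omega-sequences. *)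
Lemma unpickle_cofinal (K : countType) (k : K) N :
  exists n (j : nat), N <= n /\ (unpickle n : option (K * nat)%type) = Some (k, j).
Proof.
suff [j Hj] : exists j : nat, N <= @pickle (K * nat)%type (k, j).
  by exists (@pickle (K * nat)%type (k, j)), j; rewrite pickleK.
apply: contrapT => nE.
have lt (j : nat) : @pickle (K * nat)%type (k, j) < N by rewrite ltnNge; apply/negP => le; apply: nE; exists j.
pose f (j : 'I_N.+1) : 'I_N := Ordinal (lt j).
have injf : injective f.
  move=> i j /(congr1 val) /= /(pcan_inj pickleK) [] e; exact: val_inj.
have := leq_card f injf; rewrite !card_ord ltnn; done.
Qed.

(** * Well-orders *)

Section WellOrder.
Variables (W : Type) (lt : W -> W -> Prop).
Hypothesis wo : is_wellorder lt.

Definition wle a b := a = b \/ lt a b.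

Lemma wo_irr a : ~ lt a a. Proof. by case: wo. Qed.
Lemma wo_trans a b c : lt a b -> lt b c -> lt a c.
Proof. by case: wo => _ [h _]; exact: h. Qed.
Lemma wo_tot a b : lt a b \/ a = b \/ lt b a.
Proof. by case: wo => _ [_ [h _]]; exact: h. Qed.
Lemma wo_wf : well_founded lt. Proof. by case: wo => _ [_ []]. Qed.
Lemma wo_asym a b : lt a b -> ~ lt b a.
Proof. by move=> ab /(wo_trans ab) /wo_irr. Qed.
Lemma wlt_le a b c : lt a b -> wle b c -> lt a c.
Proof. by move=> ab [<-//|]; exact: wo_trans. Qed.
Lemma wle_lt a b c : wle a b -> lt b c -> lt a c.
Proof. by move=> [->//|]; exact: wo_trans. Qed.
Lemma wle_trans a b c : wle a b -> wle b c -> wle a c.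
Proof. by move=> [->//|ab bc]; right; exact: wlt_le bc. Qed.
Lemma wle_total a b : wle a b \/ lt b a.
Proof. by case: (wo_tot a b) => [|[]]; [left; right|left; left|right]. Qed.
Lemma wle_nlt a b : wle a b -> ~ lt b a.
Proof. by move=> [->|]; [exact: wo_irr|exact: wo_asym]. Qed.

Lemma wo_least (P : W -> Prop) a : P a ->
  exists b, [/\ P b, wle b a & forall d, lt d b -> ~ P d].
Proof.
move=> Pa; suff [b [Pb mb]] : exists b, P b /\ forall d, lt d b -> ~ P d.
  exists b; split=> //; case: (wle_total b a) => // ab; case: (mb a ab) => //.
apply: contrapT => nE.
elim/(well_founded_ind wo_wf): a Pa => a IH Pa.
by apply: nE; exists a; split=> // d /IH.
Qed.

Lemma succ_exists a b : lt a b -> exists2 d, succ_of lt a d & wle d b.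
Proof.
move=> /(@wo_least (lt a)) [d [ad db md]]; exists d => //.
by split=> // -[e [ae ed]]; apply: (md e).
Qed.

Lemma succ_wle a b d : succ_of lt a b -> lt a d -> wle b d.
Proof. by move=> [_ n] ad; case: (wle_total b d) => // db; case: n; exists d. Qed.

Lemma lt_succ_wle a b d : succ_of lt a b -> lt d b -> wle d a.
Proof. by move=> [_ n] db; case: (wle_total d a) => // ad; case: n; exists d. Qed.

Lemma succ_lt a b : succ_of lt a b -> lt a b. Proof. by case. Qed.

Lemma wo_cases b :
  [\/ forall a, ~ lt a b, exists a, succ_of lt a b | is_limit lt b].
Proof.
case: (EM (exists a, lt a b)) => [ex|]; last by move=> /forallNP; constructor 1.
by case: (EM (exists a, succ_of lt a b)); [constructor 2|constructor 3].
Qed.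

Lemma limit_succ a b : is_limit lt b -> lt a b -> exists2 d, succ_of lt a d & lt d b.
Proof.
move=> [_ ns] ab; have [d ad [e|]] := succ_exists ab; last by exists d.
by case: ns; exists a; rewrite -e.
Qed.

(** Soundness proofs follow an invariant up to the first stage where it fails and then ask whether
    that stage is a successor or a limit. *)
Lemma first_exit (P : W -> Prop) a z : P a -> wle a z -> ~ P z ->
  exists b, [/\ lt a b, wle b z, ~ P b & forall d, wle a d -> lt d b -> P d].
Proof.
move=> Pa az nPz.
have [b [[ab nPb] bz mb]] := @wo_least (fun b => wle a b /\ ~ P b) z (conj az nPz).
exists b; split=> //; first by case: ab => // e; rewrite -e in nPb.
move=> d ad db; apply: contrapT => nPd; exact: (mb d db).
Qed.

End WellOrder.

(** * Transfinite systems and countable computations *)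

(** Head and state are reset at limits, so a limit configuration is a function [lmc] of the limsup
    bits alone. Countability of [bitix] lets an omega-sequence attend to every bit infinitely
    often. *)
Record tsys := TSys {
  conf : Type;
  bitix : countType;
  stp : conf -> conf -> Prop;
  bit : conf -> bitix -> bool;
  lmc : (bitix -> bool) -> conf;
  bit_lmc : forall f, bit (lmc f) = f }.
Arguments stp {t}. Arguments bit {t}. Arguments lmc {t}. Arguments bit_lmc {t}.

Definition limsup (K : Type) (v : nat -> K -> bool) : K -> bool :=
  fun k => `[< forall n, exists i, n <= i /\ v i k >].
Definition bigor (K : Type) (v : nat -> K -> bool) : K -> bool :=
  fun k => `[< exists i, v i k >].
Definition orf (K : Type) (u v : K -> bool) : K -> bool := fun k => u k || v k.

(* [tpath s t v] is a nonempty countable computation from [s] to [t]; [v]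
   collects the bits that are 1 at some stage before the last one. *)
Inductive tpath (S : tsys) : conf S -> conf S -> (bitix S -> bool) -> Prop :=
| tpath1 s t : stp s t -> tpath s t (bit s)
| tpathS s t t' v : tpath s t v -> stp t t' -> tpath s t' (orf v (bit t))
| tpathL (t : nat -> conf S) (v : nat -> bitix S -> bool) :
    (forall i, tpath (t i) (t i.+1) (v i)) ->
    tpath (t 0) (lmc (limsup v)) (bigor v).

Section PathTheory.
Variable S : tsys.
Implicit Types s t u : conf S.

Lemma tpath_start s t v : tpath s t v -> forall k, bit s k -> v k.
Proof.
elim=> {s t v} [a b _ k //|a b t' v _ IH _ k /IH|t v _ IH k /IH]; first by rewrite /orf => ->.
by move=> h; apply/asboolP; exists 0.
Qed.

(** In the limit case the initial path is absorbed into the first of the omega many segments; this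
    enlarges the collected bits but leaves the limsup alone. *)
Lemma tpath_trans s t u v w : tpath s t v -> tpath t u w -> tpath s u (orf v w).
Proof.
move=> st tu; elim: tu s v st => {t u w} [t u tu|t t1 u w _ IH tu|t w tw IH] s v st.
- exact: tpathS st tu.
- have -> : orf v (orf w (bit t1)) = orf (orf v w) (bit t1).
    by apply: funext => k; rewrite /orf orbA.
  by apply: tpathS tu; apply: IH.
pose t' i := if i is 0 then s else t i.
pose w' i := if i is 0 then orf v (w 0) else w i.
have -> : limsup w = limsup w'.
  apply: funext => k; apply: asbool_equiv_eq; split=> h n;
  have [[|i] [ni wi]] := h n.+1; rewrite ?ltn0 // in ni *; by exists i.+1; split=> //; apply: ltnW.
have -> : orf v (bigor w) = bigor w'.
  apply: funext => k; rewrite /orf /bigor; apply/idP/asboolP.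
    case/orP => [vk|/asboolP [[|i] wi]]; [exists 0|exists 0|exists i.+1] => //=.
    - by rewrite /orf vk.
    - by rewrite /orf wi orbT.
  case=> -[|i] /=; first by rewrite /orf => /orP [->//|h]; apply/orP; right; apply/asboolP; exists 0.
  by move=> h; apply/orP; right; apply/asboolP; exists i.+1.
change s with (t' 0); apply: tpathL => -[|i] /=; last exact: tw.
exact: IH.
Qed.

Definition opath s t v := (s = t /\ v = fun _ => false) \/ tpath s t v.

Lemma orf0 K (v : K -> bool) : orf v (fun _ => false) = v.
Proof. by apply: funext => k; rewrite /orf orbF. Qed.
Lemma or0f K (v : K -> bool) : orf (fun _ => false) v = v.
Proof. by apply: funext => k. Qed.

Lemma tpath_otrans s t u v w : tpath s t v -> opath t u w -> tpath s u (orf v w).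
Proof. by move=> st [[<- ->]|tu]; [rewrite orf0|exact: tpath_trans tu]. Qed.
Lemma opath_ttrans s t u v w : opath s t v -> tpath t u w -> tpath s u (orf v w).
Proof. by move=> [[<- ->]|st] tu; [rewrite or0f|exact: tpath_trans tu]. Qed.
Lemma opath_trans s t u v w : opath s t v -> opath t u w -> opath s u (orf v w).
Proof. by move=> [[<- ->]|st] tu; [rewrite or0f|right; exact: tpath_otrans tu]. Qed.

Lemma tpath_first s t v : tpath s t v -> exists s', stp s s'.
Proof. by elim=> {s t v} // s t st; exists t. Qed.

(** The last configuration is exempt from [P], just as [tpath] collects no bits from its last
    stage. *)
Inductive star (P : conf S -> Prop) : conf S -> conf S -> Prop :=
| star0 s : star P s s
| starS s t u : P s -> stp s t -> star P t u -> star P s u.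

Lemma star1 (P : conf S -> Prop) s t : P s -> stp s t -> star P s t.
Proof. by move=> Ps st; apply: starS st _ => //; exact: star0. Qed.

Lemma star_trans P s t u : star P s t -> star P t u -> star P s u.
Proof. by elim=> // {}s {}t w Ps st _ IH /IH; exact: starS st. Qed.

Lemma star_opath (P : conf S -> Prop) s t : star P s t ->
  exists v, opath s t v /\ forall k, v k -> exists2 c, P c & bit c k.
Proof.
elim=> {s t} [s|s t u Ps st _ [v [tu vP]]].
  by exists (fun _ => false); split=> //; left.
exists (orf (bit s) v); split.
  by right; apply: tpath_otrans tu; exact: tpath1.
by move=> k /orP [sk|/vP//]; exists s.
Qed.

End PathTheory.

Section Run.
Variables (S : tsys) (W : Type) (lt : W -> W -> Prop) (c : W -> conf S).

Definition wlimsup (b : W) : bitix S -> bool :=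
  fun k => `[< forall a, lt a b -> exists a', [/\ lt a a', lt a' b & bit (c a') k] >].

Definition is_run := [/\ is_wellorder lt,
  (forall a b, succ_of lt a b -> stp (c a) (c b)) &
  (forall b, is_limit lt b -> c b = lmc (wlimsup b))].
End Run.

(** * Realization on well-ordered sets of stages *)

(* Kleene-Brouwer order: a proper extension precedes its prefixes, so that the
   empty sequence is the last stage. *)
Fixpoint kb (a b : seq nat) : Prop :=
  match a, b with
  | [::], _ => False
  | _ :: _, [::] => True
  | i :: a', j :: b' => i < j \/ (i = j /\ kb a' b')
  end.

Lemma kb_irr a : ~ kb a a.
Proof. by elim: a => //= i a IH [|[_ //]]; rewrite ltnn. Qed.

Lemma kb_nnil a b : kb a b -> a <> [::].
Proof. by case: a. Qed.

Lemma kb_trans a b c : kb a b -> kb b c -> kb a c.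
Proof.
elim: a b c => [|i a IH] [|j b] [|k c] //=.
move=> [ij|[<- ab]] [jk|[<- bc]]; [left; exact: ltn_trans jk|by left|by left|].
by right; split=> //; apply: IH bc.
Qed.

Lemma kb_total a b : kb a b \/ a = b \/ kb b a.
Proof.
elim: a b => [|i a IH] [|j b] /=; [by right; left|by right; right|by left|].
case: (ltngtP i j) => [|_|<-]; [by left; left|by right; right; left|].
case: (IH b) => [|[->|]]; [by left; right|by right; left|by right; right; right].
Qed.

Lemma ltnn_false n : n < n -> False. Proof. by rewrite ltnn. Qed.

Section KBRun.
Variable S : tsys.

Section Def.
Variables (D : seq nat -> Prop) (c : seq nat -> conf S).
Definition kbsucc a b := [/\ D a, D b, kb a b & forall d, D d -> ~ (kb a d /\ kb d b)].
Definition kblim b := [/\ D b, exists2 a, D a & kb a b & forall a, ~ kbsucc a b].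
Definition kblimsup b : bitix S -> bool := fun k =>
  `[< forall a, D a -> kb a b -> exists a', [/\ D a', kb a a', kb a' b & bit (c a') k] >].
End Def.

Record kbrun (s t : conf S) (v : bitix S -> bool) D c bot : Prop := KBRun {
  kb_top : D [::];
  kb_Dbot : D bot;
  kb_bot : forall a, D a -> a = bot \/ kb bot a;
  kb_wf : forall a, D a -> Acc (fun x y => D x /\ kb x y) a;
  kb_s : c bot = s;
  kb_t : c [::] = t;
  kb_succ : forall a b, kbsucc D a b -> stp (c a) (c b);
  kb_lim : forall b, kblim D b -> c b = lmc (kblimsup D c b);
  kb_bits : forall k, v k <-> exists2 a, D a /\ a <> [::] & bit (c a) k }.

Lemma kbrun0 (s : conf S) : kbrun s s (fun _ => false) (eq [::]) (fun _ => s) [::].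
Proof.
split.
- by [].
- by [].
- by move=> a <-; left.
- by move=> a <-; constructor=> b [<- /kb_irr].
- by [].
- by [].
- by move=> a b [<- <-].
- by move=> b [<- [a <-]].
- by move=> k; split=> // -[a [<-]].
Qed.

(** The old stages move below the prefix 0, hence before the new last stage [[::]]; the old last
    stage becomes [[:: 0]], whose successor is [[::]]. *)
Lemma kbrun_snoc s t t' v D c bot : kbrun s t v D c bot -> stp t t' ->
  exists D' c', kbrun s t' (orf v (bit t)) D' c' (0 :: bot).
Proof.
move=> R tt'.
pose D' a := if a is i :: a' then i = 0 /\ D a' else True.
pose c' a := if a is i :: a' then c a' else t'.
exists D', c'.
have succE a b : kbsucc D' (0 :: a) (0 :: b) -> kbsucc D a b.
  move=> [[_ Da] [_ Db] [//|[_ ab]] n]; split=> // d Dd [ad db].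
  by apply: (n (0 :: d)); split=> //=; right.
split; rewrite /=.
- by [].
- by split=> //; apply: kb_Dbot R.
- move=> [|i a] /=; first by right.
  by move=> [-> /(kb_bot R) [->|]]; [left|right; right].
- have acc0 a : D a -> Acc (fun x y => D' x /\ kb x y) (0 :: a).
    move=> /[dup] Da /(kb_wf R) acc.
    elim: acc Da => {}a _ IH Da; constructor=> -[|i b] /= [].
      by move=> _ [].
    by move=> [-> Db] [/ltnn_false []|[_ ba]]; exact: IH.
  move=> [|i a] /=; last by move=> [-> Da]; exact: acc0.
  move=> _; constructor=> -[|i b] /= []; first by move=> _ [].
  by move=> [-> Db] _; exact: acc0.
- exact: kb_s R.
- by [].
- move=> [|i a] [|j b] /= [] //.
    move=> [-> Da] _ _ n.
    suff -> : a = [::] by rewrite (kb_t R).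
    case: a Da n => // j a Da /(_ [:: 0]) []; first by split=> //; apply: kb_top R.
    by split=> //=; right.
  move=> [-> Da] [-> Db] h n; apply: (kb_succ R); apply: succE; split=> //.
- move=> [|j b] [] /=.
    move=> _ _ /(_ [:: 0]) [].
    split=> //; first by split=> //; exact: kb_top R.
    move=> [|i d] /=; first by move=> _ [].
    by move=> [-> _] [[/ltnn_false []|[_ []]]].
  move=> [-> Db] [[|i a] Da0 lt0] n; first by case: lt0.
  case: Da0 lt0 => -> Da [/ltnn_false []|[_ ab]] /=.
  rewrite (kb_lim R); last first.
    split=> //; first by exists a.
    move=> d [Dd _ db nn]; apply: (n (0 :: d)); split=> //=; first by right.
    move=> [|k e] /=; first by move=> _ [].
    by move=> [-> De] [[/ltnn_false []|[_ h1]] [/ltnn_false []|[_ h2]]]; exact: (nn e De).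
  congr lmc; apply: funext => k; apply: asbool_equiv_eq; split.
    move=> h [|i' a'] //= [-> Da'] [//|[_ ab']].
    have [d [Dd ad db kd]] := h a' Da' ab'.
    by exists (0 :: d); split=> //=; right.
  move=> h d Dd db.
  have [||[|i' d'] [//= [-> Dd'] [//|[_ dd']] [//|[_ d'b]] kd]] := h (0 :: d) => //=; first by right.
  by exists d'.
move=> k; split.
  case/orP => [/(kb_bits R) [a [Da na] ka]|tk]; first by exists (0 :: a).
  by exists [:: 0] => //=; [split=> //; split=> //; exact: kb_top R|rewrite (kb_t R)].
move=> [[|i a] [Da //= _] ka]; case: Da => _ Da; rewrite /orf.
case: a Da ka => [|j a] Da ka; first by rewrite -(kb_t R) ka orbT.
by apply/orP; left; apply/(kb_bits R); exists (j :: a).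
Qed.

(** Segment [i] goes below the prefix [i] without its last stage, because that configuration is also
    the first one of segment [i.+1]. The condition on [bot i] keeps the truncated segments
    nonempty. *)
Lemma kbrun_lim (t : nat -> conf S) v D c bot :
  (forall i, kbrun (t i) (t i.+1) (v i) (D i) (c i) (bot i) /\ bot i <> [::]) ->
  exists D' c', kbrun (t 0) (lmc (limsup v)) (bigor v) D' c' (0 :: bot 0).
Proof.
move=> H; have R i := proj1 (H i); have nb i := proj2 (H i).
pose D' a := if a is i :: a' then D i a' /\ a' <> [::] else True.
pose c' a := if a is i :: a' then c i a' else lmc (limsup v).
exists D', c'.
have bots i : D' (i :: bot i) by split; [exact: kb_Dbot (R i)|].
have kbn i a : a <> [::] -> kb (i :: a) [::] by [].
have kbnil a : a <> [::] -> kb a [::] by case: a.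
split; rewrite /=.
- by [].
- by split; [exact: kb_Dbot (R 0)|].
- move=> [|i a] /=; first by right.
  case: i => [|i] [Da na]; last by right; left.
  by case: (kb_bot (R 0) Da) => [->|]; [left|right; right].
- have acc1 i a : D i a -> a <> [::] -> Acc (fun x y => D' x /\ kb x y) (i :: a).
    elim/ltn_ind: i a => i IHi a /[dup] Da /(kb_wf (R i)) acc.
    elim: acc Da => {}a _ IH Da na; constructor=> -[|j b] /= [].
      by move=> _ [].
    move=> [Db nbb] [ji|[e ba]]; first exact: IHi.
    by subst j; exact: IH.
  move=> [|i a] /=; last by move=> [Da na]; exact: acc1.
  move=> _; constructor=> -[|i b] /= []; first by move=> _ [].
  by move=> [Db nbb] _; exact: acc1.
- exact: kb_s (R 0).
- by [].
- move=> [|i a] [|j b] // [] //= [Da na].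
    move=> _ _ /(_ (i.+1 :: bot i.+1)) []; first exact: bots.
    by split=> //=; left.
  move=> [Db nbb] h n.
  case: (h) => [ij|[eij ab]]; last first.
    subst j; apply: (kb_succ (R i)); split=> // d Dd [ad db].
    case: (n (i :: d)); first by split=> //; exact: kb_nnil db.
    by split; right.
  (* A successor pair that crosses between segments leads to the first stage of the very next
     segment; otherwise some first stage would lie in between. *)
  have eb : b = bot j.
    case: (kb_bot (R j) Db) => // bb; case: (n (j :: bot j) (bots j)).
    by split; [left|right].
  have ej : j = i.+1.
    apply/eqP; rewrite eqn_leq ij andbT leqNgt; apply/negP => ij'.
    by case: (n (i.+1 :: bot i.+1) (bots i.+1)); split; left.
  subst j b; rewrite (kb_s (R i.+1)) -(kb_t (R i)); apply: (kb_succ (R i)).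
  split=> //; [exact: kb_top (R i)|exact: kbnil|].
  move=> d Dd [ad dn]; apply: (n (i :: d)).
    by split=> //; exact: kb_nnil dn.
  by split; [right|left].
- move=> [|j b] [].
    move=> _ _ _ /=; congr lmc; apply: funext => k; apply: asbool_equiv_eq; split.
      move=> h [|i a] // _ _; have [m [im vm]] := h i.+1.
      have [d [Dd nd] kd] := (kb_bits (R m) k).1 vm.
      by exists (m :: d); split=> //; left.
    move=> h n; have [||[|m d] [//[Dd nd] lt _ kd]] := h (n :: bot n) => //.
    exists m; split; last by apply/(kb_bits (R m)); exists d.
    by case: lt => [|[<-//]]; exact: ltnW.
  move=> [Db nbb] [[|i0 a0] Da0' lt0] n; first by case: lt0.
  case: Da0' => Da0 na0 /=.
  case: (kb_bot (R j) Db) => [eb|bb]; last first.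
    rewrite (kb_lim (R j)); last first.
      split=> //; first by exists (bot j) => //; exact: kb_Dbot (R j).
      move=> a [Da _ ab na]; apply: (n (j :: a)); split=> //.
      - by split=> //; exact: kb_nnil ab.
      - by right.
      move=> [|m d] Dd' [h1 h2]; first by case: h2.
      case: Dd' => Dd nd.
      case: h1 h2 => [jm|[e1 h1]] [mj|[e h2]].
      + by apply: (@ltnn_false j); exact: ltn_trans mj.
      + by move: jm; rewrite e ltnn.
      + by move: mj; rewrite e1 ltnn.
      by subst m; exact: (na d).
    congr lmc; apply: funext => k; apply: asbool_equiv_eq; split.
      move=> h [|m a] Da' ab; first by case: ab.
    case: Da' => Da na.
      have [a1 [Da1 a1b aa1]] : exists a1, [/\ D j a1, kb a1 b &
          forall d, kb a1 d -> kb (m :: a) (j :: d)].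
        case: ab => [mj|[mj ab]]; last by subst m; exists a; split=> // d; right.
        by exists (bot j); split=> //; [exact: kb_Dbot (R j)|move=> d _; left].
      have [d [Dd ad db kd]] := h a1 Da1 a1b.
      exists (j :: d); split=> //; last by right.
        by split=> //; exact: kb_nnil db.
      exact: aa1.
    move=> h a Da ab.
    have [||[|m d] [Dd' h1 h2 kd]] := h (j :: a) => //; last first.
    - case: Dd' => Dd nd; exists d; case: h1 h2 => [jm|[e h1]] [mj|[e' h2]]; last by subst m.
      + by case: (@ltnn_false j); exact: ltn_trans mj.
      + by move: jm; rewrite e' ltnn.
      + by move: mj; rewrite e ltnn.
    - by right.
    - by split=> //; exact: kb_nnil ab.
  have nbot d : D j d -> ~ kb d (bot j).
    move=> Dd db; case: (kb_bot (R j) Dd) => [e|bd].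
      by rewrite e in db; exact: kb_irr db.
    exact: kb_irr (kb_trans db bd).
  (* The first stage of segment [i.+1] stands for the omitted last stage of segment [i] and inherits
     its limit rule; the first stage of segment 0 is the least stage and no limit. *)
  subst b; case: j => [|i] in Db nbb lt0 n nbot *.
    by case: lt0 => // -[e h]; subst i0; case: (nbot a0).
  rewrite (kb_s (R i.+1)) -(kb_t (R i)) (kb_lim (R i)); last first.
    split; first exact: kb_top (R i).
      by exists (bot i); [exact: kb_Dbot (R i)|exact: kbnil].
    move=> a [Da _ an na]; apply: (n (i :: a)); split=> //.
    - by split=> //; exact: kb_nnil an.
    - by left.
    move=> [|m d] Dd' [h1 h2]; first by case: h2.
      case: Dd' => Dd nd.
    case: h2 => [mi|[e h2]]; last by subst m; exact: nbot h2.
    case: h1 => [im|[e h1]]; first by apply: (@ltnn_false m); exact: leq_trans im.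
    by subst m; apply: (na d) => //; split=> //; exact: kbnil.
  congr lmc; apply: funext => k; apply: asbool_equiv_eq; split.
    move=> h [|m a] Da' ab; first by case: ab.
    case: Da' => Da na.
    have [a1 [Da1 a1b aa1]] : exists a1, [/\ D i a1, kb a1 [::] &
        forall d, kb a1 d -> kb (m :: a) (i :: d)].
      case: ab => [|[e ab]]; last by subst m; case: (nbot a).
      rewrite ltnS leq_eqVlt => /orP [/eqP e|mi].
        by subst m; exists a; split=> //; [exact: kbnil|move=> d; right].
      exists (bot i); split=> //; [exact: kb_Dbot (R i)|exact: kbnil|].
      by move=> d _; left.
    have [d [Dd ad db kd]] := h a1 Da1 a1b.
    exists (i :: d); split=> //; [|exact: aa1|by left].
    by split=> //; exact: kb_nnil db.
  move=> h a Da an.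
  have [||[|m d] [Dd' h1 h2 kd]] := h (i :: a) => //; last first.
  - case: Dd' => Dd nd; case: h2 => [mi|[e h2]]; last by subst m; case: (nbot d).
    case: h1 => [im|[e h1]]; first by case: (@ltnn_false m); exact: leq_trans im.
    by subst m; exists d; split=> //; exact: kbnil.
  - by left.
  - by split=> //; exact: kb_nnil an.
- move=> k; split.
    move/asboolP => [i vi]; have [a [Da na] ka] := (kb_bits (R i) k).1 vi.
    by exists (i :: a).
  move=> [[|i a] [Da na] ka]; first by case: na.
  by apply/asboolP; exists i; apply/(kb_bits (R i)); exists a; case: Da.
Qed.

Lemma tpath_kbrun (s t : conf S) v : tpath s t v ->
  exists D c bot, kbrun s t v D c bot /\ bot <> [::].
Proof.
elim=> {s t v} [s t st|s t t' v _ [D [c [bot [R nb]]]] tt'|t v _ IH].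
- have [D [c R]] := kbrun_snoc (kbrun0 s) st.
  by exists D, c, [:: 0]; rewrite or0f in R.
- by have [D' [c' R']] := kbrun_snoc R tt'; exists D', c', (0 :: bot).
have /choice [F HF] : forall i, exists F : (seq nat -> Prop) * (seq nat -> conf S) * seq nat,
    kbrun (t i) (t i.+1) (v i) F.1.1 F.1.2 F.2 /\ F.2 <> [::].
  by move=> i; have [D [c [bot H]]] := IH i; exists (D, c, bot).
have [D [c R]] := kbrun_lim HF.
by exists D, c, (0 :: (F 0).2).
Qed.

Lemma tpath_run (s t : conf S) v : tpath s t v ->
  exists (W : Type) (lt : W -> W -> Prop) (c : W -> conf S) (bot top : W),
  [/\ is_run lt c, forall a, a = bot \/ lt bot a, forall a, a = top \/ lt a top,
      c bot = s & c top = t].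
Proof.
move=> /tpath_kbrun [D [c [bot [R _]]]].
pose W := {a | D a}; pose lt (a b : W) := kb (sval a) (sval b).
have sE (a b : W) : sval a = sval b -> a = b.
  by case: a b => a Da [b Db] /= e; subst b; congr exist; exact: Prop_irrelevance.
exists W, lt, (fun a => c (sval a)), (exist _ bot (kb_Dbot R)), (exist _ [::] (kb_top R)).
have succE (a b : W) : succ_of lt a b <-> kbsucc D (sval a) (sval b).
  case: a b => a Da [b Db]; split=> /=.
    move=> [ab n]; split=> // d Dd [ad db]; apply: n.
    by exists (exist _ d Dd).
  by move=> [_ _ ab n]; split=> // -[[d Dd] [ad db]]; exact: (n d).
split=> /=; [split| | | |].
- split; first by move=> a; exact: kb_irr.
  split; first by move=> a b d; exact: kb_trans.
  split; first by move=> a b; case: (kb_total (sval a) (sval b)) => [|[/sE|]]; auto.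
  move=> [a Da]; elim: (kb_wf R Da) (Da) => {Da}a _ IH Da.
  by constructor=> -[b Db] ba; exact: IH.
- by move=> a b /succE h; exact: (kb_succ R h).
- move=> [b Db] [[[a Da] ab] n] /=; rewrite (kb_lim R); last first.
    split=> //; first by exists a.
    by move=> d /[dup] -[Dd _ _ _] h; apply: n; exists (exist _ d Dd); apply/succE.
  congr lmc; apply: funext => k; apply: asbool_equiv_eq; split.
    move=> h [a1 Da1] a1b; have [d [Dd ad db kd]] := h a1 Da1 a1b.
    by exists (exist _ d Dd).
  move=> h a1 Da1 a1b; have [[d Dd] [ad db kd]] := h (exist _ a1 Da1) a1b.
  by exists d.
- by move=> [a Da]; case: (kb_bot R Da) => [e|]; [left; exact: sE|right].
- move=> [[|i a] Da]; last by right.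
  by left; exact: sE.
- exact: kb_s R.
- exact: kb_t R.
Qed.
End KBRun.

(** * Following a computation inside a deterministic run *)

Section Tower.
Variables (W : Type) (lt : W -> W -> Prop) (wo : is_wellorder lt).
Variables (e : nat -> W) (z : W).
Hypothesis einc : forall i, lt (e i) (e i.+1).
Hypothesis ez : forall i, lt (e i) z.

Lemma tower_mono i j : i <= j -> wle lt (e i) (e j).
Proof.
elim: j => [|j IH]; first by rewrite leqn0 => /eqP ->; left.
rewrite leq_eqVlt => /orP [/eqP ->|/IH h]; first by left.
by right; exact: (wle_lt wo h).
Qed.

Lemma tower_block n m a : wle lt (e n) a -> lt a (e m) ->
  exists i, [/\ n <= i, wle lt (e i) a & lt a (e i.+1)].
Proof.
move=> na; elim: m => [|m IH] am.
  case: (wle_nlt wo (tower_mono (leq0n n))).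
  exact: (wle_lt wo na).
case: (wle_total wo (e m) a) => [ma|/IH //].
exists m; split=> //; rewrite leqNgt; apply/negP => mn.
by apply: (wle_nlt wo (tower_mono mn)); exact: (wle_lt wo na).
Qed.

Lemma tower_sup : exists l, [/\ is_limit lt l, wle lt l z, forall i, lt (e i) l &
  forall a, lt a l -> exists i, lt a (e i)].
Proof.
have [l [lub lz ml]] := wo_least wo (P := fun b => forall i, lt (e i) b) ez.
have below a : lt a l -> exists i, lt a (e i).
  move=> /ml /existsNP [i ni]; exists i.+1.
  by case: (wle_total wo a (e i)) => [h|//]; exact: (wle_lt wo h).
exists l; split=> //; split; first by exists (e 0).
move=> [a ha]; have [i ai] := below _ (succ_lt ha).
by apply: (wle_nlt wo (lt_succ_wle wo ha (lub i))).
Qed.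

(** Every stage from [e 0] up to the supremum lies in one block between consecutive [e i], so
    cofinal stages and infinitely many blocks show the same bits. *)
Lemma tower_limsup (K : Type) (b : W -> K -> bool) (v : nat -> K -> bool) l :
  (forall i, lt (e i) l) -> (forall a, lt a l -> exists i, lt a (e i)) ->
  (forall i k, v i k <-> exists a, [/\ wle lt (e i) a, lt a (e i.+1) & b a k]) ->
  (fun k => `[< forall a, lt a l -> exists a', [/\ lt a a', lt a' l & b a' k] >]) = limsup v.
Proof.
move=> el le vP; apply: funext => k; apply: asbool_equiv_eq; split.
  move=> h n; have [a [na al ba]] := h _ (el n).
  have [m am] := le _ al.
  have [i [ni ia ai]] := tower_block (or_intror na) am.
  by exists i; split=> //; apply/vP; exists a.
move=> h a al; have [m am] := le _ al.
have [i [mi /vP [d [id di bd]]]] := h m.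
exists d; split=> //; first by apply: (wlt_le wo am); exact: (wle_trans wo (tower_mono mi)).
exact: (wo_trans wo di).
Qed.

Lemma tower_bigor (K : Type) (b : W -> K -> bool) (v : nat -> K -> bool) l :
  (forall i, lt (e i) l) -> (forall a, lt a l -> exists i, lt a (e i)) ->
  (forall i k, v i k <-> exists a, [/\ wle lt (e i) a, lt a (e i.+1) & b a k]) ->
  forall k, bigor v k <-> exists a, [/\ wle lt (e 0) a, lt a l & b a k].
Proof.
move=> el le vP k; split.
  move=> /asboolP [i /vP [a [ia ai ba]]]; exists a; split=> //.
    exact: (wle_trans wo (tower_mono (leq0n i))).
  exact: (wo_trans wo ai).
move=> [a [a0 /le [m am] ba]]; have [i [_ ia ai]] := tower_block a0 am.
by apply/asboolP; exists i; apply/vP; exists a.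
Qed.
End Tower.

Definition deterministic (S : tsys) :=
  forall s t t' : conf S, stp s t -> stp s t' -> t = t'.
Definition halted (S : tsys) (s : conf S) := forall t, ~ stp s t.

Section Deterministic.
Variable S : tsys.
Hypothesis det : deterministic S.

Section Follow.
Variables (W : Type) (lt : W -> W -> Prop) (c : W -> conf S) (top : W).
Hypothesis run : is_run lt c.
Hypothesis topP : forall a, wle lt a top.
Hypothesis halt : halted (c top).

Let wo : is_wellorder lt. Proof. by case: run. Qed.

Lemma run_step e t : stp (c e) t -> exists2 d, succ_of lt e d & c d = t.
Proof.
move=> st; case: (topP e) => [ee|et]; first by rewrite ee in st; case: (halt st).
have [d ed _] := succ_exists wo et; exists d => //.
by case: run => _ rs _; apply: det st; exact: rs.
Qed.

(** Determinism forces the run along any [tpath] leaving one of its configurations, and since its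
    last stage is halted it cannot end before the path does. In the limit case the stages reached by
    the segments have a supremum, where the run obeys the same limsup rule. *)
Lemma follow s t v : tpath s t v -> forall e, c e = s ->
  exists e', [/\ lt e e', c e' = t &
    forall k, v k <-> exists a, [/\ wle lt e a, lt a e' & bit (c a) k]].
Proof.
elim=> {s t v} [s t st|s t t' v _ IH tt'|t v _ IH] e ce.
- rewrite -ce in st; have [d ed cd] := run_step st; exists d; split=> //.
    exact: succ_lt ed.
  move=> k; rewrite -ce; split.
    by move=> h; exists e; split=> //; [left|exact: succ_lt ed].
  move=> [a [ea ad ba]]; case: ea => [->//|ea].
  by case: (wle_nlt wo (lt_succ_wle wo ed ad)).
- have [e1 [ee1 ce1 ve1]] := IH e ce; rewrite -ce1 in tt'.
  have [d ed cd] := run_step tt'; exists d; split=> //.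
    exact: (wo_trans wo ee1 (succ_lt ed)).
  move=> k; rewrite /orf -ce1; split.
    case/orP => [/ve1 [a [ea ae ba]]|h].
      by exists a; split=> //; exact: (wo_trans wo ae (succ_lt ed)).
    by exists e1; split=> //; [right|exact: succ_lt ed].
  move=> [a [ea ad ba]]; case: (lt_succ_wle wo ed ad) => [<-|ae]; first by rewrite ba orbT.
  by apply/orP; left; apply/ve1; exists a.
pose R n x y := lt x y /\ forall k, v n k <-> exists a, [/\ wle lt x a, lt a y & bit (c a) k].
have [f [f0 fP]] : exists f : nat -> nat * W, f 0 = (0, e) /\
    forall n, ((f n).1 = n /\ c (f n).2 = t n) /\ ((f n.+1).1 = n.+1 /\ R n (f n).2 (f n.+1).2).
  have [f [f0 fP]] := @dep_choice (nat * W)%type (fun x => c x.2 = t x.1)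
    (fun n x y => y.1 = x.1.+1 /\ R x.1 x.2 y.2) (0, e) ce (fun n x cx =>
      let: ex_intro e' (And3 h1 h2 h3) := IH x.1 x.2 cx in
      ex_intro _ (x.1.+1, e') (conj h2 (conj erefl (conj h1 h3)))).
  exists f; split=> //.
  have f1 n : (f n).1 = n.
    by elim: n => [|n IHn]; [rewrite f0|have [_ [-> _]] := fP n; rewrite IHn].
  by move=> n; have [h1 [h2 h3]] := fP n; rewrite f1 in h1 h3; rewrite !f1.
pose g n := (f n).2.
have einc i : lt (g i) (g i.+1) by have [_ [_ []]] := fP i.
have gt i : lt (g i) top by exact: (wlt_le wo (einc i) (topP _)).
have [l [ll _ el le]] := tower_sup wo einc gt.
have vP i k : v i k <-> exists a, [/\ wle lt (g i) a, lt a (g i.+1) & bit (c a) k].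
  by have [_ [_ [_ h]]] := fP i; exact: h.
have g0 : g 0 = e by rewrite /g f0.
exists l; split; first by rewrite -g0.
  case: run => _ _ /(_ l ll) ->; congr lmc.
  exact: (tower_limsup wo einc el le vP).
by move=> k; rewrite -g0; exact: (tower_bigor wo einc el le vP).
Qed.

(** Call a stage covered if it lies in a traversal of the loop. A least uncovered stage would be a
    limit of loop ends: bits outside [A] never show before it, bits in [A] are 1 at each loop end,
    so its configuration is [lmc A] and a new traversal starts there. Thus the last stage is covered
    too, but then a loop end would come after it. *)
Lemma run_no_loop bot s A v0 v : c bot = s ->
  tpath s (lmc A) v0 -> tpath (lmc A) (lmc A) v -> (forall k, v k -> A k) -> False.
Proof.
move=> cbot p0 pl vA; have [e0 [_ ce0 _]] := follow p0 cbot.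
pose Cov a := exists b b', [/\ wle lt e0 b, wle lt b a, lt a b', c b' = lmc A &
  forall x k, wle lt b x -> lt x b' -> bit (c x) k -> A k].
have covE a : wle lt e0 a -> c a = lmc A -> Cov a.
  move=> ea ca; have [b' [ab' cb' vb']] := follow pl ca.
  exists a, b'; split=> //; first by left.
  by move=> x k ax xb bx; apply: vA; apply/vb'; exists x.
suff all a : wle lt e0 a -> Cov a.
  by have [b [b' [_ _ tb _ _]]] := all top (topP _); apply: (wle_nlt wo (topP b')).
move=> ea; apply: contrapT => nCa.
have [{}a [[{}ea {}nCa] _ ma]] := wo_least wo (P := fun a => wle lt e0 a /\ ~ Cov a) (conj ea nCa).
have nca : c a <> lmc A by move=> ca; apply: nCa; exact: covE.
have cov x : wle lt e0 x -> lt x a -> Cov x.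
  by move=> ex xa; apply: contrapT => nC; exact: (ma x xa).
have next x : wle lt e0 x -> lt x a -> exists b', [/\ lt x b', lt b' a, c b' = lmc A &
    forall k, bit (c x) k -> A k].
  move=> ex xa; have [b [b' [eb bx xb' cb' bA]]] := cov x ex xa; exists b'.
  split=> //; last by move=> k; exact: bA.
  case: (wle_total wo a b') => // -[eab|ab']; first by case: nca; rewrite eab.
  case: nCa; exists b, b'; split=> //.
  by right; exact: (wle_lt wo bx).
have e0a : lt e0 a by case: ea => // ee; case: nca; rewrite -ee.
have lima : is_limit lt a.
  split; first by exists e0.
  move=> [x xa]; have ex : wle lt e0 x by exact: (lt_succ_wle wo xa).
  have [b' [xb ba _ _]] := next x ex (succ_lt xa).
  exact: (wle_nlt wo (succ_wle wo xa xb)).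
apply: nca; case: run => _ _ /(_ a lima) ->; congr lmc.
apply: funext => k; apply/asboolP/idP.
  move=> /(_ e0 e0a) [x [ex xa kx]].
  have [b' [_ _ _]] := next x (or_intror ex) xa; exact.
move=> Ak x xa; have [x1 [ex1 x1a xx1]] : exists x1, [/\ wle lt e0 x1, lt x1 a & wle lt x x1].
  case: (wle_total wo e0 x) => [h|h]; first by exists x; split=> //; left.
  by exists e0; split=> //; [left|right].
have [b' [xb ba cb _]] := next x1 ex1 x1a.
exists b'; split=> //; first exact: (wle_lt wo xx1).
by rewrite cb bit_lmc.
Qed.

End Follow.

Lemma tpath_halt_uniq (s t t' : conf S) v v' :
  tpath s t v -> tpath s t' v' -> halted t -> halted t' -> t = t'.
Proof.
move=> /tpath_run [W [lt [c [bot [top [run _ tp <- <-]]]]]] p' h h'.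
have [e [_ ce _]] := follow run tp h p' erefl; rewrite -ce in h' *.
case: (tp e) => [->//|et]; case: run => wo rs _.
have [d ed _] := succ_exists wo et.
by case: (h' (c d)); exact: rs.
Qed.

Lemma loop_no_halt (s t : conf S) A v0 v w : opath s t w -> halted t ->
  tpath s (lmc A) v0 -> tpath (lmc A) (lmc A) v -> (forall k, v k -> A k) -> False.
Proof.
move=> [[<- _] h /tpath_first [s' ss'] _ _|]; first exact: (h s').
move=> /tpath_run [W [lt [c [bot [top [run _ tp cb <-]]]]]] h.
exact: (run_no_loop run tp h cb).
Qed.
End Deterministic.

(** * From arbitrary runs to countable computations *)

Section Reflect.
Variables (S : tsys) (W : Type) (lt : W -> W -> Prop) (wo : is_wellorder lt).
Variables (c : W -> conf S) (a0 z : W).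
(** Stages may stutter, since [c] will be a projection of a run that also makes auxiliary steps.
    Proper steps are required cofinally below each limit because [tpath] has no empty segments. *)
Hypothesis csucc : forall a b, wle lt a0 a -> wle lt b z -> succ_of lt a b ->
  c a = c b \/ stp (c a) (c b).
Hypothesis clim : forall b, lt a0 b -> wle lt b z -> is_limit lt b ->
  c b = lmc (wlimsup lt c b) /\
  forall a, wle lt a0 a -> lt a b ->
    exists a' a'', [/\ wle lt a a', succ_of lt a' a'', lt a'' b & stp (c a') (c a'')].

Definition span a b (v : bitix S -> bool) :=
  forall k, v k -> exists x, [/\ wle lt a x, lt x b & bit (c x) k].

Lemma span_orf a x b v w : wle lt a x -> wle lt x b ->
  span a x v -> span x b w -> span a b (orf v w).
Proof.
move=> ax xb va wx k /orP [/va|/wx] [y [h1 h2 h3]]; exists y; split=> //.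
  exact: (wlt_le wo h2).
exact: (wle_trans wo ax).
Qed.

Lemma span_bit a b : lt a b -> span a b (bit (c a)).
Proof. by move=> ab k h; exists a; split=> //; left. Qed.

(* Stages that repeat the previous configuration are skipped; the limit case
   picks an omega-sequence of stages that is long enough to let every bit
   that is 1 cofinally often show up infinitely often. *)
Lemma reflect_run b : wle lt b z -> forall a, wle lt a0 a -> lt a b ->
  c a = c b \/ exists v, tpath (c a) (c b) v /\ span a b v.
Proof.
elim/(well_founded_ind (wo_wf wo)): b => b IH bz a a0a ab.
case: (wo_cases lt b) => [nb|[e eb]|lb]; first by case: (nb a).
  have eltb := succ_lt eb.
  have ez : wle lt e z by right; exact: (wlt_le wo eltb).
  have ae := lt_succ_wle wo eb ab.
  have a0e : wle lt a0 e := wle_trans wo a0a ae.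
  have st := csucc a0e bz eb.
  have [ce|[v [p sv]]] : c a = c e \/ exists v, tpath (c a) (c e) v /\ span a e v.
    by case: ae => [->|ae]; [left|exact: IH].
  - case: st => [<-|st]; [by left|right]; exists (bit (c a)); split; last exact: span_bit.
    by apply: tpath1; rewrite ce.
  right; case: st => [<-|st].
    by exists v; split=> // k /sv [x [h1 h2 h3]]; exists x; split=> //; exact: (wo_trans wo h2).
  exists (orf v (bit (c e))); split; first exact: tpathS st.
  by apply: span_orf sv (span_bit eltb) => //; right.
have a0b := wle_lt wo a0a ab.
have [cb prop] := clim a0b bz lb; right.
pose A k := wlimsup lt c b k.
have deadP k : ~~ A k -> exists2 d, lt d b & forall x, lt d x -> lt x b -> ~~ bit (c x) k.
  move=> /asboolPn /existsNP [d nd]; have db : lt d b.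
    by apply: contrapT => ndb; apply: nd.
  exists d => // x dx xb; apply/negP => bx; apply: nd => _.
  by exists x.
(* Task [n], decoded to [(k, j)]: if [k] is 1 at the limit, segment [n] must show it; if not, the
   segment must end beyond all stages below [b] that show [k]. *)
pose good n y (v : bitix S -> bool) :=
  forall k j, @unpickle (bitix S * nat)%type n = Some (k, j) -> (A k -> v k) /\
    (~~ A k -> forall y', wle lt y y' -> lt y' b -> ~~ bit (c y') k).
pose R n x y := lt x y /\ exists v, [/\ tpath (c x) (c y) v, span x y v & good n y v].
have proper x : wle lt a0 x -> lt x b -> exists y, [/\ lt x y, lt y b &
    exists v, [/\ tpath (c x) (c y) v, span x y v & forall k, bit (c x) k -> v k]].
  move=> ax xb; have [y [y' [xy yy' yb st]]] := prop x ax xb.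
  have lyy := succ_lt yy'.
  have yltb := wo_trans wo lyy yb.
  exists y'; split=> //; first exact: (wle_lt wo xy).
  have [cxy|[v [p sv]]] : c x = c y \/ exists v, tpath (c x) (c y) v /\ span x y v.
    case: xy => [->|xy]; [by left|apply: IH => //].
    by right; exact: (wlt_le wo yltb).
  - exists (bit (c x)); split=> //; last by apply: span_bit; exact: (wle_lt wo xy).
    by apply: tpath1; rewrite cxy.
  exists (orf v (bit (c y))); split; first exact: tpathS st.
    by apply: span_orf sv (span_bit lyy) => //; right.
  by move=> k /(tpath_start p); rewrite /orf => ->.
have [f [f0 fP]] : exists f : nat -> W, f 0 = a /\
    forall n, (wle lt a0 (f n) /\ lt (f n) b) /\ R n (f n) (f n.+1).
  apply: (@dep_choice W (fun x => wle lt a0 x /\ lt x b)) => // n x [a0x xb].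
  case eq_n: (@unpickle (bitix S * nat)%type n) => [[k j]|]; last first.
    have [y [xy yb [v [p sv vx]]]] := proper x a0x xb.
    exists y; split; first by split=> //; right; exact: (wle_lt wo a0x).
    by split=> //; exists v; split=> // k j; rewrite eq_n.
  case Ak: (A k).
    have [h [xh hb bh]] : exists x', [/\ lt x x', lt x' b & bit (c x') k].
      by move/asboolP: Ak => /(_ x xb).
    have a0h : wle lt a0 h by right; exact: (wle_lt wo a0x).
    have [y [hy yb [v [p sv vh]]]] := proper h a0h hb.
    have hz : wle lt h z by right; exact: (wlt_le wo hb).
    exists y; split; first by split=> //; right; exact: (wle_lt wo a0h).
    split; first exact: (wo_trans wo xh).
    have [cxh|[w [q sw]]] := IH h hb hz x a0x xh.
      exists v; split; [by rewrite cxh| |].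
        by move=> i /sv [u [h1 h2 h3]]; exists u; split=> //; right; exact: (wlt_le wo xh).
      by move=> k' j'; rewrite eq_n => -[<- _]; split=> [_|]; [exact: vh|rewrite Ak].
    exists (orf w v); split; first exact: tpath_trans p.
      by apply: span_orf sw sv; right.
    by move=> k' j'; rewrite eq_n => -[<- _]; split=> [_|]; [rewrite /orf vh // orbT|rewrite Ak].
  have [d db dP] := deadP k (negbT Ak).
  have [x1 [xx1 dx1 x1b]] : exists x1, [/\ wle lt x x1, wle lt d x1 & lt x1 b].
    case: (wle_total wo x d) => h; first by exists d; split=> //; left.
    by exists x; split=> //; [left|right].
  have a0x1 := wle_trans wo a0x xx1.
  have [y [x1y yb [v [p sv _]]]] := proper x1 a0x1 x1b.
  have xy := wle_lt wo xx1 x1y.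
  exists y; split; first by split=> //; right; exact: (wle_lt wo a0x).
  split=> //.
  have dead (u : bitix S -> bool) : good n y u.
    move=> k' j'; rewrite eq_n => -[<- _]; split; first by rewrite Ak.
    move=> _ y' yy' y'b; apply: dP => //.
    exact: (wlt_le wo (wle_lt wo dx1 x1y) yy').
  have [cx|[w [q sw]]] : c x = c x1 \/ exists w, tpath (c x) (c x1) w /\ span x x1 w.
    case: xx1 => [->|h]; [by left|apply: IH => //].
    by right; exact: (wlt_le wo x1b).
    exists v; split=> //; first by rewrite cx.
    by move=> i /sv [u [h1 h2 h3]]; exists u; split=> //; exact: (wle_trans wo xx1).
  exists (orf w v); split=> //; first exact: tpath_trans p.
  by apply: span_orf sw sv => //; right.
have /choice [v vP] n := proj2 (proj2 (fP n)).
have einc i : lt (f i) (f i.+1) by case: (fP i) => _ [].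
have fb i : lt (f i) b by case: (fP i) => -[].
have mono := tower_mono wo einc.
have -> : c b = lmc (limsup v).
  rewrite cb; congr lmc; apply: funext => k; apply/idP/asboolP => [Ak n|h].
    have [m [j [nm um]]] := unpickle_cofinal k n.
    by exists m; split=> //; case: (vP m) => _ _ /(_ k j um) [/(_ Ak)].
  apply: contrapT => /negP nA; have [m [j [_ um]]] := unpickle_cofinal k 0.
  case: (vP m) => _ _ /(_ k j um) [_ /(_ nA) dead].
  have [i [mi vik]] := h m.+1; case: (vP i) => _ /(_ k vik) [x [fx xf bx]] _.
  have /negP := dead x (wle_trans wo (mono _ _ mi) fx) (wo_trans wo xf (fb _)).
  exact.
exists (bigor v); split; first by rewrite -f0; apply: (@tpathL S (fun i => c (f i))) => i; case: (vP i).
move=> k /asboolP [i vik]; case: (vP i) => _ /(_ k vik) [x [fx xf bx]] _.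
exists x; split=> //; last exact: (wo_trans wo xf).
by rewrite -f0; exact: (wle_trans wo (mono _ _ (leq0n i))).
Qed.
End Reflect.

(** * Computations that do not halt loop *)

Section Loop.
Variable S : tsys.
Implicit Types s t u : conf S.

Lemma opath_refl s : opath s s (fun _ => false). Proof. by left. Qed.

Definition dead k t := forall u w, opath t u w -> ~~ w k && ~~ bit u k.
(** This is stronger than not being dead: no continuation may kill the bit. Both properties persist
    along paths, and from every configuration one of the two can be reached. *)
Definition alive k t := forall u w, opath t u w -> ~ dead k u.

Lemma dead_opath k t u w : opath t u w -> dead k t -> dead k u.
Proof.
move=> tu d u' w' uu'; have := d _ _ (opath_trans tu uu').
by rewrite /orf negb_or -andbA => /and3P [_ -> ->].
Qed.

Lemma alive_opath k t u w : opath t u w -> alive k t -> alive k u.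
Proof. by move=> tu a u' w' uu'; exact: a (opath_trans tu uu'). Qed.

Lemma tpath_tail (t : nat -> conf S) v n :
  (forall i, tpath (t i) (t i.+1) (v i)) ->
  exists w, tpath (t n) (lmc (limsup v)) w /\ forall k, w k -> exists i, v i k.
Proof.
move=> tv; exists (bigor (fun i => v (n + i))).
have -> : limsup v = limsup (fun i => v (n + i)).
  apply: funext => k; apply: asbool_equiv_eq; split=> h m.
    have [i [mi vi]] := h (n + m); exists (i - n).
    have ni : n <= i by exact: leq_trans (leq_addr m n) mi.
    by rewrite subnKC // leq_subRL //.
  by have [i [mi vi]] := h m; exists (n + i); split=> //; exact: leq_trans (leq_addl n i).
split.
  have -> : t n = t (n + 0) by rewrite addn0.
  by apply: (@tpathL S (fun i => t (n + i))) => i; rewrite addnS.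
by move=> k /asboolP [i vi]; exists (n + i).
Qed.

(* First pass every stage after which some bit never becomes 1 again; from then
   on each bit is either constantly 0 or can be made 1 again and again, and the
   limits at which all the latter recur have the same configuration. *)
Lemma nonhalting_loop s :
  (forall t v, opath s t v -> exists t', stp t t') ->
  exists A v0 v, [/\ tpath s (lmc A) v0, tpath (lmc A) (lmc A) v & forall k, v k -> A k].
Proof.
move=> tot; pose Reach t := exists v, opath s t v.
have reach_tr t u w : Reach t -> opath t u w -> Reach u.
  by move=> [v sv] tu; exists (orf v w); exact: opath_trans tu.
have [f [f0 fP]] : exists f : nat -> conf S, f 0 = s /\ forall n, Reach (f n) /\
    exists w, tpath (f n) (f n.+1) w /\
      forall k, unpickle n = Some k -> dead k (f n.+1) \/ alive k (f n.+1).
  apply: (@dep_choice _ Reach (fun n x y => exists w, tpath x y w /\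
      forall k, unpickle n = Some k -> dead k y \/ alive k y)) => [|n x Rx].
    by exists (fun _ => false); exact: opath_refl.
  have [u [w [xu ku]]] : exists u w, opath x u w /\
      forall k, unpickle n = Some k -> dead k u \/ alive k u.
    case: (unpickle n) => [k|]; last first.
      by exists x, (fun _ => false); split=> //; exact: opath_refl.
    case: (EM (exists u w, opath x u w /\ dead k u)) => [[u [w [xu du]]]|nd].
      by exists u, w; split=> // k' [<-]; left.
    exists x, (fun _ => false); split; first exact: opath_refl.
    by move=> k' [<-]; right => u w xu du; apply: nd; exists u, w.
  have Ru := reach_tr _ _ _ Rx xu.
  have [v su] := Ru; have [u' uu'] := tot _ _ su.
  exists u'; split.
    by apply: (reach_tr _ _ _ Ru); right; exact: tpath1 uu'.
  exists (orf w (bit u)); split; first by apply: (opath_ttrans xu); exact: tpath1.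
  have uo : opath u u' (bit u) by right; exact: tpath1.
  by move=> k /ku [/(dead_opath uo)|/(alive_opath uo)]; [left|right].
have /choice [w wP] n := proj2 (fP n).
have path_f i : tpath (f i) (f i.+1) (w i) by case: (wP i).
set t := lmc (limsup w).
have st : tpath s t (bigor w) by rewrite -f0; exact: (@tpathL S f).
have Rt : Reach t by exists (bigor w); right.
(* Stage [(pickle k).+1] of the sequence has settled [k], and persistence carries the verdict to
   [t]. *)
have dec k : dead k t \/ alive k t.
  have [v [pv _]] := tpath_tail (pickle k).+1 path_f.
  have pv' : opath _ t v := or_intror pv.
  by case: (wP (pickle k)) => _ /(_ k (pickleK k)) [/(dead_opath pv')|/(alive_opath pv')]; [left|right].
pose A k := `[< alive k t >].
(* From any [u] beyond [t] an omega-sequence can show each alive bit infinitely often and can never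
   show a dead one, so its limit is [lmc A] whatever [u] is. *)
have next u w0 : opath t u w0 -> exists v, tpath u (lmc A) v /\ forall k, v k -> A k.
  move=> tu.
  have [g [g0 gP]] : exists g : nat -> conf S, g 0 = u /\ forall n,
      (exists v, opath t (g n) v) /\ exists v, tpath (g n) (g n.+1) v /\
      forall k j, @unpickle (bitix S * nat)%type n = Some (k, j) -> A k -> v k.
    apply: (@dep_choice _ (fun x => exists v, opath t x v)
        (fun n x y => exists v, tpath x y v /\ forall k j,
          @unpickle (bitix S * nat)%type n = Some (k, j) -> A k -> v k)) => [|n x [v tx]].
      by exists w0.
    have [y [v' [xy vk]]] : exists y v', opath x y v' /\
      forall k j, @unpickle (bitix S * nat)%type n = Some (k, j) -> A k -> v' k || bit y k.
      case eq_n: (@unpickle (bitix S * nat)%type n) => [[k j]|]; last first.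
        by exists x, (fun _ => false); split=> //; exact: opath_refl.
      case: (asboolP (alive k t)) => [al|nal]; last first.
        exists x, (fun _ => false); split; first exact: opath_refl.
        by move=> k' j' [<- _] /asboolP.
      have /existsNP [y /existsNP [v' nd]] := al _ _ tx.
      exists y, v'; case: (EM (opath x y v')) => [xy|nxy]; last first.
        by case: nd => xy; case: nxy.
      split=> // k' j' [<- _] _; apply: contrapT => /negP.
      by rewrite negb_or => h; apply: nd.
    have [v1 sy] := reach_tr _ _ _ Rt (opath_trans tx xy).
    have [y' yy'] := tot _ _ sy.
    have yo : tpath y y' (bit y) := tpath1 yy'.
    exists y'; split.
      by exists (orf (orf v v') (bit y)); apply: opath_trans (opath_trans tx xy) (or_intror yo).
    by exists (orf v' (bit y)); split; [exact: opath_ttrans yo|exact: vk].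
  have /choice [v vP] n := proj2 (gP n).
  have path_g i : tpath (g i) (g i.+1) (v i) by case: (vP i).
  have vA i k : v i k -> A k.
    move=> vik; case: (dec k) => [d|/asboolP //].
    have [v1 tg] := proj1 (gP i).
    by have := dead_opath tg d (or_intror (path_g i)); rewrite vik.
  have eA : limsup v = A.
    apply: funext => k; apply/asboolP/idP => [|Ak n].
      by move=> /(_ 0) [i [_ /vA]].
    have [m [j [nm um]]] := unpickle_cofinal k n.
    by exists m; split=> //; case: (vP m) => _ h; exact: (h k j um Ak).
  exists (bigor v); split; first by rewrite -g0 -eA; exact: (@tpathL S g v path_g).
  move=> k /asboolP [i vi]; exact: vA vi.
(* Starting from [t] gives a visit to [lmc A]; starting again from there gives the recurrence. *)
have [v0 [p0 _]] := next t _ (opath_refl t).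
have [v [pv vA]] := next _ _ (or_intror p0).
by exists A, (orf (bigor w) v0), v; split=> //; exact: tpath_trans p0.
Qed.
End Loop.

(** * Forward simulation *)

Section Forward.
Variables (S1 S2 : tsys) (Rel : conf S1 -> conf S2 -> Prop).
Variables (kappa : bitix S1 -> bitix S2) (cst : bitix S2 -> option bool).

Definition fits (w : bitix S2 -> bool) := forall k r, cst k = Some r -> w k -> r.
Hypothesis Rbit : forall s u, Rel s u -> (forall k, bit u (kappa k) = bit s k) /\
  forall k r, cst k = Some r -> bit u k = r.
Hypothesis Rstep : forall s u t, Rel s u -> stp s t -> exists u' w,
  [/\ tpath u u' w, Rel t u', forall k, w (kappa k) -> bit s k || bit t k & fits w].
Hypothesis Rlim : forall f g, (forall k, g (kappa k) = f k) ->
  (forall k r, cst k = Some r -> g k = r) -> exists u' w,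
  [/\ opath (lmc g) u' w, Rel (lmc f) u', forall k, w (kappa k) -> f k & fits w].

(** During a simulated step only bits of its two ends may show, so the limsups of coded bits agree.
    The bits fixed by [cst] survive limits: a 0 because of [fits], a 1 because every segment starts
    with it. [Rlim] grants extra steps after a limit, where the simulator has lost its head position
    and state. *)
Lemma forward_sim s t v : tpath s t v -> forall u, Rel s u -> exists u' w,
  [/\ tpath u u' w, Rel t u', forall k, v k -> w (kappa k),
     forall k, w (kappa k) -> v k || bit t k & fits w].
Proof.
elim=> {s t v} [s t st|s t t' v st IH tt'|t v tv IH] u Ru.
- have [u' [w [p R' wb fw]]] := Rstep Ru st.
  exists u', w; split=> // k sk; apply: (tpath_start p).
  by case: (Rbit Ru) => ->.
- have [u1 [w1 [p1 R1 l1 b1 f1]]] := IH u Ru.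
  have [u' [w [p R' wb fw]]] := Rstep R1 tt'.
  exists u', (orf w1 w); split=> //; first exact: tpath_trans p.
  + move=> k /orP [/l1 h|h]; apply/orP; [by left|right].
    by apply: (tpath_start p); case: (Rbit R1) => ->.
  + move=> k /orP [/b1/orP[h|h]|/wb/orP[h|h]]; rewrite /orf h ?orbT //.
  + by move=> k r kr /orP [/(f1 k r kr)|/(fw k r kr)].
have [f [f0 fP]] : exists f : nat -> nat * conf S2, f 0 = (0, u) /\ forall n,
    (Rel (t (f n).1) (f n).2) /\ ((f n.+1).1 = (f n).1.+1 /\ exists w,
     [/\ tpath (f n).2 (f n.+1).2 w, forall k, v (f n).1 k -> w (kappa k),
      forall k, w (kappa k) -> v (f n).1 k || bit (t (f n).1.+1) k & fits w]).
  apply: (@dep_choice (nat * conf S2)%type (fun x => Rel (t x.1) x.2) (fun n x y =>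
     y.1 = x.1.+1 /\ exists w, [/\ tpath x.2 y.2 w, forall k, v x.1 k -> w (kappa k),
      forall k, w (kappa k) -> v x.1 k || bit (t x.1.+1) k & fits w])) => // n x Rx.
  have [u' [w [p R' l b fw]]] := IH x.1 x.2 Rx.
  by exists (x.1.+1, u'); split=> //; split=> //; exists w.
have f1 n : (f n).1 = n.
  by elim: n => [|n IHn]; [rewrite f0|have [_ [-> _]] := fP n; rewrite IHn].
pose g n := (f n).2.
have Rg n : Rel (t n) (g n) by have [] := fP n; rewrite f1.
have /choice [w wP] : forall n, exists w, [/\ tpath (g n) (g n.+1) w, forall k, v n k -> w (kappa k),
      forall k, w (kappa k) -> v n k || bit (t n.+1) k & fits w].
  by move=> n; have [_ [_]] := fP n; rewrite f1.
have tw i : tpath (g i) (g i.+1) (w i) by case: (wP i).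
have wk i k r : cst k = Some r -> w i k = r.
  move=> kr; apply/idP/idP; first by case: (wP i) => _ _ _ h; exact: h.
  by move=> hr; apply: (tpath_start (tw i)); case: (Rbit (Rg i)) => _ /(_ k r kr) ->.
have lv k : limsup w (kappa k) = limsup v k.
  apply: asbool_equiv_eq; split=> h n.
    have [i [ni wi]] := h n; case: (wP i) => _ _ /(_ k wi) /orP [vi|ti] _.
      by exists i.
    by exists i.+1; split; [exact: leqW|exact: tpath_start (tv i.+1) _ ti].
  by have [i [ni vi]] := h n; exists i; split=> //; case: (wP i) => _ ->.
have lc k r : cst k = Some r -> limsup w k = r.
  move=> kr; apply/asboolP/idP => [/(_ 0) [i [_]]|hr n]; first by rewrite (wk i k r kr).
  by exists n; rewrite (wk n k r kr).
have [u' [w' [p' R' b' f']]] := Rlim lv lc.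
have pw := @tpathL S2 g w tw; rewrite {1}/g f0 /= in pw.
exists u', (orf (bigor w) w'); split=> //; first exact: tpath_otrans p'.
- move=> k /asboolP [i vi]; apply/orP; left; apply/asboolP; exists i.
  by case: (wP i) => _ ->.
- move=> k /orP [/asboolP [i wi]|/b' h]; last by rewrite bit_lmc h orbT.
  apply/orP; left; apply/asboolP.
  case: (wP i) => _ _ /(_ k wi) /orP [vi|ti] _; first by exists i.
  by exists i.+1; exact: tpath_start (tv i.+1) _ ti.
- move=> k r kr /orP [/asboolP [i]|/(f' k r kr) //].
  by rewrite (wk i k r kr).
Qed.
End Forward.

Section Restrict.
Variables (S : tsys) (A : bitix S -> bool).

(** Turns the confinement of a whole path to the bits in [A] into a property of single steps, as a
    stepwise simulation needs it. *)
Definition restrict_sys : tsys :=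
  @TSys (conf S) (bitix S) (fun s t => stp s t /\ forall k, bit t k -> A k)
    (@bit S) (@lmc S) (@bit_lmc S).

Lemma tpath_restrict s t v : tpath s t v -> (forall k, v k -> A k) ->
  (forall k, bit t k -> A k) -> @tpath restrict_sys s t v.
Proof.
elim=> {s t v} [s t st|s t t' v _ IH tt'|t v tv IH] vA tA.
- exact: (@tpath1 restrict_sys).
- have tA' k : bit t k -> A k by move=> h; apply: vA; rewrite /orf h orbT.
  apply: (@tpathS restrict_sys s t t') => //; apply: IH => // k h.
  by apply: vA; rewrite /orf h.
have vA' i k : v i k -> A k by move=> h; apply: vA; apply/asboolP; exists i.
apply: (@tpathL restrict_sys) => i; apply: IH => [k|k h]; first exact: vA'.
by apply: (vA' i.+1); exact: tpath_start (tv i.+1) _ h.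
Qed.
End Restrict.

(** * Infinite time Turing machines as transfinite systems *)

Section Nittm.
Variable p : nittm.

Definition sbit n (s : snapshot n) (k : option bool * nat) : bool :=
  match k.1 with
  | None => s_in s k.2 | Some false => s_scr s k.2 | Some true => s_out s k.2
  end.

Definition slim (f : option bool * nat -> bool) : snapshot (nst p) :=
  Snap (fun k => f (None, k)) (fun k => f (Some false, k)) (fun k => f (Some true, k))
    0 (st_limit p).

Definition sstp (s t : snapshot (nst p)) : Prop :=
  s_state s <> st_halt p /\
  exists ins, ntrans p (s_state s, cell_at s) ins /\ t = apply_instr s ins.

Lemma sbit_lim f : sbit (slim f) = f.
Proof. by apply: funext => -[[[]|] k]. Qed.

Lemma slim_eq (s : snapshot (nst p)) f : s_state s = st_limit p -> s_head s = 0 ->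
  (forall k, s_in s k = f (None, k)) -> (forall k, s_scr s k = f (Some false, k)) ->
  (forall k, s_out s k = f (Some true, k)) -> s = slim f.
Proof.
case: s => i sc o h q /= -> -> e1 e2 e3; rewrite /slim.
by congr Snap; apply: funext => k.
Qed.

Definition nsys : tsys :=
  @TSys (snapshot (nst p)) (option bool * nat)%type sstp (@sbit _) slim sbit_lim.

Lemma halting_run x W (lt : W -> W -> Prop) (c : W -> snapshot (nst p)) top :
  halting_computation p x lt c top ->
  [/\ @is_run nsys W lt c, forall a, wle lt a top,
      exists2 bot, c bot = initial p x & forall a, wle lt bot a & s_state (c top) = st_halt p].
Proof.
move=> [wo [tp [ini [su [li [nh ha]]]]]]; split=> //.
- split=> //.
    move=> a b ab; split; last exact: su.
    by apply: nh; exact: (wlt_le wo (succ_lt ab)).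
  move=> b lb; have [s0 [h0 [e1 [e2 e3]]]] := li b lb.
  have E (f : snapshot (nst p) -> real) t k :
      (forall s, f s k = sbit s (t, k)) -> (f (c b) k = true <-> limsup_at lt c f b k) ->
      f (c b) k = wlimsup (S := nsys) lt c b (t, k).
    move=> fE eb; apply/idP/asboolP => [/eb h a ab|h].
      by have [a' [h1 [h2 h3]]] := h a ab; exists a'; split=> //=; rewrite -fE.
    apply/eb => a ab; have [a' [h1 h2 h3]] := h a ab.
    by exists a'; split=> //; split=> //; rewrite fE.
  apply: slim_eq => // k.
  + exact: (E (@s_in _) None k).
  + exact: (E (@s_scr _) (Some false) k).
  + exact: (E (@s_out _) (Some true) k).
have [b [_ _ mb]] := wo_least wo (P := fun _ => True) (a := top) I.
have nb a : ~ lt a b by move=> h; exact: (mb a h).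
exists b; first exact: ini.
by move=> a; case: (wle_total wo b a) => // /nb.
Qed.

Lemma run_halting x W (lt : W -> W -> Prop) (c : W -> snapshot (nst p)) bot top :
  @is_run nsys W lt c -> (forall a, wle lt a top) -> (forall a, wle lt bot a) ->
  c bot = initial p x -> s_state (c top) = st_halt p ->
  halting_computation p x lt c top.
Proof.
move=> [wo su li] tp bt cb ha; split=> //; split=> //.
split; first by move=> a na; case: (bt a) => [<-//|ba]; case: (na bot).
split; first by move=> a b ab; case: (su a b ab).
split.
  move=> b /li ->; split=> //; split=> //.
  have E (f : snapshot (nst p) -> real) t k :
      (forall s, f s k = sbit s (t, k)) ->
      wlimsup (S := nsys) lt c b (t, k) = true <-> limsup_at lt c f b k.
    move=> fE; split.
      move=> /asboolP h a ab; have [a' [h1 h2 h3]] := h a ab.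
      by exists a'; split=> //; split=> //; rewrite fE.
    move=> h; apply/asboolP => a ab; have [a' [h1 [h2 h3]]] := h a ab.
    by exists a'; split=> //=; rewrite -fE.
  by split; [|split] => k; apply: E.
split=> // a at_; have [b ab _] := succ_exists wo at_.
by case: (su a b ab).
Qed.

Lemma nsys_accepts x :
  (exists W (lt : W -> W -> Prop) c top,
     halting_computation p x lt c top /\ outputs_one (c top)) <->
  exists (W : Type) (lt : W -> W -> Prop) (c : W -> conf nsys) bot top,
   [/\ is_run lt c, (forall a, wle lt bot a) /\ forall a, wle lt a top, c bot = initial p x,
       s_state (c top) = st_halt p & s_out (c top) 0].
Proof.
split.
  move=> [W [lt [c [top [hc o]]]]]; have [run tp [bot cb bt] ha] := halting_run hc.
  by exists W, lt, c, bot, top.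
move=> [W [lt [c [bot [top [run [bt tp] cb ha o]]]]]].
by exists W, lt, c, top; split; [exact: (run_halting run tp bt)|].
Qed.
End Nittm.

(** * Machines whose cells are blocks of tape cells *)

Record mconf (I : finType) (Q : Type) := MConf {
  tp : nat -> {ffun I -> bool}; hd : nat; stt : Q }.

Definition updm (T : Type) (f : nat -> T) (i : nat) (v : T) : nat -> T :=
  fun k => if k == i then v else f k.
Definition mvh (mv : bool) (h : nat) := if mv then h.+1 else h.-1.

Section MBits.
Variables (I : finType) (Q : Type).
Definition mbit (s : mconf I Q) (k : nat * I) : bool := tp s k.1 k.2.
Definition mlimc (q : Q) (f : nat * I -> bool) : mconf I Q :=
  MConf (fun k => [ffun i => f (k, i)]) 0 q.
Lemma mbit_lim q f : mbit (mlimc q f) = f.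
Proof. by apply: funext => -[k i]; rewrite /mbit ffunE. Qed.

Lemma mconf_eq (s t : mconf I Q) : (forall k i, tp s k i = tp t k i) ->
  hd s = hd t -> stt s = stt t -> s = t.
Proof.
case: s t => T h q [T' h' q'] /= eT -> ->; congr MConf.
by apply: funext => k; apply/ffunP => i.
Qed.
End MBits.

Record mach (I : finType) := Mach {
  mQ : finType; mstart : mQ; mlim : mQ; mhalt : mQ;
  mtrans : mQ -> {ffun I -> bool} -> mQ -> {ffun I -> bool} -> bool -> Prop }.

Section MSys.
Variables (I : finType) (N : mach I).
Definition mstp (s t : mconf I (mQ N)) : Prop :=
  stt s <> mhalt N /\ exists q g mv, mtrans (stt s) (tp s (hd s)) q g mv /\
    t = MConf (updm (tp s) (hd s) g) (mvh mv (hd s)) q.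
Definition msys : tsys :=
  @TSys (mconf I (mQ N)) (nat * I)%type mstp (@mbit _ _) (mlimc (mlim N)) (@mbit_lim _ _ _).
End MSys.

Lemma plus_tpath (S : tsys) (P : conf S -> Prop) s s1 t : P s -> stp s s1 -> star P s1 t ->
  exists v, tpath s t v /\ forall k, v k -> exists2 c, P c & bit c k.
Proof.
move=> Ps ss1 /star_opath [v [p vP]]; exists (orf (bit s) v); split.
  by apply: tpath_otrans p; exact: tpath1.
by move=> k /orP [sk|/vP//]; exists s.
Qed.

(** From the last cell of block [k] one move left is made while that cell is rewritten, and
    [2 * m - 2] further ones lead to the first cell of block [k.-1]. For [k = 0] truncated
    subtraction matches a head that stays at cell 0. *)
Lemma left_move_arith m k i : i.+1 = m -> (m * k + i).-1 - (2 * m - 2) = m * k.-1.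
Proof.
move=> <-; have -> : 2 * i.+1 - 2 = i + i by rewrite mulnS addKn mul2n -addnn.
case: k => [|k]; last by rewrite (mulnS i.+1 k) !addSn !succnK addnAC addKn.
rewrite muln0; apply/eqP; rewrite subn_eq0 add0n.
exact: leq_trans (leq_pred i) (leq_addr i i).
Qed.

(** * Compilation of block machines into nondeterministic ITTMs *)

Section Compile.
Variables (J : finType) (j0 : J).
Let I : finType := (J * option bool)%type.
Variable N : mach I.

Definition rk (j : J) : nat := index j (enum J).
Definition sl (i : nat) : J := nth j0 (enum J) i.
Lemma m_gt0 : 0 < #|J|. Proof. by apply/card_gt0P; exists j0. Qed.
Lemma rk_lt j : rk j < #|J|. Proof. by rewrite /rk cardE index_mem mem_enum. Qed.
Lemma rkK j : sl (rk j) = j. Proof. by rewrite /sl nth_index // mem_enum. Qed.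
Lemma slK i : i < #|J| -> rk (sl i) = i.
Proof. by rewrite cardE => h; rewrite /rk index_uniq // enum_uniq. Qed.

Definition instr : finType := (mQ N * {ffun I -> bool} * mQ N * {ffun I -> bool} * bool)%type.
(** [Run q] stands at the first cell of a block, [Exec x i] rewrites its cell [i] under the guessed
    instruction [x], [Left q r] has [r] moves to the left to go, and [Fin] serves to produce output
    1 after [N] has halted. *)
Definition ustate : finType := (mQ N + (instr * 'I_#|J|.+1) + (mQ N * 'I_(2 * #|J|).+1) + bool)%type.
Definition Run (q : mQ N) : ustate := inl (inl (inl q)).
Definition Exec (x : instr) (i : nat) : ustate := inl (inl (inr (x, inord i))).
Definition Left (q : mQ N) (r : nat) : ustate := inl (inr (q, inord r)).
Definition leftst q r := if r == 0 then Run q else Left q r.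
Definition Fin (b : bool) : ustate := inr b.

Definition cellf (f : option bool -> bool) : cell := (f None, f (Some false), f (Some true)).
Definition cf_cell (c : cell) (t : option bool) : bool :=
  match t with None => c.1.1 | Some false => c.1.2 | Some true => c.2 end.
Lemma cf_cellK c : cellf (cf_cell c) = c. Proof. by case: c => -[]. Qed.
Lemma cellfK f : cf_cell (cellf f) = f. Proof. by apply: funext => -[[]|]. Qed.

Definition slotf (g : {ffun I -> bool}) (i : nat) : option bool -> bool := fun t => g (sl i, t).

(* The instruction for a block is guessed on entering it; its left-hand side is
   checked cell by cell while the new content is written, and a wrong guess
   leaves no transition. *)
Definition proc (x : instr) (i : nat) (f : option bool -> bool) (X : ustate)
    (g : option bool -> bool) (mv : bool) : Prop :=
  let: (q, old, q', new, d) := x in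
  f = slotf old i /\ g = slotf new i /\
  (if i.+1 < #|J| then X = Exec x i.+1 /\ mv = true
   else if d then X = Run q' /\ mv = true
   else X = leftst q' (2 * #|J| - 2) /\ mv = false).

Definition valid (x : instr) : Prop :=
  let: (q, old, q', new, d) := x in q <> mhalt N /\ mtrans q old q' new d.

(** [Fin false] walks left and may stop anywhere after writing an output 1. This is safe, as [Fin]
    is entered only when [N] has halted; completeness stops at cell 0. *)
Definition ustep (X : ustate) (f : option bool -> bool) (X' : ustate)
    (g : option bool -> bool) (mv : bool) : Prop :=
  match X with
  | inl (inl (inl q)) =>
      if q == mhalt N then X' = Fin false /\ g = f /\ mv = false
      else exists x : instr, x.1.1.1.1 = q /\ valid x /\ proc x 0 f X' g mv
  | inl (inl (inr (x, i))) => proc x i f X' g mv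
  | inl (inr (q, r)) => X' = leftst q r.-1 /\ g = f /\ mv = false
  | inr false => mv = false /\ ((X' = Fin false /\ g = f) \/ (X' = Fin true /\ g (Some true)))
  | inr true => False
  end.

Definition compiled : nittm :=
  @NITTM #|ustate| (enum_rank (Run (mstart N))) (enum_rank (Fin true))
    (enum_rank (Run (mlim N)))
    (fun a b => ustep (enum_val a.1) (cf_cell a.2) (enum_val b.1.1) (cf_cell b.1.2) b.2).

Definition mks (T : nat -> option bool -> bool) (h : nat) (X : ustate) : conf (nsys compiled) :=
  @Snap #|ustate| (fun p => T p None) (fun p => T p (Some false)) (fun p => T p (Some true))
    h (enum_rank X).

Lemma sbit_mks T h X t k : sbit (mks T h X) (t, k) = T k t.
Proof. by case: t => [[]|]. Qed.

Lemma mks_inj T h X T' h' X' : mks T h X = mks T' h' X' -> [/\ T = T', h = h' & X = X'].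
Proof.
move=> e; split.
- apply: funext => k; apply: funext => t.
  by rewrite -(sbit_mks T h X) e sbit_mks.
- by case: e.
- by move: e => [_ _ _ _ /enum_rank_inj].
Qed.

Lemma stp_mks T h X u : stp (mks T h X) u <->
  X <> Fin true /\ exists X' g mv, ustep X (T h) X' g mv /\ u = mks (updm T h g) (mvh mv h) X'.
Proof.
have cE : cell_at (mks T h X) = cellf (T h) by [].
have updE X' g mv : @apply_instr #|ustate| (mks T h X) (enum_rank X', cellf g, mv) =
    mks (updm T h g) (mvh mv h) X'.
  by rewrite /mks /apply_instr /=; congr Snap; apply: funext => k; rewrite /upd /updm; case: eqP.
split=> [[nh [[[q c] mv] [tr ->]]]|[nX [X' [g [mv [us ->]]]]]].
  split; first by move=> eX; apply: nh; rewrite /= eX.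
  exists (enum_val q), (cf_cell c), mv; rewrite -updE enum_valK cf_cellK; split=> //.
  by move: tr; rewrite /= enum_rankK cE cellfK.
split; first by move=> /= /enum_rank_inj.
exists (enum_rank X', cellf g, mv); rewrite updE /= !enum_rankK cE !cellfK; split=> //.
Qed.

Definition flat (s : mconf I (mQ N)) : nat -> option bool -> bool :=
  fun p t => tp s (p %/ #|J|) (sl (p %% #|J|), t).
Definition enc (s : mconf I (mQ N)) := mks (flat s) (#|J| * hd s) (Run (stt s)).
Definition part (s : mconf I (mQ N)) (new : {ffun I -> bool}) (i : nat) : nat -> option bool -> bool :=
  fun p t => if (p %/ #|J| == hd s) && (p %% #|J| < i) then slotf new (p %% #|J|) t else flat s p t.

Definition kap (k : nat * I) : option bool * nat := (k.2.2, #|J| * k.1 + rk k.2.1).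

Lemma divk k i : i < #|J| -> (#|J| * k + i) %/ #|J| = k.
Proof. by move=> h; rewrite mulnC divnMDl ?m_gt0 // divn_small // addn0. Qed.
Lemma modk k i : i < #|J| -> (#|J| * k + i) %% #|J| = i.
Proof. by move=> h; rewrite mulnC modnMDl modn_small. Qed.

Lemma flat_kap s k j t : flat s (#|J| * k + rk j) t = tp s k (j, t).
Proof. by rewrite /flat divk ?rk_lt // modk ?rk_lt // rkK. Qed.

Lemma sbit_enc s k : sbit (enc s) (kap k) = mbit s k.
Proof. by case: k => k [j t]; rewrite sbit_mks flat_kap. Qed.

Lemma part0 s new : part s new 0 = flat s.
Proof. by apply: funext => p; apply: funext => t; rewrite /part ltn0 andbF. Qed.

Lemma part_at s new i : i < #|J| -> part s new i (#|J| * hd s + i) = slotf (tp s (hd s)) i.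
Proof. by move=> h; apply: funext => t; rewrite /part /flat modk // divk // ltnn andbF. Qed.

Lemma part_upd s new i : i < #|J| ->
  updm (part s new i) (#|J| * hd s + i) (slotf new i) = part s new i.+1.
Proof.
move=> h; apply: funext => p; apply: funext => t; rewrite /updm.
case: eqP => [->|ne]; first by rewrite /part divk // modk // eqxx ltnSn.
rewrite /part; case: (p %/ #|J| =P hd s) => //= e.
rewrite ltnS (leq_eqVlt (p %% #|J|) i); case: (p %% #|J| =P i) => //= e'.
by case: ne; rewrite {1}(divn_eq p #|J|) e e' mulnC.
Qed.

Lemma part_full s new q h : part s new #|J| = flat (MConf (updm (tp s) (hd s) new) h q).
Proof.
apply: funext => p; apply: funext => t.
by rewrite /part /flat /updm /= ltn_mod m_gt0 andbT; case: eqP.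
Qed.

Lemma flat_inj s s' : flat s = flat s' -> tp s = tp s'.
Proof.
move=> e; apply: funext => k; apply/ffunP => -[j t].
by rewrite -!flat_kap e.
Qed.

Definition iold (x : instr) := x.1.1.1.2.
Definition inew (x : instr) := x.1.2.
Definition iq (x : instr) := x.1.1.1.1.

(** The snapshots that belong to [s]. While a block is being rewritten [s] is still the old
    configuration, and the checked part of the guess agrees with it; during the walk to the left [s]
    is already the new one. *)
Inductive mid (s : mconf I (mQ N)) (u : conf (nsys compiled)) : Prop :=
| mid_enc of u = enc s
| mid_exec x i of 0 < i < #|J| & valid x & iq x = stt s &
    (forall j, j < i -> slotf (iold x) j = slotf (tp s (hd s)) j) &
    u = mks (part s (inew x) i) (#|J| * hd s + i) (Exec x i)
| mid_left h r of 0 < r <= 2 * #|J| & h - r = #|J| * hd s &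
    u = mks (flat s) h (Left (stt s) r).

Lemma Exec_inj x i x' i' : i <= #|J| -> i' <= #|J| -> Exec x i = Exec x' i' -> x = x' /\ i = i'.
Proof. by move=> h h' [-> /(congr1 val)]; rewrite /= !inordK. Qed.

(** The guessed old content in the state remembers the overwritten cells of the block, so nothing
    about [s] is lost. This is what allows a run of the compiled machine to be projected to [N]. *)
Lemma mid_uniq s s' u : mid s u -> mid s' u -> s = s'.
Proof.
have E (T T' : nat -> {ffun I -> bool}) h h' q q' : T = T' -> h = h' -> q = q' ->
    MConf T h q = MConf T' h' q' by move=> -> -> ->.
case=> [->|x i /andP [i0 im] v xq xo ->|h r /andP [r0 rm] hr ->].
- case=> [/mks_inj [/flat_inj eT /eqP eh [eq]]|x i _ _ _ _ /mks_inj [] //|h r _ _ /mks_inj [] //].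
  case: s s' eT eh eq => T h q [T' h' q'] /= -> eh ->; congr MConf.
  by move: eh; rewrite eqn_pmul2l ?m_gt0 // => /eqP.
- case=> [/mks_inj [] //|x' i' /andP [i0' im'] v' xq' xo' /mks_inj [eT eh ex]|h r _ _ /mks_inj [] //].
  have [exx ei] := Exec_inj (ltnW im) (ltnW im') ex; subst x' i'.
  move/eqP: eh; rewrite eqn_add2r eqn_pmul2l ?m_gt0 // => /eqP eh.
  apply: mconf_eq => //; last by rewrite -xq.
  move=> k [j t]; have := congr1 (fun f => f (#|J| * k + rk j) t) eT.
  rewrite /part !divk ?rk_lt // !modk ?rk_lt // !flat_kap -eh.
  case: (k =P hd s) => //= ->; case: (ltnP (rk j) i) => // ji _.
  have := congr1 (fun f => f t) (xo _ ji); have := congr1 (fun f => f t) (xo' _ ji).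
  by rewrite /slotf rkK eh => <- <-.
case=> [/mks_inj [] //|x i _ _ _ _ /mks_inj [] //|h' r' /andP [r0' rm'] hr' /mks_inj [/flat_inj eT eh]].
move=> [eq /(congr1 val)] /=; rewrite !inordK // => er; subst h' r'.
case: s s' eT eq hr hr' => T k q [T' k' q'] /= -> -> -> /eqP.
by rewrite eqn_pmul2l ?m_gt0 // => /eqP ->.
Qed.

(** The guess is verified in full only at the last cell of the block; there [iold x] is known to be
    the whole block content, and the step of [N] is justified. *)
Lemma proc_mid s x i X' g mv : valid x -> iq x = stt s -> i < #|J| ->
  (forall j, j < i -> slotf (iold x) j = slotf (tp s (hd s)) j) ->
  proc x i (part s (inew x) i (#|J| * hd s + i)) X' g mv ->
  let u' := mks (updm (part s (inew x) i) (#|J| * hd s + i) g) (mvh mv (#|J| * hd s + i)) X' in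
  (i.+1 < #|J| /\ u' = mks (part s (inew x) i.+1) (#|J| * hd s + i.+1) (Exec x i.+1) /\ mid s u')
  \/ exists s', [/\ @stp (msys N) s s', mid s' u', u' = enc s' \/ exists h r, r <= 2 * #|J| /\ u' = mks (flat s') h (Left (stt s') r) &
      forall k, hd s = k -> tp s' k = inew x].
Proof.
case: x => [[[[q old] q'] new] d] /=; rewrite /iold /iq /inew /= => -[nq tr] eq im xo.
rewrite part_at // => -[eo [-> nx]]; rewrite part_upd //.
have xo' j : j < i.+1 -> slotf old j = slotf (tp s (hd s)) j.
  by rewrite ltnS leq_eqVlt => /orP [/eqP ->|/xo].
case: ltnP nx => [im' [-> ->]|mi nx]; rewrite /mvh /=.
  left; split=> //; rewrite addnS; split=> //; rewrite -addnS.
  by apply: (mid_exec (x := (q, old, q', new, d)) (i := i.+1)).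
have em : i.+1 = #|J| by apply/eqP; rewrite eqn_leq im mi.
have eold : old = tp s (hd s).
  apply/ffunP => -[j t]; have := congr1 (fun f => f t) (xo' (rk j) _).
  by rewrite /slotf rkK em => ->; rewrite ?rk_lt.
right; exists (MConf (updm (tp s) (hd s) new) (mvh d (hd s)) q').
have st : @stp (msys N) s (MConf (updm (tp s) (hd s) new) (mvh d (hd s)) q').
  by split; [rewrite -eq|exists q', new, d; rewrite -eold -eq].
rewrite em (part_full _ _ q' (mvh d (hd s))).
have tpk k : hd s = k -> updm (tp s) (hd s) new k = new by move=> <-; rewrite /updm eqxx.
case: d nx st tr => /= -[-> ->] st _.
  have -> : mks (flat (MConf (updm (tp s) (hd s) new) (hd s).+1 q')) (#|J| * hd s + i).+1 (Run q')
    = enc (MConf (updm (tp s) (hd s) new) (hd s).+1 q').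
    by rewrite /enc /= -addnS em mulnS addnC.
  by split=> //; [exact: mid_enc|left].
rewrite /leftst; case: eqP => [e0|n0].
  have m1 : #|J| = 1.
    apply/eqP; rewrite eqn_leq m_gt0 andbT.
    by move/eqP: e0; rewrite subn_eq0 -{2}[2]muln1 leq_pmul2l.
  have i0 : i = 0 by move: em; rewrite m1 => -[].
  have -> : mks (flat (MConf (updm (tp s) (hd s) new) (hd s).-1 q')) (#|J| * hd s + i).-1 (Run q')
    = enc (MConf (updm (tp s) (hd s) new) (hd s).-1 q').
    rewrite /enc /= i0 addn0; congr mks.
    by move: m1; case: #|J| (hd s) => [|[|?]] // k _; rewrite !mul1n.
  by split=> //; [exact: mid_enc|left].
split=> //; last first.
  right; exists (#|J| * hd s + i).-1, (2 * #|J| - 2); split=> //; exact: leq_subr.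
apply: (mid_left (h := (#|J| * hd s + i).-1) (r := 2 * #|J| - 2)) => //=.
  by rewrite leq_subr lt0n; apply/andP; split=> //; apply/eqP.
exact: left_move_arith em.
Qed.

Lemma mid_step s u u' : mid s u -> stp u u' ->
  [\/ stt s = mhalt N /\ forall s', ~ mid s' u', mid s u' |
    exists s', [/\ @stp (msys N) s s', mid s' u' &
      u' = enc s' \/ exists h r, r <= 2 * #|J| /\ u' = mks (flat s') h (Left (stt s') r)]].
Proof.
case=> [->|x i /andP [i0 im] v xq xo ->|h r /andP [r0 rm] hr ->] /stp_mks [nX [X' [g [mv [us ->]]]]].
- move: us => /=; case: eqP => [e [-> _]|ne [x [xq [v pr]]]].
    constructor 1; split=> // s'.
    by case=> [/mks_inj []|x i _ _ _ _ /mks_inj []|h r _ _ /mks_inj []].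
  have v0 j : j < 0 -> slotf (iold x) j = slotf (tp s (hd s)) j by [].
  rewrite -(addn0 (#|J| * hd s)) -(part0 s (inew x)) in pr *.
  case: (proc_mid v xq m_gt0 v0 pr) => [[_ [_ h]]|[s' [st h e _]]]; first by constructor 2.
  by constructor 3; exists s'.
- have {}us : proc x i (part s (inew x) i (#|J| * hd s + i)) X' g mv.
    by move: us; rewrite /= inordK // ltnW.
  case: (proc_mid v xq im xo us) => [[_ [_ h]]|[s' [st h e _]]]; first by constructor 2.
  by constructor 3; exists s'.
move: us => /=; rewrite inordK // => -[-> [-> ->]]; constructor 2.
have -> : updm (flat s) h (flat s h) = flat s.
  by apply: funext => k; rewrite /updm; case: eqP => [->|].
have hr' : h.-1 - r.-1 = #|J| * hd s by rewrite -hr; case: (h) (r) r0 => [|a] [|b].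
rewrite /leftst /mvh; case: eqP => [r1|/eqP r1].
  by apply: mid_enc; rewrite /enc -hr' r1 subn0.
apply: (mid_left (h := h.-1) (r := r.-1)) => //.
by rewrite lt0n r1 /=; exact: leq_trans (leq_pred r) rm.
Qed.
End Compile.

(** * Correctness of the compilation *)

Section CompileSpec.
Variables (J : finType) (j0 : J).
Let I : finType := (J * option bool)%type.
Variable N : mach I.
Local Notation cN := (compiled j0 N).
Local Notation "'mks_'" := (@mks J j0 N).
Implicit Types s : mconf I (mQ N).

Definition minit (x : real) : mconf I (mQ N) :=
  MConf (fun k => [ffun i : I => if i.2 is None then x (#|J| * k + rk i.1) else false]) 0 (mstart N).

Lemma enc_minit x : enc j0 (minit x) = initial cN x.
Proof.
rewrite /enc /mks /initial /= muln0; congr Snap; apply: funext => k; rewrite /flat /= ffunE //=.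
have lt := ltn_pmod k (m_gt0 j0); rewrite slK // mulnC -divn_eq //.
Qed.

Lemma lim_enc f g : (forall k, g (kap k) = f k) -> slim cN g = enc j0 (mlimc (mlim N) f).
Proof.
move=> gf; rewrite /enc /mks /slim /= muln0.
have E t p : g (t, p) = flat j0 (mlimc (mlim N) f) p t.
  rewrite /flat /= ffunE -gf /kap /= slK ?ltn_mod ?(m_gt0 j0) //.
  by rewrite [#|J| * _]mulnC -divn_eq.
by congr Snap; apply: funext => k; exact: E.
Qed.

Section Step.
Variables (s : mconf I (mQ N)) (x : instr N).
Hypotheses (v : valid x) (xq : iq x = stt s) (xo : iold x = tp s (hd s)).
Let s' : mconf I (mQ N) := MConf (updm (tp s) (hd s) (inew x)) (mvh x.2 (hd s)) x.1.1.2.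
Let P (c : conf (nsys cN)) := forall k, bit c (kap k) -> mbit s k || mbit s' k.

Lemma flat_P h X : P (mks_ (flat j0 s') h X).
Proof. by move=> [k [j t]]; rewrite /= sbit_mks flat_kap => h'; rewrite /mbit /= h' orbT. Qed.

Lemma left_star r h : r <= 2 * #|J| -> h - r = #|J| * hd s' ->
  star P (mks_ (flat j0 s') h (leftst (stt s') r)) (enc j0 s').
Proof.
elim: r h => [|r IH] h rm hr; first by rewrite /enc -hr subn0; exact: star0.
apply: (starS (t := mks_ (flat j0 s') h.-1 (leftst (stt s') r))).
- exact: flat_P.
- apply/stp_mks; split=> //; exists (leftst (stt s') r), (flat j0 s' h), false; split.
    by rewrite /= inordK.
  congr mks; apply: funext => k; rewrite /updm.
  by case: eqP => [->|].
- apply: IH; first exact: ltnW.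
  by rewrite -hr; case: (h).
Qed.

Let ui i := mks_ (part j0 s (inew x) i) (#|J| * hd s + i) (if i is 0 then Run (stt s) else Exec x i).

Lemma ui_P i : P (ui i).
Proof.
move=> [k [j t]]; rewrite /= sbit_mks /part divk ?rk_lt // modk ?rk_lt // flat_kap.
case: (k =P hd s) => [->|_] /=; last by rewrite /mbit /= => ->.
case: ifP => _; last by rewrite /mbit /= => ->.
by rewrite /slotf rkK /mbit /= /updm eqxx => ->; rewrite orbT.
Qed.

Lemma exec_star i : i < #|J| -> exists u1, stp (ui i) u1 /\ star P u1 (enc j0 s').
Proof.
move=> im; move: {2}(#|J| - i) (erefl (#|J| - i)) => d; elim: d i im => [|d IH] i im ed.
  by move/eqP: ed; rewrite subn_eq0 leqNgt im.
have st X' mv : proc j0 x i (part j0 s (inew x) i (#|J| * hd s + i)) X' (slotf j0 (inew x) i) mv ->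
    stp (ui i) (mks_ (part j0 s (inew x) i.+1) (mvh mv (#|J| * hd s + i)) X').
  move=> pr; apply/stp_mks; split; first by case: (i).
  exists X', (slotf j0 (inew x) i), mv; rewrite part_upd //; split=> //.
  case: i im {ed} pr => [|i] im pr /=; last by rewrite inordK // ltnW.
  case: ifP => [/eqP e|_]; last by exists x.
  by move: v xq; rewrite /valid /iq; case: (x) => [[[[q old] q'] new] dd] /= [nq _] qe; case: nq; rewrite qe.
have po : part j0 s (inew x) i (#|J| * hd s + i) = slotf j0 (iold x) i by rewrite part_at // xo.
have xE : x = (iq x, iold x, x.1.1.2, inew x, x.2) by case: (x) => [[[[q old] q'] new] dd].
case: (ltnP i.+1 #|J|) => [im'|mi].
  exists (ui i.+1); split.
    have := st (Exec x i.+1) true; rewrite /ui addnS; apply.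
    by rewrite po {1}xE /proc im' -xE.
  have [|u1 [s1 s2]] := IH i.+1 im'; first by rewrite subnS ed.
  by apply: starS s1 s2; exact: ui_P.
have em : i.+1 = #|J| by apply/eqP; rewrite eqn_leq im mi.
have fE : part j0 s (inew x) i.+1 = flat j0 s' by rewrite em (part_full j0 s _ x.1.1.2 (mvh x.2 (hd s))).
case ex: x.2.
  exists (enc j0 s'); split; last exact: star0.
  have := st (Run x.1.1.2) true; rewrite fE.
  have -> : mvh true (#|J| * hd s + i) = #|J| * hd s' by rewrite /s' /= ex /mvh -addnS em mulnS addnC.
  by apply; rewrite po {1}xE /proc ltnNge mi /= ex.
have := st (leftst x.1.1.2 (2 * #|J| - 2)) false; rewrite fE => h.
exists (mks_ (flat j0 s') (#|J| * hd s + i).-1 (leftst x.1.1.2 (2 * #|J| - 2))); split.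
  by apply: h; rewrite po {1}xE /proc ltnNge mi /= ex.
apply: left_star; first exact: leq_subr.
by rewrite /s' /= ex; exact: left_move_arith em.
Qed.

Lemma compile_step : exists w, tpath (enc j0 s) (enc j0 s') w /\
  forall k, w (kap k) -> mbit s k || mbit s' k.
Proof.
have [u1 [s1 s2]] := exec_star (m_gt0 j0).
have e0 : ui 0 = enc j0 s by rewrite /ui part0 addn0.
rewrite e0 in s1; have P0 : P (enc j0 s) by rewrite -e0; exact: ui_P.
have [w [pw wP]] := plus_tpath P0 s1 s2.
by exists w; split=> // k /wP [c]; exact.
Qed.
End Step.

Lemma compile_path s t v : @tpath (msys N) s t v -> exists w, tpath (enc j0 s) (enc j0 t) w.
Proof.
move=> p; have [|||u' [w [pw eu _ _ _]]] := @forward_sim (msys N) (nsys cN)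
  (fun s u => u = enc j0 s) (@kap J) (fun _ => None) _ _ _ s t v p (enc j0 s) erefl.
- by move=> a u ->; split=> // k; exact: sbit_enc.
- move=> a u b -> [na [q [g [mv [tr eb]]]]].
  have [|||w [pw wb]] := @compile_step a (stt a, tp a (hd a), q, g, mv) => //.
  by exists (enc j0 b), w; rewrite eb; split.
- move=> f g gf _; exists (enc j0 (mlimc (mlim N) f)), (fun _ => false); split=> //.
  by left; split=> //; exact: lim_enc.
- by exists w; rewrite -eu.
Qed.

Lemma fin_star T h : exists u, [/\ star (fun _ => True) (mks_ T h (Fin N false)) u,
  s_state u = st_halt cN & s_out u 0].
Proof.
elim: h T => [|h IH] T.
  exists (mks_ (updm T 0 (fun _ => true)) 0 (Fin N true)); split=> //.
  apply: star1 => //; apply/stp_mks; split=> //.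
  by exists (Fin N true), (fun _ => true), false; split=> //=; split=> //; right.
have [u [st hu ou]] := IH T; exists u; split=> //; apply: starS st => //.
apply/stp_mks; split=> //; exists (Fin N false), (T h.+1), false; split.
  by split=> //; left.
by congr mks; apply: funext => k; rewrite /updm; case: eqP => [->|].
Qed.

Lemma compiled_complete x s v : @opath (msys N) (minit x) s v -> stt s = mhalt N ->
  exists W (lt : W -> W -> Prop) c top,
     halting_computation cN x lt c top /\ outputs_one (c top).
Proof.
move=> p hs; apply/nsys_accepts.
have {p} [w pw] : exists w, opath (enc j0 (minit x)) (enc j0 s) w.
  case: p => [[-> _]|/compile_path [w pw]]; last by exists w; right.
  by exists (fun _ => false); left.
have [u [st hu ou]] := fin_star (flat j0 s) (#|J| * hd s).-1.
have s1 : stp (enc j0 s) (mks_ (flat j0 s) (#|J| * hd s).-1 (Fin N false)).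
  apply/stp_mks; split=> //; exists (Fin N false), (flat j0 s (#|J| * hd s)), false.
  rewrite /= hs eqxx; split=> //.
  by congr mks; apply: funext => k; rewrite /updm; case: eqP => [->|].
have [w1 [pw1 _]] := plus_tpath (P := fun _ => True) Logic.I s1 st.
have [W [lt [c [bot [top [run bt tp cb ct]]]]]] := tpath_run (opath_ttrans pw pw1).
exists W, lt, c, bot, top; rewrite ct cb enc_minit; split=> //.
by split=> a; [case: (bt a) => [->|]; [left|right]|exact: tp].
Qed.

Section Sound.
Variables (W : Type) (lt : W -> W -> Prop) (c : W -> conf (nsys cN)).
Hypothesis run : is_run lt c.
Let wo : is_wellorder lt. Proof. by case: run. Qed.
Variables (a0 z : W).
Variable c1 : W -> conf (msys N).
Hypothesis c1P : forall a, wle lt a0 a -> wle lt a z -> mid (c1 a) (c a).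

Lemma c1_uniq a s : wle lt a0 a -> wle lt a z -> mid s (c a) -> c1 a = s.
Proof. by move=> h1 h2; apply: mid_uniq; exact: c1P. Qed.

Lemma mid_lim b : wle lt a0 b -> wle lt b z -> is_limit lt b ->
  c1 b = mlimc (mlim N) (fun k => wlimsup lt c b (kap k)).
Proof.
move=> h1 h2 lb; apply: c1_uniq => //; apply: mid_enc.
by case: run => _ _ /(_ b lb) ->; exact: lim_enc.
Qed.

Lemma c1_succ a b : wle lt a0 a -> wle lt b z -> succ_of lt a b ->
  c1 a = c1 b \/ stp (c1 a) (c1 b).
Proof.
move=> a0a bz ab; have ltab := succ_lt ab.
have az : wle lt a z by right; exact: (wlt_le wo ltab).
have a0b : wle lt a0 b by right; exact: (wle_lt wo a0a).
case: run => _ /(_ a b ab) st _.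
case: (mid_step (c1P a0a az) st) => [[_ /(_ _ (c1P a0b bz)) []]|h|[s' [h1 h2 _]]].
  by left; apply/esym; exact: c1_uniq.
by right; rewrite (c1_uniq a0b bz h2).
Qed.

Definition execs a x i := [/\ 0 < i < #|J|, valid x, iq x = stt (c1 a),
  (forall j, j < i -> slotf j0 (iold x) j = slotf j0 (tp (c1 a) (hd (c1 a))) j) &
  c a = mks_ (part j0 (c1 a) (inew x) i) (#|J| * hd (c1 a) + i) (Exec x i)].
(** No block is half rewritten, so the tape of [c a] is exactly that of [c1 a]. *)
Definition tidy a := exists h X, c a = mks_ (flat j0 (c1 a)) h X /\ forall x i, X <> Exec x i.

Lemma c_forms a : wle lt a0 a -> wle lt a z -> tidy a \/ exists x i, execs a x i.
Proof.
move=> h1 h2; case: (c1P h1 h2) => [e|x i i0 v xq xo e|h r _ _ e].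
- by left; exists (#|J| * hd (c1 a)), (Run (stt (c1 a))).
- by right; exists x, i.
- by left; exists h, (Left (stt (c1 a)) r).
Qed.

Lemma tidy_bit a k : tidy a -> bit (c a) (kap k) = bit (c1 a) k.
Proof. by case: k => k [j t] [h [X [-> _]]]; rewrite [LHS]sbit_mks flat_kap. Qed.

Section Limit.
Variable b : W.
Hypotheses (bz : wle lt b z) (lb : is_limit lt b).

Let inz a : lt a b -> wle lt a z.
Proof. by move=> ab; right; exact: (wlt_le wo ab). Qed.

Definition proper a a' a'' := [/\ wle lt a a', succ_of lt a' a'', lt a'' b & stp (c1 a') (c1 a'')].

Lemma proper_le a d a' a'' : wle lt a d -> proper d a' a'' -> proper a a' a''.
Proof. by move=> ad [h1 h2 h3 h4]; split=> //; exact: (wle_trans wo ad). Qed.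

Lemma proc_prog a x i X' g mv d : wle lt a0 a -> lt a b -> i < #|J| -> valid x -> iq x = stt (c1 a) ->
  (forall j, j < i -> slotf j0 (iold x) j = slotf j0 (tp (c1 a) (hd (c1 a))) j) ->
  proc j0 x i (part j0 (c1 a) (inew x) i (#|J| * hd (c1 a) + i)) X' g mv ->
  succ_of lt a d -> lt d b ->
  c d = mks_ (updm (part j0 (c1 a) (inew x) i) (#|J| * hd (c1 a) + i) g)
     (mvh mv (#|J| * hd (c1 a) + i)) X' ->
  (c1 d = c1 a /\ execs d x i.+1) \/
  [/\ stp (c1 a) (c1 d), tidy d & tp (c1 d) (hd (c1 a)) = inew x].
Proof.
move=> a0a ab im v xq xo pr ad db cd.
have a0d : wle lt a0 d by right; exact: (wle_lt wo a0a (succ_lt ad)).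
case: (proc_mid v xq im xo pr) => /=; rewrite -cd.
  move=> [im' [e h]]; left; have ec := c1_uniq a0d (inz db) h.
  split=> //; split=> //; rewrite ?ec //.
  move=> j; rewrite ltnS leq_eqVlt => /orP [/eqP ->|/xo //].
  by case: (x) pr => [[[[q old] q'] new] dd] [h1 _]; rewrite part_at // in h1.
move=> [s' [st h e tpk]]; right; have ec := c1_uniq a0d (inz db) h.
rewrite ec; split=> //; last exact: tpk.
rewrite /tidy ec; case: e => [->|[h' [r [_ ->]]]]; last by exists h', (Left (stt s') r).
by exists (#|J| * hd s'), (Run (stt s')).
Qed.

(** Fewer than [#|J|] successor stages complete a started instruction, and they all lie below the
    limit [b]; a wrong guess would have no successor there. *)
Lemma exec_prog a x i : wle lt a0 a -> lt a b -> execs a x i ->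
  exists a' a'', [/\ proper a a' a'', tidy a'' & tp (c1 a'') (hd (c1 a)) = inew x].
Proof.
move: {2}(#|J| - i) (erefl (#|J| - i)) => n; elim: n i a => [|n IH] i a en a0a ab.
  by case=> /andP [_ im]; move/eqP: en; rewrite subn_eq0 leqNgt im.
case=> /andP [i0 im] v xq xo ca.
have [d ad db] := limit_succ wo lb ab.
have := (let: And3 _ h _ := run in h) a d ad; rewrite ca.
move=> /stp_mks [_ [X' [g [mv [/= us cd]]]]]; rewrite inordK in us; last exact: ltnW.
have a0d : wle lt a0 d by right; exact: (wle_lt wo a0a (succ_lt ad)).
case: (proc_prog a0a ab im v xq xo us ad db cd) => [[ec ex]|[st td tpk]].
  have [|a' [a'' [pr td tpk]]] := IH i.+1 d _ a0d db ex; first by rewrite subnS en.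
  exists a', a''; rewrite -ec; split=> //; apply: proper_le pr.
  by right; exact: succ_lt ad.
by exists a, d; split=> //; split=> //; left.
Qed.

Lemma enc_prog a : wle lt a0 a -> lt a b -> c a = enc j0 (c1 a) ->
  exists a' a'', proper a a' a''.
Proof.
move=> a0a ab ca; have [d ad db] := limit_succ wo lb ab.
have := (let: And3 _ h _ := run in h) a d ad; rewrite ca.
have a0d : wle lt a0 d by right; exact: (wle_lt wo a0a (succ_lt ad)).
move=> /stp_mks [_ [X' [g [mv [/= us cd]]]]]; case: eqP us => [_ [e _]|_ [x [xq [v pr]]]].
  move: cd; rewrite e => cd.
  by have := c1P a0d (inz db); rewrite cd; case=> [/mks_inj []|y i _ _ _ _ /mks_inj []|h r _ _ /mks_inj []].
rewrite -(addn0 (#|J| * _)) -(part0 j0 _ (inew x)) in pr cd.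
have v0 j : j < 0 -> slotf j0 (iold x) j = slotf j0 (tp (c1 a) (hd (c1 a))) j by [].
case: (proc_prog a0a ab (m_gt0 j0) v xq v0 pr ad db cd) => [[ec ex]|[st td tpk]].
  have [a' [a'' [pp _ _]]] := exec_prog a0d db ex.
  by exists a', a''; apply: proper_le pp; right; exact: succ_lt ad.
by exists a, d; split=> //; left.
Qed.

Lemma left_prog r a h : wle lt a0 a -> lt a b -> 0 < r <= 2 * #|J| ->
  c a = mks_ (flat j0 (c1 a)) h (Left (stt (c1 a)) r) -> exists a' a'', proper a a' a''.
Proof.
elim: r a h => [//|r IH] a h a0a ab /andP [_ rm] ca.
have [d ad db] := limit_succ wo lb ab.
have := (let: And3 _ h _ := run in h) a d ad; rewrite ca.
have a0d : wle lt a0 d by right; exact: (wle_lt wo a0a (succ_lt ad)).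
move=> /stp_mks [_ [X' [g [mv [/= [eX _] cd]]]]]; rewrite inordK // in eX.
have ad' : wle lt a d by right; exact: succ_lt ad.
suff [a' [a'' pp]] : exists a' a'', proper d a' a'' by exists a', a''; exact: proper_le pp.
case: (c1P a0d (inz db)) => [cd'|x i i0 v xq xo cd'|h' r' hr' _ cd'].
- exact: enc_prog.
- move: cd; rewrite cd' => /mks_inj [_ _]; rewrite eX /leftst.
  by case: eqP.
apply: (IH d h') => //.
  move: cd; rewrite cd' => /mks_inj [_ _]; rewrite eX /leftst.
  by case: eqP => // /eqP; rewrite -lt0n => -> _; exact: ltnW.
move: cd; rewrite {1}cd' => /mks_inj [_ _]; rewrite eX /leftst.
case: eqP => // _ [_ /(congr1 val)] /=; case/andP: hr' => _ hr'.
by rewrite !inordK //= => [<-|]; last exact: ltnW.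
Qed.

Lemma mid_prog a : wle lt a0 a -> lt a b -> exists a' a'', proper a a' a''.
Proof.
move=> a0a ab; case: (c1P a0a (inz ab)) => [ca|x i i0 v xq xo e|h r hr _ ca].
- exact: enc_prog.
- have ex : execs a x i by [].
  by have [a' [a'' [pp _ _]]] := exec_prog a0a ab ex; exists a', a''.
- exact: left_prog hr ca.
Qed.

Lemma mid_tidy a : wle lt a0 a -> lt a b -> exists a1, [/\ wle lt a a1, lt a1 b & tidy a1].
Proof.
move=> a0a ab; case: (c_forms a0a (inz ab)) => [t|[x [i ex]]].
  by exists a; split=> //; left.
have [a' [a'' [[h1 h2 h3 _] t _]]] := exec_prog a0a ab ex.
by exists a''; split=> //; right; exact: (wle_lt wo h1 (succ_lt h2)).
Qed.

(** A new bit already written into a half-rewritten block belongs to [c1] once the instruction is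
    complete, which happens before the limit. *)
Lemma bit_forward a k : wle lt a0 a -> lt a b -> bit (c a) (kap k) ->
  exists a', [/\ wle lt a a', lt a' b & bit (c1 a') k].
Proof.
move=> a0a ab; case: (c_forms a0a (inz ab)) => [t|[x [i ex]]].
  by rewrite tidy_bit // => h; exists a; split=> //; left.
have [a' [a'' [[h1 h2 h3 _] t tpk]]] := exec_prog a0a ab ex.
case: ex => _ _ _ _ ca; case: k => k [j t0]; rewrite ca -[bit _ _]/(sbit _ _) sbit_mks.
rewrite /part divk ?rk_lt // modk ?rk_lt // flat_kap.
case: (k =P hd (c1 a)) => [->|_] /=; last by move=> h; exists a; split=> //; left.
case: ifP => _; last by move=> h; exists a; split=> //; left.
rewrite /slotf rkK => h; exists a''; split=> //.
  by right; exact: (wle_lt wo h1 (succ_lt h2)).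
by rewrite /bit /= /mbit /= tpk.
Qed.

(** An old bit that has been overwritten was visible when the instruction began. Since [a1] is tidy,
    that earlier stage does not lie before [a1]. *)
Lemma bit_backward a1 k : wle lt a0 a1 -> tidy a1 -> forall a, wle lt a1 a -> lt a b ->
  bit (c1 a) k -> exists a', [/\ wle lt a1 a', wle lt a' a & bit (c a') (kap k)].
Proof.
move=> a01 t1 a; elim/(well_founded_ind (wo_wf wo)): a => a IH a1a ab h.
have a0a := wle_trans wo a01 a1a.
case: (c_forms a0a (inz ab)) => [t|[x [i [i0 v xq xo ca]]]].
  by exists a; split=> //; [left|rewrite tidy_bit].
have lt1 : lt a1 a.
  case: a1a => // e; case: t1 => h' [X []]; subst a1; rewrite ca.
  by move=> /mks_inj [_ _ <-] /(_ x i).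
have [d da] : exists d, succ_of lt d a.
  case: (wo_cases lt a) => [/(_ _ lt1) //|//|la].
  have ea : c a = enc j0 (mlimc (mlim N) (fun k => wlimsup lt c a (kap k))).
    by case: run => _ _ /(_ a la) ->; exact: lim_enc.
  by move: ca; rewrite ea => /mks_inj [].
have a1d := lt_succ_wle wo da lt1.
have a0d := wle_trans wo a01 a1d.
have db := wo_trans wo (succ_lt da) ab.
have st := (let: And3 _ l _ := run in l) d a da.
have ed : c1 d = c1 a.
  case: (mid_step (c1P a0d (inz db)) st) => [[_ /(_ _ (c1P a0a (inz ab))) []]|md|[s' [_ _ e]]].
    by apply/esym; exact: (c1_uniq a0a (inz ab) md).
  by move: e; rewrite ca => -[/mks_inj []|[h' [r [_ /mks_inj []]]]].
rewrite -ed in h.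
have [a' [h1 h2 h3]] := IH d (succ_lt da) a1d db h.
by exists a'; split=> //; right; exact: (wle_lt wo h2 (succ_lt da)).
Qed.

Lemma c1_limit : lt a0 b -> c1 b = lmc (wlimsup lt c1 b).
Proof.
move=> a0b; rewrite mid_lim //; last by right.
congr mlimc; apply: funext => k; apply/asboolP/asboolP => h a ab.
  have [a1 [a01 a1a a1b]] : exists a1, [/\ wle lt a0 a1, wle lt a a1 & lt a1 b].
    case: (wle_total wo a0 a) => h'; first by exists a; split=> //; left.
    by exists a0; split=> //; [left|right].
  have [a' [h1 h2 h3]] := h a1 a1b.
  have [d [h4 h5 h6]] := bit_forward (or_intror (wle_lt wo a01 h1)) h2 h3.
  by exists d; split=> //; exact: (wlt_le wo (wle_lt wo a1a h1)).
have [a1 [a01 a1a a1b]] : exists a1, [/\ wle lt a0 a1, lt a a1 & lt a1 b].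
  case: (wle_total wo a0 a) => h'; last by exists a0; split=> //; left.
  have [d ad db] := limit_succ wo lb ab; exists d; split=> //.
    by right; exact: (wle_lt wo h' (succ_lt ad)).
  exact: succ_lt ad.
have [a2 [a12 a2b t2]] := mid_tidy a01 a1b.
have [a' [h1 h2 h3]] := h a2 a2b.
have a02 := wle_trans wo a01 a12.
have [d [h4 h5 h6]] := bit_backward a02 t2 (or_intror h1) h2 h3.
exists d; split=> //; first exact: (wlt_le wo a1a (wle_trans wo a12 h4)).
exact: (wle_lt wo h5).
Qed.

End Limit.

Lemma mid_reflect b : wle lt b z -> lt a0 b -> c1 a0 = c1 b \/ exists v, tpath (c1 a0) (c1 b) v.
Proof.
move=> bz a0b; have [||e|[v [p _]]] := @reflect_run (msys N) W lt wo c1 a0 z _ _ b bz a0 (or_introl erefl) a0b.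
- exact: c1_succ.
- move=> d a0d dz ld; split; first exact: c1_limit.
  by move=> a a0a ad; exact: mid_prog.
- by left.
- by right; exists v.
Qed.
End Sound.

(** The halting snapshot is no [mid], so there is a first stage that is not. It is no limit, and a
    step can leave [mid] only from the halting state of [N]; the run up to that step projects to a
    computation of [N]. *)
Lemma compiled_sound x W (lt : W -> W -> Prop) c top :
  halting_computation cN x lt c top -> outputs_one (c top) ->
  exists s v, @opath (msys N) (minit x) s v /\ stt s = mhalt N.
Proof.
move=> hc _; have [run tp [bot cb bt] ha] := halting_run hc.
have wo : is_wellorder lt by case: run.
pose P a := exists s, mid s (c a : conf (nsys cN)).
have Pb : P bot by exists (minit x); apply: mid_enc; rewrite cb enc_minit.
have nP : ~ P top.
  have E T h X : s_state (mks_ T h X) = st_halt cN -> X = Fin N true by move=> /enum_rank_inj.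
  by case=> s [e|y i _ _ _ _ e|h r _ _ e]; rewrite e in ha; have := E _ _ _ ha.
have [b [lb bt' nPb Pa]] := first_exit wo Pb (bt top) nP.
have [a ab] : exists a, succ_of lt a b.
  case: (wo_cases lt b) => [/(_ _ lb) //|//|limb]; case: nPb.
  exists (mlimc (mlim N) (fun k => wlimsup (S := nsys cN) lt c b (kap k))); apply: mid_enc.
  by case: run => _ _ /(_ b limb) ->; exact: lim_enc.
have ba : wle lt bot a := bt a.
have lab := succ_lt ab.
have mids d : wle lt bot d -> wle lt d a -> P d.
  by move=> h1 h2; apply: Pa => //; exact: (wle_lt wo h2).
have [c1 c1P] : exists c1 : W -> mconf I (mQ N), forall d, wle lt d a -> mid (c1 d) (c d).
  have /choice [c1 c1P] : forall d, exists s, wle lt d a -> mid s (c d).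
    move=> d; case: (EM (wle lt d a)) => h; last by exists (minit x).
    by have [s ms] := mids d (bt d) h; exists s.
  by exists c1.
have c1b : c1 bot = minit x.
  by apply: (mid_uniq (c1P _ ba)); apply: mid_enc; rewrite cb enc_minit.
have hlt : stt (c1 a) = mhalt N.
  have := (let: And3 _ h _ := run in h) a b ab.
  move=> /(mid_step (c1P a (or_introl erefl))) [[]//|m|[s' [_ m _]]]; case: nPb; last by exists s'.
  by exists (c1 a).
have [v pv] : exists v, @opath (msys N) (c1 bot) (c1 a) v.
  case: ba => [<-|ba]; first by exists (fun _ => false); left.
  have c1P' d : wle lt bot d -> wle lt d a -> mid (c1 d) (c d) by move=> _; exact: c1P.
  case: (@mid_reflect W lt c run bot a c1 c1P' a (or_introl erefl) ba) => [e|[v pv]].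
    by rewrite -e; exists (fun _ => false); left.
  by exists v; right.
by exists (c1 a), v; rewrite -c1b.
Qed.

Theorem compiled_spec x :
  (exists W (lt : W -> W -> Prop) c top,
     halting_computation cN x lt c top /\ outputs_one (c top)) <->
  exists s v, @opath (msys N) (minit x) s v /\ stt s = mhalt N.
Proof.
split; first by move=> [W [lt [c [top [hc o]]]]]; exact: compiled_sound hc o.
by move=> [s [v [p h]]]; exact: compiled_complete p h.
Qed.
End CompileSpec.

(** * Loop detection *)

(** A dedicated limit state is entered at limits only, which shows the loop machine where saving and
    comparing are possible. The labels in [L] are read only. *)
Record umach (L Wk : finType) := UMach {
  uQ : finType; ustart : uQ; ulim : uQ; uacc : uQ; urej : uQ;
  udelta : uQ -> (L -> bool) -> {ffun option Wk -> bool} -> uQ * {ffun option Wk -> bool} * bool;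
  ulim_dedicated : ustart <> ulim /\ forall q l w, (udelta q l w).1.1 <> ulim }.

Section USys.
Variables (L Wk : finType) (U : umach L Wk) (ro : nat -> L -> bool).
Definition ufinal (q : uQ U) : bool := (q == uacc U) || (q == urej U).
Definition unext (s : mconf (option Wk) (uQ U)) : mconf (option Wk) (uQ U) :=
  let d := udelta (stt s) (ro (hd s)) (tp s (hd s)) in
  MConf (updm (tp s) (hd s) d.1.2) (mvh d.2 (hd s)) d.1.1.
Definition ustp (s t : mconf (option Wk) (uQ U)) : Prop := ~~ ufinal (stt s) /\ t = unext s.
Definition usys : tsys :=
  @TSys (mconf (option Wk) (uQ U)) (nat * option Wk)%type ustp (@mbit _ _)
    (mlimc (ulim U)) (@mbit_lim _ _ _).
Lemma usys_det : deterministic usys.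
Proof. by move=> s t t' [_ ->] [_ ->]. Qed.
Lemma ufinal_halted (s : conf usys) : ufinal (stt s) -> halted s.
Proof. by move=> h t [/negP]. Qed.
End USys.

Section Blocks.
Variables (L Wk : finType).
Definition slot : finType := (bool + Wk + L)%type.
Definition bitpos : finType := (slot * option bool)%type.
Definition cellT : finType := {ffun bitpos -> bool}.

(* The work bit [None] starts as an input bit and stays on the input tape; the
   others are on the scratch tape, and the saved copies on the output tape. *)
Definition iw (w : option Wk) : bitpos :=
  if w is Some w then (inl (inr w), Some false) else (inl (inl true), None).
Definition ig (w : option Wk) : bitpos :=
  if w is Some w then (inl (inr w), Some true) else (inl (inl true), Some true).
Definition il (l : L) : bitpos := (inr l, None).
Definition if1 : bitpos := (inl (inl true), Some false).
Definition if2 : bitpos := (inl (inl false), Some false).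

Definition wk (g : cellT) : {ffun option Wk -> bool} := [ffun w => g (iw w)].
Definition rol (g : cellT) : L -> bool := fun l => g (il l).
Definition setw (g : cellT) (v : {ffun option Wk -> bool}) : cellT :=
  [ffun i => match i with
    | (inl (inl true), None) => v None
    | (inl (inr w), Some false) => v (Some w)
    | _ => g i end].
Definition setg (g : cellT) (v : {ffun option Wk -> bool}) : cellT :=
  [ffun i => match i with
    | (inl (inl true), Some true) => v None
    | (inl (inr w), Some true) => v (Some w)
    | _ => g i end].
Definition setf (g : cellT) (f1 f2 : bool) : cellT :=
  [ffun i => match i with
    | (inl (inl true), Some false) => f1
    | (inl (inl false), Some false) => f2
    | _ => g i end].
Definition save (g : cellT) : cellT := setg g (wk g).

Lemma setw_iw g v w : setw g v (iw w) = v w. Proof. by rewrite ffunE; case: w. Qed.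
Lemma setw_ig g v w : setw g v (ig w) = g (ig w). Proof. by rewrite ffunE; case: w. Qed.
Lemma setw_il g v l : setw g v (il l) = g (il l). Proof. by rewrite ffunE. Qed.
Lemma setw_f1 g v : setw g v if1 = g if1. Proof. by rewrite ffunE. Qed.
Lemma setw_f2 g v : setw g v if2 = g if2. Proof. by rewrite ffunE. Qed.
Lemma setg_iw g v w : setg g v (iw w) = g (iw w). Proof. by rewrite ffunE; case: w. Qed.
Lemma setg_ig g v w : setg g v (ig w) = v w. Proof. by rewrite ffunE; case: w. Qed.
Lemma setg_il g v l : setg g v (il l) = g (il l). Proof. by rewrite ffunE. Qed.
Lemma setg_f1 g v : setg g v if1 = g if1. Proof. by rewrite ffunE. Qed.
Lemma setg_f2 g v : setg g v if2 = g if2. Proof. by rewrite ffunE. Qed.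
Lemma setf_iw g a b w : setf g a b (iw w) = g (iw w). Proof. by rewrite ffunE; case: w. Qed.
Lemma setf_ig g a b w : setf g a b (ig w) = g (ig w). Proof. by rewrite ffunE; case: w. Qed.
Lemma setf_il g a b l : setf g a b (il l) = g (il l). Proof. by rewrite ffunE. Qed.
Lemma setf_f1 g a b : setf g a b if1 = a. Proof. by rewrite ffunE. Qed.
Lemma setf_f2 g a b : setf g a b if2 = b. Proof. by rewrite ffunE. Qed.
Lemma wkE g w : wk g w = g (iw w). Proof. by rewrite ffunE. Qed.
Lemma save_ig g w : save g (ig w) = g (iw w). Proof. by rewrite setg_ig wkE. Qed.
Definition cellE := (setw_iw, setw_ig, setw_il, setw_f1, setw_f2, setg_iw, setg_ig, setg_il,
  setg_f1, setg_f2, setf_iw, setf_ig, setf_il, setf_f1, setf_f2, wkE).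

Lemma save_id g : save g = g <-> forall w, g (ig w) = g (iw w).
Proof.
split=> [e w|h]; first by rewrite -[in LHS]e save_ig.
apply/ffunP => -[[[[]|w]|l] [[]|]]; rewrite ffunE //= wkE.
  by rewrite -(h None).
by rewrite -(h (Some w)).
Qed.
End Blocks.

(** * The loop machine and its completeness *)

Section LoopMachine.
Variables (L Wk : finType) (U : umach L Wk) (b : bool).
Local Notation J := (slot L Wk).
Local Notation I := (bitpos L Wk).
Local Notation j0 := (inl (inl true) : J).

Definition lst : finType := (bool * uQ U + bool + bool)%type.
Definition Sim f q : lst := inl (inl (f, q)).
Definition Sw f : lst := inl (inr f).
Definition Lim : lst := inr true.
Definition Hlt : lst := inr false.
(** The machine with [b = false] serves acceptance; the one with [b = true] serves the complement
    and halts on rejection or on a detected loop. *)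
Definition utarget := if b then urej U else uacc U.

(* A limit flagged [if2] ends a sweep over the whole tape: the first sweep
   saves the work bits, a later one compares the work bits with the saved
   ones; in between ([if1]) no work bit whose saved value is 0 may become 1. *)
Definition ltrans (q : lst) (g : cellT L Wk) (q' : lst) (g' : cellT L Wk) (mv : bool) : Prop :=
  match q with
  | inl (inl (f, q)) =>
      (q = utarget /\ (q', g', mv) = (Hlt, g, false)) \/
      (~~ ufinal q /\ let d := udelta q (rol g) (wk g) in
        (q', g', mv) = (Sim f d.1.1, setw g d.1.2, d.2) /\
        (f -> forall w, d.1.2 w -> g (ig L w)))
  | inl (inr f) => (f -> save g = g) /\ (q', g', mv) = (Sw f, save g, true)
  | inr true =>
      if g (if2 L Wk) then
        (if g (if1 L Wk) then (q', g', mv) = (Hlt, g, false)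
         else (q', g', mv) = (Sim true (ulim U), setf g true false, false))
      else (q', g', mv) = (Sim (g (if1 L Wk)) (ulim U), g, false) \/
           [/\ b, g (if1 L Wk) -> save g = g &
            (q', g', mv) = (Sw (g (if1 L Wk)), setf (save g) (g (if1 L Wk)) true, true)]
  | inr false => False
  end.

Definition lmach : mach I := @Mach I lst (Sim false (ustart U)) Lim Hlt ltrans.

Variable x : real.
Definition rox (k : nat) (l : L) : bool := x (#|J| * k + rk (inr l : J)).
Definition uinit : mconf (option Wk) (uQ U) :=
  MConf (fun k => [ffun w => if w is None then x (#|J| * k + rk j0) else false]) 0 (ustart U).
Local Notation UX := (usys U rox).
Local Notation MX := (msys lmach).

Lemma updm_id T (f : nat -> T) h : updm f h (f h) = f.
Proof. by apply: funext => k; rewrite /updm; case: eqP => [->|]. Qed.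

Section Complete.
Variables (f : bool) (A : nat * option Wk -> bool).

(** The bits that phase [f] leaves fixed: labels, the flags in block 0 and, in the second phase, the
    saved copy [A]. *)
Definition lcst (k : nat * I) : option bool :=
  match k.2 with
  | (inr l, None) => Some (rox k.1 l)
  | (inl (inl true), Some false) => if k.1 == 0 then Some f else None
  | (inl (inl false), Some false) => if k.1 == 0 then Some false else None
  | (inl (inl true), Some true) => if f then Some (A (k.1, None)) else None
  | (inl (inr w), Some true) => if f then Some (A (k.1, Some w)) else None
  | _ => None
  end.
Definition lkap (k : nat * option Wk) : nat * I := (k.1, iw L k.2).

Definition lrel (s : mconf (option Wk) (uQ U)) (u : mconf I lst) : Prop :=
  [/\ hd u = hd s, (forall k, mbit u (lkap k) = mbit s k),
    (forall k r, lcst k = Some r -> mbit u k = r) &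
    (stt u = Sim f (stt s) /\ stt s <> ulim U) \/ [/\ stt u = Lim, stt s = ulim U & hd s = 0]].

Definition ssys := restrict_sys (S := UX) (fun k => f ==> A k).

Lemma lcst_il k l : lcst (k, il Wk l) = Some (rox k l). Proof. by []. Qed.
Lemma lcst_f1 : lcst (0, if1 L Wk) = Some f. Proof. by []. Qed.
Lemma lcst_f2 : lcst (0, if2 L Wk) = Some false. Proof. by []. Qed.
Lemma lcst_ig k w : f -> lcst (k, ig L w) = Some (A (k, w)).
Proof. by rewrite /lcst => ->; case: w. Qed.

Lemma sim_step (s : mconf (option Wk) (uQ U)) (u : mconf I lst) :
  hd u = hd s -> (forall k, mbit u (lkap k) = mbit s k) ->
  (forall k r, lcst k = Some r -> mbit u k = r) -> stt u = Sim f (stt s) ->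
  ~~ ufinal (stt s) -> (forall k, mbit (unext rox s) k -> f ==> A k) ->
  exists u', @stp MX u u' /\ lrel (unext rox s) u'.
Proof.
move=> eh eb ec es nf fA.
pose d := udelta (stt s) (rox (hd s)) (tp s (hd s)).
have er : rol (tp u (hd u)) = rox (hd s).
  by apply: funext => l; rewrite eh; exact: (ec _ _ (lcst_il (hd s) l)).
have ew : wk (tp u (hd u)) = tp s (hd s).
  by apply/ffunP => w; rewrite wkE eh; exact: (eb (hd s, w)).
exists (MConf (updm (tp u) (hd u) (setw (tp u (hd u)) d.1.2)) (mvh d.2 (hd u)) (Sim f d.1.1)).
split.
  split; first by rewrite es.
  exists (Sim f d.1.1), (setw (tp u (hd u)) d.1.2), d.2; split=> //.
  rewrite es /=; right; split=> //; rewrite er ew; split=> // ff w dw.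
  have := ec _ _ (lcst_ig (hd s) w ff); rewrite /mbit /= eh => ->.
  by have := fA (hd s, w); rewrite ff; apply; rewrite /mbit /= /updm eqxx.
split=> /=; rewrite ?eh //.
- move=> [k w]; rewrite /mbit /= /updm; case: eqP => _; first by rewrite cellE.
  exact: (eb (k, w)).
- move=> [k i] r kr; rewrite -(ec _ _ kr) /mbit /= /updm; case: eqP => [->|//].
  by move: kr; rewrite /lcst /= ffunE; case: i => [[[[]|w]|l] [[]|]].
- by left; split=> //; case: (ulim_dedicated U) => _; exact.
Qed.

Lemma lim_step (s : mconf (option Wk) (uQ U)) (u : mconf I lst) : lrel s u -> stt s = ulim U ->
  @stp MX u (MConf (tp u) 0 (Sim f (stt s))).
Proof.
move=> [eh _ ec [[_ //]|[eu es hs]]] _; split; first by rewrite eu.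
have f1 : tp u (hd u) (if1 L Wk) = f by rewrite eh hs; exact: (ec _ _ lcst_f1).
have f2 : tp u (hd u) (if2 L Wk) = false by rewrite eh hs; exact: (ec _ _ lcst_f2).
exists (Sim f (stt s)), (tp u (hd u)), false; rewrite eu /= f1 f2 es; split; first by left.
by rewrite updm_id eh hs.
Qed.

Lemma lforward (s t : mconf (option Wk) (uQ U)) v u : @tpath ssys s t v ->
  lrel s u -> exists u' w, @tpath MX u u' w /\ lrel t u'.
Proof.
move=> p rsu.
have [|||u' [w [pw rt _ _ _]]] := @forward_sim ssys MX lrel lkap lcst _ _ _ s t v p u rsu.
- by move=> a c [_ h1 h2 _].
- move=> a c d R [[nf ed] dA]; subst d.
  have fitc (c' : mconf I lst) : (forall k r, lcst k = Some r -> mbit c' k = r) ->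
      @fits MX lcst (@bit MX c') by move=> h k r kr; rewrite /= (h k r kr).
  case: (R) => eh eb ec [[es nl]|[es el hs]].
    have [u1 [st R1]] := sim_step eh eb ec es nf dA.
    exists u1, (@bit MX c); split; [exact: tpath1|by []| |exact: fitc].
    by move=> k; rewrite /= eb => ->.
  have st := lim_step R el.
  have [||||||u1 [st1 R1]] := @sim_step a (MConf (tp c) 0 (Sim f (stt a))) => //.
  exists u1, (orf (@bit MX c) (@bit MX (MConf (tp c) 0 (Sim f (stt a))))).
  split; [exact: (tpathS (tpath1 st) st1)|by []| |].
    by move=> k /orP [|] /=; [|rewrite -[mbit _ _]/(mbit c (lkap k))]; rewrite eb => ->.
  move=> k r kr /orP [|] /=; first exact: fitc.
  by rewrite -[mbit _ _]/(mbit c k) (ec _ _ kr).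
- move=> h g gh gc; exists (mlimc Lim g), (fun _ => false); split=> //; first by left.
  split=> //.
  + by move=> k; rewrite -[mbit _ (lkap k)]/(@bit MX (@lmc MX g) (lkap k)) bit_lmc gh -[mbit _ k]/(@bit UX (@lmc UX h) k) bit_lmc.
  + by move=> k r kr; rewrite -[mbit _ k]/(@bit MX (@lmc MX g) k) bit_lmc; exact: gc.
  + by right.
by exists u', w.
Qed.
End Complete.

(** Each block is visited once and is constant afterwards, so at the limit after omega steps every
    block has its final content. *)
Lemma sweep (u : mconf I lst) f : b -> stt u = Lim -> hd u = 0 ->
  tp u 0 (if1 L Wk) = f -> tp u 0 (if2 L Wk) = false ->
  (f -> forall k, save (tp u k) = tp u k) ->
  exists w, @tpath MX u
    (MConf (fun k => if k == 0 then setf (save (tp u 0)) f true else save (tp u k)) 0 Lim) w.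
Proof.
move=> bt eu hu f1 f2 sv.
pose T k := if k == 0 then setf (save (tp u 0)) f true else save (tp u k).
pose t i : mconf I lst := if i is i'.+1 then MConf (fun k => if k < i then T k else tp u k) i (Sw f) else u.
have st i : @stp MX (t i) (t i.+1).
  case: i => [|i] /=.
    split; first by rewrite eu.
    exists (Sw f), (setf (save (tp u 0)) f true), true; rewrite eu hu /= f1 f2; split.
      by right; split=> // ff; exact: sv.
    by congr MConf; apply: funext => -[|k].
  split=> //; exists (Sw f), (T i.+1), true; split.
    by rewrite /= ltnn; split=> // ff; exact: sv.
  congr MConf; apply: funext => k; rewrite /updm /= ltnS leq_eqVlt.
  by case: (k =P i.+1) => // ->.
have := @tpathL MX t (fun i => @bit MX (t i)) (fun i => tpath1 (st i)).
set v := bigor _; rewrite [lmc _](_ : _ = MConf T 0 Lim); first by exists v.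
rewrite /lmc /= /mlimc; congr MConf; apply: funext => k; apply/ffunP => i; rewrite ffunE.
apply/asboolP/idP => [/(_ k.+1) [n [kn]]|h n].
  by case: n kn => // n kn; rewrite /= /mbit /= kn.
exists (maxn n k.+1); split; first exact: leq_maxl.
have : k < maxn n k.+1 by exact: leq_maxr.
by case: (maxn n k.+1) => // m km; rewrite /= /mbit /= km.
Qed.

(** After saving, the loop machine resumes directly in [Sim true (ulim U)], a state that [lrel]
    excludes; the first step of the loop is therefore simulated apart. *)
Lemma tpath_peel (S : tsys) (s t : conf S) v : tpath s t v ->
  exists s1 w, [/\ stp s s1, opath s1 t w & forall k, w k -> v k].
Proof.
elim=> {s t v} [s t st|s t t' v _ [s1 [w [st p wv]]] tt'|t v tv IH].
- by exists t, (fun _ => false); split=> //; left.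
- exists s1, (orf w (bit t)); split=> //; first by right; apply: opath_ttrans p _; exact: tpath1.
  by move=> k /orP [/wv|] h; rewrite /orf h ?orbT.
have [s1 [w [st p wv]]] := IH 0; have [w' [pw wv']] := tpath_tail 1 tv.
exists s1, (orf w w'); split=> //; first by right; apply: opath_ttrans p pw.
by move=> k /orP [/wv|/wv' [i]] h; apply/asboolP; [exists 0|exists i].
Qed.

Lemma lrel_init f A : f = false -> 
  lrel f A uinit (minit lmach x).
Proof.
move=> ->; split=> //=; last by left; split=> //; case: (ulim_dedicated U).
- by move=> [k w]; rewrite /mbit /= !ffunE; case: w.
- move=> [k i] r; rewrite /lcst /mbit /= ffunE /=.
  by case: i => [[[[]|w]|l] [[]|]] //=; case: (k == 0) => // -[<-].
Qed.

Lemma complete_final s v : @opath UX uinit s v -> stt s = utarget -> utarget <> ulim U ->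
  exists s' w, @opath MX (minit lmach x) s' w /\ stt s' = Hlt.
Proof.
move=> p es nl; pose A := fun _ : nat * option Wk => true.
have [u [w [pu [eh _ _ R]]]] : exists u w, @opath MX (minit lmach x) u w /\ lrel false A s u.
  case: p => [[<- _]|p].
    by exists (minit lmach x), (fun _ => false); split; [left|exact: lrel_init].
  have p' : @tpath (ssys false A) uinit s v by apply: (tpath_restrict (S := UX)) p _ _.
  have [u [w [pw R]]] := lforward p' (lrel_init A erefl).
  by exists u, w; split=> //; right.
case: R => [[eu _]|[_ e _]]; last by case: nl; rewrite -es.
exists (MConf (tp u) (hd u).-1 Hlt), (orf w (@bit MX u)); split=> //; right.
apply: opath_ttrans pu _; apply: tpath1; split; first by rewrite eu.
exists Hlt, (tp u (hd u)), false; rewrite eu es /=; split; first by left.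
by rewrite updm_id.
Qed.

Lemma complete_loop A v0 v : b -> @tpath UX uinit (lmc A) v0 -> @tpath UX (lmc A) (lmc A) v ->
  (forall k, v k -> A k) -> exists s' w, @opath MX (minit lmach x) s' w /\ stt s' = Hlt.
Proof.
move=> bt p0 pl vA.
have p0' : @tpath (ssys false A) uinit (lmc A) v0 by apply: (tpath_restrict (S := UX)) p0 _ _.
have [u [w0 [q0 [eh eb ec R]]]] := lforward p0' (lrel_init A erefl).
case: R => [[_ []//]|[eu _ _]].
have f1 : tp u 0 (if1 L Wk) = false by exact: (ec _ _ (lcst_f1 _ _)).
have f2 : tp u 0 (if2 L Wk) = false by exact: (ec _ _ (lcst_f2 _ _)).
have ul k l : tp u k (il Wk l) = rox k l by exact: (ec _ _ (lcst_il _ _ k l)).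
have uA k i : tp u k (iw L i) = A (k, i).
  by rewrite -[LHS]/(mbit u (lkap (k, i))) eb -[mbit _ _]/(@bit UX (@lmc UX A) (k, i)) bit_lmc.
have [|w1 q1] := sweep bt eu eh f1 f2; first by [].
set u1 := MConf _ _ _ in q1.
have u1w k i : tp u1 k (iw L i) = A (k, i) by rewrite /=; case: eqP => [->|_]; rewrite !cellE.
have u1g k i : tp u1 k (ig L i) = A (k, i).
  by rewrite /=; case: eqP => [->|_]; rewrite !cellE.
have u1l k l : tp u1 k (il Wk l) = rox k l by rewrite /=; case: eqP => [->|_]; rewrite !cellE.
have [u1s u1h u1f1 u1f2] : [/\ stt u1 = Lim, hd u1 = 0, tp u1 0 (if1 L Wk) = false & tp u1 0 (if2 L Wk)].
  by split; rewrite /= ?cellE.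
clearbody u1.
pose u2 : mconf I lst := MConf (updm (tp u1) 0 (setf (tp u1 0) true false)) 0 (Sim true (ulim U)).
have s12 : @stp MX u1 u2.
  split; first by rewrite u1s.
  exists (Sim true (ulim U)), (setf (tp u1 0) true false), false.
  by rewrite u1s u1h /= u1f2 u1f1.
have u2E k : tp u2 k = if k == 0 then setf (tp u1 0) true false else tp u1 k by [].
have u2w k i : tp u2 k (iw L i) = A (k, i) by rewrite u2E; case: eqP => [->|_]; rewrite ?cellE u1w.
have u2g k i : tp u2 k (ig L i) = A (k, i) by rewrite u2E; case: eqP => [->|_]; rewrite ?cellE u1g.
have u2l k l : tp u2 k (il Wk l) = rox k l by rewrite u2E; case: eqP => [->|_]; rewrite ?cellE u1l.
have [s1 [v' [[nf es1] o1 v'v]]] := tpath_peel pl.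
have s1l : stt s1 <> ulim U by rewrite es1 /=; case: (ulim_dedicated U) => _; exact.
(* One step cannot already complete the loop, since no step enters [ulim U]. *)
case: o1 => [[e _]|p1]; first by case: s1l; rewrite e.
have s1A k : mbit s1 k -> A k by move=> h; apply: vA; apply: v'v; exact: (tpath_start p1).
have [||||||u3 [s23 R3]] := @sim_step true A (lmc A) u2 => //.
- by move=> [k i]; rewrite -[RHS]/(@bit UX (@lmc UX A) (k, i)) bit_lmc; exact: u2w.
- move=> [k i] r; rewrite /lcst /=.
  case: i => [[[[]|w]|l] [[]|]] //=.
  + by move=> [<-]; exact: (u2g k None).
  + by case: (k =P 0) => // -> [<-]; rewrite /mbit /= /updm /= cellE.
  + by case: (k =P 0) => // -> [<-]; rewrite /mbit /= /updm /= cellE.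
  + by move=> [<-]; exact: (u2g k (Some w)).
  + by move=> [<-]; exact: u2l.
- by move=> k; rewrite -es1 => /s1A.
rewrite -es1 in R3.
have p1' : @tpath (ssys true A) s1 (lmc A) v'.
  apply: (tpath_restrict (S := UX)) p1 _ _ => [k /v'v/vA //|k].
  by rewrite bit_lmc.
have [u4 [w4 [q4 [eh4 eb4 ec4 R4]]]] := lforward p1' R3.
case: R4 => [[_ []//]|[eu4 _ _]].
have f41 : tp u4 0 (if1 L Wk) = true by exact: (ec4 _ _ (lcst_f1 _ _)).
have f42 : tp u4 0 (if2 L Wk) = false by exact: (ec4 _ _ (lcst_f2 _ _)).
(* The loop is back at [lmc A] and the copy was kept constant, so the comparison succeeds in every
   block. *)
have sv4 k : save (tp u4 k) = tp u4 k.
  apply/save_id => i; rewrite -[RHS]/(mbit u4 (lkap (k, i))) eb4 -[mbit _ _]/(@bit UX (@lmc UX A) (k, i)) bit_lmc.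
  exact: (ec4 _ _ (@lcst_ig true A k i isT)).
have [|w5 q5] := sweep bt eu4 eh4 f41 f42; first by [].
set u5 := MConf _ _ _ in q5.
have [u5s u5h u5f1 u5f2] : [/\ stt u5 = Lim, hd u5 = 0, tp u5 0 (if1 L Wk) & tp u5 0 (if2 L Wk)].
  by split; rewrite /= ?cellE.
clearbody u5.
have s56 : @stp MX u5 (MConf (tp u5) 0 Hlt).
  split; first by rewrite u5s.
  exists Hlt, (tp u5 0), false.
  by rewrite u5s u5h updm_id /= u5f2 u5f1.
exists (MConf (tp u5) 0 Hlt); eexists; split=> //; right.
apply: tpathS s56; apply: tpath_trans q5; apply: tpath_trans q4.
apply: tpathS s23; apply: tpathS s12; exact: (tpath_trans q0 q1).
Qed.
End LoopMachine.

(** * Soundness of loop detection *)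

Section LoopSound.
Variables (L Wk : finType) (U : umach L Wk) (b : bool) (x : real).
Local Notation J := (slot L Wk).
Local Notation I := (bitpos L Wk).
Local Notation MX := (msys (lmach U b)).
Local Notation UX := (usys U (@rox L Wk x)).
Local Notation "'iw_'" := (@iw L Wk).
Local Notation "'ig_'" := (@ig L Wk).
Local Notation f1_ := (if1 L Wk).
Local Notation f2_ := (if2 L Wk).
Implicit Types s t : mconf I (lst U).

(** Reading [Lim] as the state [ulim U] makes the step that resumes the simulation after a limit a
    mere stutter. *)
Definition proj s : mconf (option Wk) (uQ U) :=
  MConf (fun k => wk (tp s k)) (hd s) (if stt s is inl (inl (_, q)) then q else ulim U).
Definition roOK s := forall k l, tp s k (il Wk l) = rox Wk x k l.
Definition simf f s := [/\ tp s 0 f1_ = f, tp s 0 f2_ = false &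
  (stt s = Lim U /\ hd s = 0) \/ exists q, stt s = Sim f q].

Lemma mbit_proj s k w : mbit (proj s) (k, w) = tp s k (iw_ w).
Proof. by rewrite /mbit /= wkE. Qed.

Lemma step_ro s t : @stp MX s t -> roOK s -> roOK t.
Proof.
move=> [_ [q [g [mv [tr ->]]]]] ro k l; rewrite /= /updm; case: eqP => [->|_]; last exact: ro.
rewrite -ro; move: tr; rewrite /= /ltrans; case: (stt s) => [[[f r]|f]|[]] //.
- by case=> [[_ [_ -> _]]//|[_ [[_ -> _] _]]]; rewrite cellE.
- by move=> [_ [_ -> _]]; rewrite cellE.
by case: ifP => _; [case: ifP => _ [_ -> _]|case=> [[_ -> _]|[_ _ [_ -> _]]]]; rewrite ?cellE.
Qed.

Variant sim_step_spec f s t : Prop :=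
| SimFinal of stt s = Sim f (utarget U b) & stt t = Hlt U
| SimStep of simf f t & @stp UX (proj s) (proj t) &
   (forall k w, tp t k (ig_ w) = tp s k (ig_ w)) &
   (f -> forall k w, tp t k (iw_ w) -> tp s k (iw_ w) \/ tp s k (ig_ w))
| SimResume of stt s = Lim U & t = MConf (tp s) 0 (Sim f (ulim U))
| SimSweep of b & stt s = Lim U & hd s = 0 & (f -> save (tp s 0) = tp s 0) &
   t = MConf (updm (tp s) 0 (setf (save (tp s 0)) f true)) 1 (Sw U f).

Lemma simP f s t : simf f s -> roOK s -> @stp MX s t -> sim_step_spec f s t.
Proof.
move=> [e1 e2 es] ro [_ [q [g [mv [tr et]]]]].
have updf (v : {ffun option Wk -> bool}) i : i = f1_ \/ i = f2_ ->
    updm (tp s) (hd s) (setw (tp s (hd s)) v) 0 i = tp s 0 i.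
  by move=> h; rewrite /updm; case: eqP => [->|_] //; case: h => ->; rewrite cellE.
case: es => [[es hs]|[r es]].
  move: tr; rewrite /= es hs /= e1 e2 => -[[eq eg emv]|[bt sv [eq eg emv]]].
    by apply: SimResume => //; rewrite et hs eq eg emv updm_id.
  by apply: SimSweep => //; rewrite et hs eq eg emv.
move: tr; rewrite /= es /= => -[[er [eq _ _]]|[nf [[eq eg emv] fA]]].
  by apply: SimFinal; rewrite ?es ?er // et.
have er : rol (tp s (hd s)) = rox Wk x (hd s) by apply: funext => l; exact: ro.
apply: SimStep.
- by rewrite et eg eq; split=> /=; [rewrite updf; auto|rewrite updf; auto|right; eexists].
- split; rewrite /proj es //= et /unext /= eq eg emv er.
  apply: mconf_eq => //= k i; rewrite /updm.
  by rewrite wkE; case: eqP => _; rewrite ?cellE.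
- move=> k w; rewrite et eg /= /updm; case: eqP => [->|//]; by rewrite cellE.
- move=> ff k w; rewrite et eg /= /updm; case: eqP => [->|_]; last by left.
  by rewrite cellE => /(fA ff); right.
Qed.

Section OnRun.
Variables (W : Type) (lt : W -> W -> Prop) (c : W -> conf MX).
Hypothesis run : is_run lt c.
Let wo : is_wellorder lt. Proof. by case: run. Qed.
Let step a d : succ_of lt a d -> @stp MX (c a) (c d).
Proof. by case: run => _ h _; exact: h. Qed.

Lemma lim_eq d : is_limit lt d -> c d = lmc (wlimsup lt c d).
Proof. by case: run => _ _ h; exact: h. Qed.

Lemma lim_bit d k i : is_limit lt d -> tp (c d) k i = wlimsup lt c d (k, i).
Proof. by move=> ld; rewrite lim_eq // -[LHS]/(@bit MX (lmc _) (k, i)) bit_lmc. Qed.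

Lemma lim_const d a k i r : is_limit lt d -> lt a d ->
  (forall e, wle lt a e -> lt e d -> tp (c e) k i = r) -> tp (c d) k i = r.
Proof.
move=> ld ad H; rewrite lim_bit //; apply/asboolP/idP => [/(_ a ad) [e [ae ed]]|hr e ed].
  by rewrite -(H e) //; right.
have [m [em am md]] : exists m, [/\ lt e m, wle lt a m & lt m d].
  case: (wle_total wo a e) => h.
    have [m eem md] := limit_succ wo ld ed; exists m; split=> //; first exact: succ_lt eem.
    by right; exact: (wle_lt wo h (succ_lt eem)).
  by exists a; split=> //; left.
by exists m; split=> //; rewrite -[bit _ _]/(tp (c m) k i) H.
Qed.

Lemma lim_state d : is_limit lt d -> stt (c d) = Lim U /\ hd (c d) = 0.
Proof. by move=> /lim_eq ->. Qed.

Lemma run_ro bot : (forall a, wle lt bot a) -> roOK (c bot) -> forall a, roOK (c a).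
Proof.
move=> bt ro a; elim/(well_founded_ind (wo_wf wo)): a => a IH.
case: (wo_cases lt a) => [na|[e ea]|la].
- by case: (bt a) => [<-//|/na].
- by apply: (step_ro (step ea)); exact: IH _ (succ_lt ea).
move=> k l; case: (la) => -[e ea] _; apply: (lim_const la ea) => d _ da.
exact: IH.
Qed.

Lemma sim_lim f a d : is_limit lt d -> lt a d ->
  (forall e, wle lt a e -> lt e d -> simf f (c e)) -> simf f (c d).
Proof.
move=> ld ad H; split; last by left; exact: lim_state.
  by apply: (lim_const ld ad) => e h1 h2; case: (H e h1 h2).
by apply: (lim_const ld ad) => e h1 h2; case: (H e h1 h2).
Qed.

Hypothesis ro : forall a, roOK (c a).

(** The only stutter is the step that resumes after a limit, and the step following it is proper; so
    proper steps are cofinal below limits, as [reflect_run] demands. *)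
Lemma sim_reflect f a0 z : (forall e, wle lt a0 e -> wle lt e z -> simf f (c e)) -> lt a0 z ->
  proj (c a0) = proj (c z) \/ exists v, @tpath UX (proj (c a0)) (proj (c z)) v /\
    span (S := UX) lt (fun a => proj (c a)) a0 z v.
Proof.
move=> H az.
have sz d e : wle lt a0 d -> wle lt e z -> succ_of lt d e ->
    proj (c d) = proj (c e) /\ stt (c d) = Lim U /\ stt (c e) = Sim f (ulim U) \/
    @stp UX (proj (c d)) (proj (c e)).
  move=> h1 h2 de; have dz : wle lt d z by right; exact: (wlt_le wo (succ_lt de)).
  have a0e : wle lt a0 e by right; exact: (wle_lt wo h1 (succ_lt de)).
  have [_ _ es] := H e a0e h2.
  case: (simP (H d h1 dz) (@ro d) (step de)) => [_ e1|_ h _ _|es1 e1|_ _ _ _ e1].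
  - by rewrite e1 in es; case: es => [[]|[]].
  - by right.
  - left; rewrite e1; split=> //; rewrite /proj es1 /=; congr MConf.
    by have [_ _ [[_ ->]|[q]]] := H d h1 dz; rewrite ?es1.
  - by rewrite e1 in es; case: es => [[]|[]].
apply: (@reflect_run UX W lt wo (fun a => proj (c a)) a0 z _ _ z (or_introl erefl) a0 (or_introl erefl) az).
- by move=> d e h1 h2 de; case: (sz d e h1 h2 de) => [[]|]; [left|right].
move=> d a0d dz ld; split.
  have [es hs] := lim_state ld; rewrite {1}/proj es hs.
  apply: mconf_eq => //= k w; rewrite wkE ffunE lim_bit //.
  apply: asbool_equiv_eq; split=> h a ad; have [e [h1 h2 h3]] := h a ad; exists e; split=> //.
    by rewrite -[bit _ _]/(mbit _ _) mbit_proj.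
  by move: h3; rewrite -[bit _ _]/(mbit _ _) mbit_proj.
move=> a a0a ad; have [e ae ed] := limit_succ wo ld ad.
have ez : wle lt e z by right; exact: (wlt_le wo ed).
case: (sz a e a0a ez ae) => [[_ [_ es]]|st]; last by exists a, e; split=> //; left.
have a0e : wle lt a0 e by right; exact: (wle_lt wo a0a (succ_lt ae)).
have [e' ee' ed'] := limit_succ wo ld ed.
have ez' : wle lt e' z by right; exact: (wlt_le wo ed').
case: (sz e e' a0e ez' ee') => [[_ [es' _]]|st]; first by rewrite es in es'.
by exists e, e'; split=> //; right; exact: succ_lt ae.
Qed.

(** [S] is the work content being saved and [T] the copy saved before. In the second phase a sweep
    must not alter the copy, so to the left of the head it is both [S] and [T]. *)
Definition swp f S T s := [/\ stt s = Sw U f, tp s 0 f1_ = f /\ tp s 0 f2_, 0 < hd s,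
  forall k w, tp s k (iw_ w) = S k w &
  (forall k, k < hd s -> forall w, tp s k (ig_ w) = S k w) /\
  (f -> forall k w, tp s k (ig_ w) = T k w)].

Lemma swp_step f S T s t : swp f S T s -> @stp MX s t -> swp f S T t /\ hd t = (hd s).+1.
Proof.
move=> [es [e1 e2] h0 ew [eg eT]] [_ [q [g [mv [tr ->]]]]].
move: tr; rewrite /= es /= => -[sv [-> -> ->]]; split=> //; split=> //=.
- by rewrite /updm; case: eqP => [<-|//]; rewrite ?cellE.
- by move=> k w; rewrite /updm; case: eqP => [->|_]; rewrite ?cellE ew.
split=> k.
  rewrite ltnS leq_eqVlt /updm; case: (k =P hd s) => [-> _ w|_ /= /eg //].
  by rewrite !cellE ew.
by move=> h w; rewrite /updm; case: eqP => [->|_]; rewrite ?sv // eT.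
Qed.

(** A sweep can be left at a limit only, and by then the head has passed every block; so the copy is
    [S] everywhere, and in the second phase it is [T] as well. *)
Lemma sweep_sound f S T a z : swp f S T (c a) -> lt a z -> ~ swp f S T (c z) ->
  exists d, [/\ lt a d, wle lt d z, [/\ is_limit lt d, stt (c d) = Lim U & hd (c d) = 0],
    tp (c d) 0 f1_ = f /\ tp (c d) 0 f2_ &
    [/\ forall k w, tp (c d) k (iw_ w) = S k w, forall k w, tp (c d) k (ig_ w) = S k w &
     f -> forall k w, T k w = S k w]].
Proof.
move=> sa az nz.
have [d [ad dz nd sd]] := first_exit wo (P := fun e => swp f S T (c e)) sa (or_intror az) nz.
have ld : is_limit lt d.
  case: (wo_cases lt d) => [/(_ a ad) //|[e ed]|//]; case: nd.
  have se := sd e (lt_succ_wle wo ed ad) (succ_lt ed).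
  by have [] := swp_step se (step ed).
have [es hs] := lim_state ld.
have adj e : lt a e -> lt e d -> exists2 e', succ_of lt e' e & wle lt a e'.
  move=> ae ed; case: (wo_cases lt e) => [/(_ a ae) //|[e' ee']|le].
    by exists e' => //; exact: (lt_succ_wle wo ee' ae).
  by have [h _ _ _ _] := sd e (or_intror ae) ed; have [h'] := lim_state le; rewrite h' in h.
have mono m e : wle lt a m -> wle lt m e -> lt e d -> hd (c m) <= hd (c e).
  move=> am; elim/(well_founded_ind (wo_wf wo)): e => e IH [->//|me] ed.
  have [e' ee' _] := adj e (wle_lt wo am me) ed.
  have e'd := wo_trans wo (succ_lt ee') ed.
  have me' := lt_succ_wle wo ee' me.
  have [_ ->] := swp_step (sd e' (wle_trans wo am me') e'd) (step ee').
  by apply: leqW; exact: IH (succ_lt ee') me' e'd.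
have unb k : exists m, [/\ wle lt a m, lt m d & k < hd (c m)].
  elim: k => [|k [m [am md km]]]; first by exists a; split=> //; [left|case: sa].
  have [e me ed] := limit_succ wo ld md; exists e; split=> //.
    by right; exact: (wle_lt wo am (succ_lt me)).
  by have [_ ->] := swp_step (sd m am md) (step me).
have eg k w : tp (c d) k (ig_ w) = S k w.
  have [m [am md km]] := unb k; apply: (lim_const ld md) => e me ed.
  have [_ _ _ _ [h _]] := sd e (wle_trans wo am me) ed.
  by apply: h; exact: leq_trans km (mono m e am me ed).
exists d; split=> //.
  split; apply: (lim_const ld ad) => e h1 h2; by have [_ []] := sd e h1 h2.
split=> //.
  by move=> k w; apply: (lim_const ld ad) => e h1 h2; have [_ _ _ ->] := sd e h1 h2.
move=> ff k w; rewrite -(eg k w); apply/esym/(lim_const ld ad) => e h1 h2.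
by have [_ _ _ _ [_ ->]] := sd e h1 h2.
Qed.

End OnRun.
End LoopSound.

Section LoopSpec.
Variables (L Wk : finType) (U : umach L Wk) (b : bool) (x : real).
Local Notation J := (slot L Wk).
Local Notation I := (bitpos L Wk).
Local Notation MX := (msys (lmach U b)).
Local Notation UX := (usys U (@rox L Wk x)).
Local Notation "'iw_'" := (@iw L Wk).
Local Notation "'ig_'" := (@ig L Wk).
Local Notation f1_ := (if1 L Wk).
Local Notation f2_ := (if2 L Wk).

Lemma proj_minit : proj (minit (lmach U b) x) = uinit U x.
Proof. by apply: mconf_eq => //= k [w|]; rewrite wkE !ffunE. Qed.

Definition ureach q := exists t w, @opath UX (uinit U x) t w /\ stt t = q.
Definition uloop := exists A v0 v, [/\ @tpath UX (uinit U x) (lmc A) v0,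
  @tpath UX (lmc A) (lmc A) v & forall k, v k -> A k].

Lemma loop_sound s v : @opath MX (minit (lmach U b) x) s v -> stt s = Hlt U ->
  ureach (utarget U b) \/ (b /\ uloop).
Proof.
case=> [[<- _] //|p hs].
have [W [lt [c [bot [top [run bt tpb cb ct]]]]]] := tpath_run p.
have wo : is_wellorder lt by case: run.
have step a d : succ_of lt a d -> @stp MX (c a) (c d) by case: run => _ h _; exact: h.
have bl a : wle lt bot a by case: (bt a) => [->|]; [left|right].
have ro : forall a, roOK x (c a).
  by apply: (run_ro run bl); rewrite cb => k l; rewrite ffunE.
have s0 : simf false (c bot) by rewrite cb; split; rewrite /= ?ffunE //; right; eexists.
have nsim f : ~ simf f (c top) by rewrite ct => -[_ _]; rewrite hs => -[[]|[]].
have path_sim f a0 z : (forall e, wle lt a0 e -> wle lt e z -> simf f (c e)) -> wle lt a0 z ->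
    exists v, @opath UX (proj (c a0)) (proj (c z)) v.
  move=> H [->|az]; first by exists (fun _ => false); left.
  case: (sim_reflect run ro H az) => [->|[w [pw _]]]; first by exists (fun _ => false); left.
  by exists w; right.
have [b1 [bb1 b1t nb1 sb1]] := first_exit wo (P := fun a => simf false (c a)) s0 (bl top) (@nsim _).
have [a1 ab1] : exists a, succ_of lt a b1.
  by case: (wo_cases lt b1) => [/(_ _ bb1) //|//|l]; case: nb1; exact: (sim_lim run l bb1).
have lab1 := succ_lt ab1.
have sa1 e : wle lt bot e -> wle lt e a1 -> simf false (c e).
  by move=> h1 h2; apply: sb1 => //; exact: (wle_lt wo h2).
have [v1] := path_sim _ _ _ sa1 (bl a1); rewrite cb proj_minit => p1.
case: (simP (sa1 a1 (bl a1) (or_introl erefl)) (ro a1) (step _ _ ab1)) =>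
    [e1 _|//|e1 e2|bb e1 hd1 _ cb1].
- by left; exists (proj (c a1)), v1; split=> //; rewrite /proj e1.
- by case: nb1; rewrite e2; case: (sa1 a1 (bl a1) (or_introl erefl)) => ? ? _; split=> //; right; eexists.
(* The content saved by the first sweep; the loop will begin and end at the limit configuration with
   these bits. *)
pose S k w : bool := tp (c a1) k (iw_ w).
have [F1 F2 _] := sa1 a1 (bl a1) (or_introl erefl).
have sw1 : swp false S S (c b1).
  rewrite cb1; split=> //=; first by rewrite /updm /= !cellE.
    by move=> k w; rewrite /updm; case: eqP => [->|_]; rewrite ?cellE.
  by split=> // k; rewrite ltnS leqn0 => /eqP -> w; rewrite /updm /= !cellE.
have ntop f S' T' : ~ swp f S' T' (c top) by rewrite ct => -[]; rewrite hs.
have b1top : lt b1 top by case: (tpb b1) => // e; move: sw1; rewrite e => /ntop.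
have [b2 [b12 _ [lb2 es2 hs2] [f21 f22] [ew2 eg2 _]]] := sweep_sound run sw1 b1top (@ntop _ _ _).
have b2top : lt b2 top by case: (tpb b2) => // e; move: es2; rewrite e ct hs.
have [b3 b23 b3t] := succ_exists wo b2top.
have cb3 : c b3 = MConf (updm (tp (c b2)) 0 (setf (tp (c b2) 0) true false)) 0 (Sim true (ulim U)).
  have [_ [q [g [mv [tr ->]]]]] := step _ _ b23.
  by move: tr; rewrite /= es2 hs2 /= f22 f21 => -[-> -> ->].
have ew3 k w : tp (c b3) k (iw_ w) = S k w.
  by rewrite cb3 /= /updm; case: eqP => [->|_]; rewrite ?cellE ew2.
have eg3 k w : tp (c b3) k (ig_ w) = S k w.
  by rewrite cb3 /= /updm; case: eqP => [->|_]; rewrite ?cellE eg2.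
(* Invariant of the second phase: the copy remains [S] and no work bit outside [S] becomes 1, which
   is what makes a recurrence a genuine loop. *)
pose post (s : mconf I (lst U)) := simf true s /\ forall k w, tp s k (ig_ w) = S k w /\ (tp s k (iw_ w) -> S k w).
have post3 : post (c b3).
  split; last by move=> k w; rewrite eg3 ew3.
  by rewrite cb3; split; rewrite /= ?/updm /= ?cellE //; right; eexists.
have [b4 [b34 b4t nb4 sb4]] := first_exit wo (P := fun a => post (c a)) post3 b3t
   (fun h => @nsim true (proj1 h)).
have [a4 ab4] : exists a, succ_of lt a b4.
  case: (wo_cases lt b4) => [/(_ _ b34) //|//|l]; case: nb4; split.
    by apply: (sim_lim run l b34) => e h1 h2; case: (sb4 e h1 h2).
  move=> k w; split.
    by apply: (lim_const run l b34) => e h1 h2; have [_ /(_ k w) []] := sb4 e h1 h2.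
  rewrite (lim_bit run) // => /asboolP /(_ b3 b34) [e [h1 h2 h3]].
  by have [_ /(_ k w) []] := sb4 e (or_intror h1) h2; move=> _; exact.
have lab4 := succ_lt ab4.
have b3a4 : wle lt b3 a4 := lt_succ_wle wo ab4 b34.
have po4 e : wle lt b3 e -> wle lt e a4 -> post (c e).
  by move=> h1 h2; apply: sb4 => //; exact: (wle_lt wo h2).
have sa4 e : wle lt b3 e -> wle lt e a4 -> simf true (c e).
  by move=> h1 h2; case: (po4 e h1 h2).
pose A (k : nat * option Wk) := S k.1 k.2.
have pA (s0' : mconf I (lst U)) : (forall k w, tp s0' k (iw_ w) = S k w) -> hd s0' = 0 ->
    (stt s0' = Lim U \/ exists f, stt s0' = Sim f (ulim U)) -> proj s0' = @lmc UX A.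
  move=> e h st; apply: mconf_eq => /=.
  - by move=> k w; rewrite wkE e ffunE.
  - exact: h.
  - by case: st => [->|[f ->]].
have [S1 [es1 hs1]] : stt (c a1) = Lim U /\ (stt (c a1) = Lim U /\ hd (c a1) = 0) by [].
have pa1 : proj (c a1) = @lmc UX A by apply: pA => //; left.
have pb3 : proj (c b3) = @lmc UX A.
  by apply: pA => //; rewrite cb3 //; right; eexists.
have [v4] := path_sim _ _ _ sa4 b3a4; rewrite pb3 => p4.
rewrite pa1 in p1.
have [st4 po_a4] := po4 a4 b3a4 (or_introl erefl).
case: (simP st4 (ro a4) (step _ _ ab4)) => [e4 _|st h4 eg4 ew4|e4 e4'|_ e4 h4 sv4 cb4].
- left; exists (proj (c a4)), (orf v1 v4); split; last by rewrite /proj e4.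
  exact: opath_trans p1 p4.
- case: nb4; split=> // k w; rewrite eg4; have [h5 h6] := po_a4 k w; split=> //.
  by move=> /(ew4 isT) [|]; rewrite ?h5 //; exact: h6.
- case: nb4; rewrite e4'; split; first by case: st4 => ? ? _; split=> //; right; eexists.
  exact: po_a4.
right; split=> //.
have [F41 F42 _] := st4.
pose S' k w : bool := tp (c a4) k (iw_ w).
have sw4 : swp true S' S (c b4).
  rewrite cb4; split=> //=; first by rewrite /updm /= !cellE.
    by move=> k w; rewrite /updm; case: eqP => [->|_]; rewrite ?cellE.
  split; first by move=> k; rewrite ltnS leqn0 => /eqP -> w; rewrite /updm /= !cellE.
  move=> _ k w; rewrite /updm; case: eqP => [->|_]; last by case: (po_a4 k w).
  by rewrite cellE sv4 //; case: (po_a4 0 w).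
have b4top : lt b4 top by case: b4t => [e|//]; move: sw4; rewrite e => /ntop.
have [b5 [_ _ _ _ [_ _ /(_ isT) SS]]] := sweep_sound run sw4 b4top (@ntop _ _ _).
(* The second sweep reached its limit, which forces the work content at [a4] to equal the old
   copy. *)
have pa4 : proj (c a4) = @lmc UX A.
  apply: pA; [|exact: h4|by left].
  by move=> k w; rewrite SS.
have ne : b3 <> a4 by move=> e; move: e4; rewrite -e cb3.
have lt34 : lt b3 a4 by case: b3a4.
(* The first step out of [lmc A] is split off: from [b3] to [a4] the projections are equal, so
   [sim_reflect] might report just that instead of a nonempty path. *)
have [d b3d da4] := succ_exists wo lt34.
have b3ld : wle lt b3 d by right; exact: succ_lt b3d.
have sd := sa4 d b3ld da4.
have b3az : wle lt b3 a4 by right.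
have stu : @stp UX (@lmc UX A) (proj (c d)).
  case: (simP (sa4 b3 (or_introl erefl) b3az) (ro b3) (step _ _ b3d)) => [_ e|_ h _ _|e _|_ e _ _ _].
  - by case: sd => _ _; rewrite e => -[[]|[]].
  - by rewrite -pb3.
  - by rewrite cb3 in e.
  - by rewrite cb3 in e.
have pl : exists w, @tpath UX (@lmc UX A) (@lmc UX A) w /\ forall k, w k -> A k.
  have bA e k : wle lt b3 e -> wle lt e a4 -> mbit (proj (c e)) k -> A k.
    case: k => k w h1 h2; rewrite mbit_proj => h3.
    by have [_ /(_ k w) [_]] := po4 e h1 h2; exact.
  have bA0 k : @bit UX (@lmc UX A) k -> A k by rewrite bit_lmc.
  case: da4 => [ed|da4].
    exists (@bit UX (@lmc UX A)); split=> //; apply: tpath1.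
    by move: stu; rewrite ed pa4.
  have H e : wle lt d e -> wle lt e a4 -> simf true (c e).
    by move=> h; apply: sa4; exact: (wle_trans wo b3ld h).
  case: (sim_reflect run ro H da4) => [e|[w [pw sw]]].
    exists (@bit UX (@lmc UX A)); split=> //; apply: tpath1.
    by move: stu; rewrite e pa4.
  exists (orf (@bit UX (@lmc UX A)) w); split.
    by rewrite pa4 in pw; apply: tpath_trans pw; exact: tpath1.
  move=> k /orP [/bA0 //|/sw [e [h1 h2 h3]]]; apply: (bA e k) h3.
    exact: (wle_trans wo b3ld h1).
  by right.
have [w [pw wA]] := pl.
have dz : uinit U x <> @lmc UX A.
  by move=> e; have := congr1 (@stt _ _) e; case: (ulim_dedicated U).
case: p1 => [[e _]|p1]; first by case: dz.
by exists A, v1, w; split.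
Qed.
End LoopSpec.

(** * Acceptance belongs to ND and to coND *)

Section Semidecidable.
Variables (L Wk : finType) (U : umach L Wk).
Hypotheses (acc_lim : uacc U <> ulim U) (rej_lim : urej U <> ulim U) (acc_rej : uacc U <> urej U).
Local Notation J := (slot L Wk).
Local Notation j0 := (inl (inl true) : J).

Lemma opath_halt_uniq (S : tsys) (s t t' : conf S) v v' : deterministic S ->
  opath s t v -> opath s t' v' -> halted t -> halted t' -> t = t'.
Proof.
move=> det [[<- _]|p] [[<- _]|p'] h h' //.
- by have [s' st] := tpath_first p'; case: (h s').
- by have [s' st] := tpath_first p; case: (h' s').
- exact: (tpath_halt_uniq det p p').
Qed.

Definition accepted x := ureach x (uacc U).

Lemma accepted_rejected x : ureach x (uacc U) -> ureach x (urej U) -> False.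
Proof.
move=> [t [v [p e]]] [t' [v' [p' e']]]; apply: acc_rej; rewrite -e -e'.
have fin q : q = uacc U \/ q = urej U -> ufinal q by rewrite /ufinal => -[->|->]; rewrite eqxx ?orbT.
rewrite (opath_halt_uniq (@usys_det _ _ _ _) p p') //; apply: ufinal_halted; apply: fin; auto.
Qed.

Theorem accepted_nd : nittm_recognizable accepted.
Proof.
exists (compiled j0 (lmach U false)) => x; rewrite compiled_spec; split.
  by move=> [t [v [p e]]]; have [//|//|s' [w h]] := @complete_final L Wk U false x t v p; exists s', w.
by move=> [s [v [p e]]]; case: (loop_sound p e) => [|[]].
Qed.

(** A machine that does not accept either rejects or never reaches a final state, and then it loops;
    conversely a rejection and a loop each exclude acceptance. *)
Theorem accepted_cond : co_nittm_recognizable accepted.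
Proof.
exists (compiled j0 (lmach U true)) => x; rewrite compiled_spec; split; last first.
  move=> [s [v [p e]]] acc; case: (loop_sound p e) => [rej|[_ [A [v0 [w [p0 pl wA]]]]]].
    exact: accepted_rejected acc rej.
  have [t [v1 [pt et]]] := acc.
  apply: (loop_no_halt (@usys_det _ _ _ _) pt _ p0 pl wA).
  by apply: ufinal_halted; rewrite et /ufinal eqxx.
move=> nacc; case: (EM (ureach x (urej U))) => [[t [v [p e]]]|nrej].
  by have [//|//|s' [w h]] := @complete_final L Wk U true x t v p; exists s', w.
have [|A [v0 [v [p0 pl vA]]]] := @nonhalting_loop (usys U (@rox L Wk x)) (uinit U x).
  move=> t v p; exists (unext (@rox L Wk x) t); split=> //.
  by apply/negP => /orP [/eqP e|/eqP e]; [apply: nacc|apply: nrej]; exists t, v.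
have [//|s' [w h]] := @complete_loop L Wk U true x A v0 v _ p0 pl vA.
by exists s', w.
Qed.
End Semidecidable.

(** * Machines with several heads *)

Definition pcell := option bool -> bool.

(** The state picks the one head that acts in a step; the move [None] leaves that head in place. *)
Record hmach (L Hd : finType) := HMach {
  hQ : finType; hstart : hQ; hlim : hQ; hacc : hQ; hrej : hQ;
  hhd : hQ -> Hd;
  hdelta : hQ -> (L -> bool) -> pcell -> hQ * pcell * option bool }.

Section HSys.
Variables (L Hd : finType) (M : hmach L Hd) (ro : nat -> L -> bool).

Record hconf := HConf { ht : nat -> pcell; hp : Hd -> nat; hs : hQ M }.
Definition hbit (s : hconf) (k : option bool * nat) : bool := ht s k.2 k.1.
Definition hlimc (f : option bool * nat -> bool) : hconf :=
  HConf (fun k t => f (t, k)) (fun _ => 0) (hlim M).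
Lemma hbit_lim f : hbit (hlimc f) = f. Proof. by apply: funext => -[]. Qed.

Definition hfinal (q : hQ M) := (q == hacc M) || (q == hrej M).
Definition hnext (s : hconf) : hconf :=
  let j := hhd (hs s) in
  let d := hdelta (hs s) (ro (hp s j)) (ht s (hp s j)) in
  HConf (updm (ht s) (hp s j) d.1.2)
    (fun i => if i == j then (if d.2 is Some mv then mvh mv (hp s j) else hp s j) else hp s i) d.1.1.
Definition hstp (s t : hconf) : Prop := ~~ hfinal (hs s) /\ t = hnext s.
Definition hsys : tsys :=
  @TSys hconf (option bool * nat)%type hstp hbit hlimc hbit_lim.
End HSys.

Lemma star_tpath (S : tsys) (P : conf S -> Prop) s m m' t : star P s m -> P m -> stp m m' ->
  star P m' t -> exists w, tpath s t w /\ forall k, w k -> exists2 c, P c & bit c k.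
Proof.
move=> /star_opath [w1 [p1 h1]] Pm st /(plus_tpath Pm st) [w2 [p2 h2]].
by exists (orf w1 w2); split; [exact: opath_ttrans p2|move=> k /orP [/h1|/h2]].
Qed.

Section Simulate.
Variables (L Hd : finType) (M : hmach L Hd) (lend : L).
Definition markT : finType := (bool + Hd)%type.
Definition mk (j : Hd) : option markT := Some (inr j).
Definition iwc (t : option bool) : option markT := omap inl t.

(** [Go q] walks right from cell 0 to the marker of the acting head, [Put j q] sets the marker in
    its new cell, [Back q] returns to cell 0. The boolean states, for start and limit, put all
    markers on cell 0. *)
Definition uM : finType := (hQ M + Hd * hQ M + hQ M + bool)%type.
Definition Go q : uM := inl (inl (inl q)).
Definition Put j q : uM := inl (inl (inr (j, q))).
Definition Back q : uM := inl (inr q).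

Definition wcell := {ffun option markT -> bool}.
Definition getc (w : wcell) : pcell := fun t => w (iwc t).
Definition setc (w : wcell) (c : pcell) : wcell :=
  [ffun i => match i with None => c None | Some (inl t) => c (Some t) | _ => w i end].
Definition setm (w : wcell) (j : Hd) (v : bool) : wcell :=
  [ffun i => if i == mk j then v else w i].
Definition allm (w : wcell) : wcell :=
  [ffun i => if i is Some (inr j) then true else w i].

Lemma setc_c w c t : setc w c (iwc t) = c t. Proof. by rewrite ffunE; case: t. Qed.
Lemma setc_m w c j : setc w c (mk j) = w (mk j). Proof. by rewrite ffunE. Qed.
Lemma setm_c w j v t : setm w j v (iwc t) = w (iwc t). Proof. by rewrite ffunE; case: t. Qed.
Lemma setm_m w j v i : setm w j v (mk i) = if i == j then v else w (mk i).
Proof. by rewrite ffunE. Qed.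
Lemma allm_c w t : allm w (iwc t) = w (iwc t). Proof. by rewrite ffunE; case: t. Qed.
Lemma allm_m w j : allm w (mk j) = true. Proof. by rewrite ffunE. Qed.

Definition sdelta (q : uM) (l : L -> bool) (w : wcell) : uM * wcell * bool :=
  match q with
  | inl (inl (inl q)) =>
      if w (mk (hhd q)) then
        let d := hdelta q l (getc w) in
        match d.2 with
        | None => (Back d.1.1, setc w d.1.2, false)
        | Some mv => (Put (hhd q) d.1.1, setm (setc w d.1.2) (hhd q) false, mv)
        end
      else (Go q, w, true)
  | inl (inl (inr (j, q))) => (Back q, setm w j true, false)
  | inl (inr q) => if l lend then (Go q, w, false) else (Back q, w, false)
  | inr true => (Go (hlim M), allm w, false)
  | inr false => (Go (hstart M), allm w, false)
  end.

Lemma sdelta_lim : (inr false : uM) <> inr true /\ forall q l w, (sdelta q l w).1.1 <> inr true.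
Proof.
split=> // -[[[q|[j q]]|q]|[]] l w //=; last by case: ifP.
by case: ifP => // _; case: (hdelta _ _ _) => [[a c] [d|]].
Qed.

Definition simM : umach L markT := @UMach L markT uM (inr false) (inr true)
  (Go (hacc M)) (Go (hrej M)) sdelta sdelta_lim.

Variable ro : nat -> L -> bool.
Hypothesis ro_end : forall k, ro k lend = (k == 0).
Local Notation HX := (hsys M ro).
Local Notation UX := (usys simM ro).
Local Notation uconf := (mconf (option markT) (uQ simM)).

(* Limits leave stray markers on the tape; only the leftmost one is used. *)
Definition srel (s : hconf M) (u : uconf) : Prop :=
  [/\ stt u = Go (hs s), hd u = 0, forall k t, tp u k (iwc t) = ht s k t &
   forall j, tp u (hp s j) (mk j) /\ forall i, i < hp s j -> tp u i (mk j) = false].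

Definition skap (k : option bool * nat) : nat * option markT := (k.2, iwc k.1).

Lemma go_step (q : hQ M) (T : nat -> wcell) i : ~~ hfinal q -> T i (mk (hhd q)) = false ->
  @stp UX (MConf T i (Go q)) (MConf T i.+1 (Go q)).
Proof.
move=> nf mi; split; first by move: nf; rewrite /hfinal /ufinal /= !negb_or.
by rewrite /unext /= mi /= updm_id.
Qed.

Lemma walk_right P (q : hQ M) (T : nat -> wcell) n : ~~ hfinal q ->
  (forall i, i < n -> T i (mk (hhd q)) = false) -> (forall h X, P (MConf T h X)) ->
  star (S := UX) P (MConf T 0 (Go q)) (MConf T n (Go q)).
Proof.
move=> nf; elim: n => [|n IH] mi PT; first exact: star0.
apply: star_trans (star1 (PT _ _) (go_step nf (mi n (ltnSn n)))).
by apply: IH => // i h; apply: mi; exact: ltnW.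
Qed.

Lemma walk_back P (q : hQ M) (T : nat -> wcell) n : (forall h X, P (MConf T h X)) ->
  star (S := UX) P (MConf T n (Back q)) (MConf T 0 (Go q)).
Proof.
move=> PT; elim: n => [|n IH].
  apply: star1 => //; split=> //.
  by rewrite /unext /= ro_end /= updm_id.
apply: starS IH => //; split=> //.
by rewrite /unext /= ro_end /= updm_id.
Qed.

Lemma sim_hstep s u : srel s u -> ~~ hfinal (hs s) -> exists u' w,
  [/\ @tpath UX u u' w, srel (hnext ro s) u' &
   forall k, w (skap k) -> hbit s k || hbit (hnext ro s) k].
Proof.
move=> [eu hu ec em] nf.
case: u eu hu ec em => T h0 q0 /= -> -> ec em.
set j := hhd (hs s); set p := hp s j.
have [mp lm] := em j.
pose d := hdelta (hs s) (ro p) (ht s p).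
have gc : getc (T p) = ht s p by apply: funext => t; rewrite /getc ec.
pose P (c : conf UX) := forall k, mbit c (skap k) -> hbit s k || hbit (hnext ro s) k.
have P0 h X : P (MConf T h X) by move=> [t k]; rewrite /mbit /= ec /hbit /= => ->.
have Pn (T' : nat -> wcell) h X : (forall k t, T' k (iwc t) = ht (hnext ro s) k t) -> P (MConf T' h X).
  by move=> e [t k]; rewrite /mbit /= e /hbit /= => ->; rewrite orbT.
have w1 := walk_right nf lm P0; rewrite -/p in w1.
have fin m' u' : @stp UX (MConf T p (Go (hs s))) m' -> star P m' u' -> srel (hnext ro s) u' ->
    exists u'0 w, [/\ @tpath UX (MConf T 0 (Go (hs s))) u'0 w,
    srel (hnext ro s) u'0 & forall k, w (skap k) -> hbit s k || hbit (hnext ro s) k].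
  move=> st w2 R; have [w [pw wP]] := star_tpath w1 (P0 _ _) st w2.
  by exists u', w; split=> // k /wP [c]; exact.
have ufin : ~~ @ufinal _ _ simM (Go (hs s)) by move: nf; rewrite /hfinal /ufinal /= !negb_or.
have d2E : (hdelta (hs s) (ro p) (getc (T p))) = d by rewrite gc.
case ed : d.2 => [mv|]; last first.
  pose T1 := updm T p (setc (T p) d.1.2).
  have T1c k t : T1 k (iwc t) = ht (hnext ro s) k t.
    by rewrite /T1 /= /updm -/j -/p; case: eqP => _; rewrite ?setc_c.
  have T1m k i : T1 k (mk i) = T k (mk i).
    by rewrite /T1 /updm; case: eqP => [->|_]; rewrite ?setc_m.
  apply: (@fin (MConf T1 p.-1 (Back d.1.1)) (MConf T1 0 (Go d.1.1))).
  - by split=> //; rewrite /unext /= mp /= d2E ed.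
  - by apply: walk_back => h X; exact: Pn.
  split=> //= i; rewrite -/j -/p -/d ed.
  have -> : (if i == j then p else hp s i) = hp s i by case: eqP => [->|].
  have [h1 h2] := em i; rewrite T1m; split=> // n /h2 <-; exact: T1m.
pose T1 := updm T p (setm (setc (T p) d.1.2) j false).
pose p' := mvh mv p.
pose T2 := updm T1 p' (setm (T1 p') j true).
have T1c k t : T1 k (iwc t) = ht (hnext ro s) k t.
  by rewrite /T1 /= /updm -/j -/p; case: eqP => _; rewrite ?setm_c ?setc_c.
have T2c k t : T2 k (iwc t) = ht (hnext ro s) k t.
  by rewrite /T2 -T1c /updm; case: eqP => [->|_]; rewrite ?setm_c.
have T2m k i : i <> j -> T2 k (mk i) = T k (mk i).
  move=> /eqP/negbTE ne; rewrite /T2 /T1 /updm; case: (k =P p') => [->|_]; rewrite ?setm_m ?ne;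
  by case: eqP => [->|_]; rewrite ?setm_m ?ne ?setc_m.
have T2j : T2 p' (mk j) by rewrite /T2 /updm eqxx setm_m eqxx.
(* After a move to the right the old marker has been erased; after a move to the left the cells
   before the new position were clear already. *)
have T2lt i : i < p' -> T2 i (mk j) = false.
  move=> ip; rewrite /T2 {1}/updm (ltn_eqF ip) /T1 /updm.
  case: (i =P p) => [_|ne]; first by rewrite setm_m eqxx.
  apply: lm; rewrite -/p; move: ip; rewrite /p' /mvh.
  by case: mv {ed p' T2 T2c T2m T2j} => h; [rewrite ltn_neqAle; apply/andP; split; [apply/eqP|]|exact: leq_trans h (leq_pred p)].
apply: (@fin (MConf T1 p' (Put j d.1.1)) (MConf T2 0 (Go d.1.1))).
- by split=> //; rewrite /unext /= mp /= d2E ed.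
- apply: (@starS UX P _ (MConf T2 p'.-1 (Back d.1.1))) => //.
  + exact: Pn.
  by apply: walk_back => h X; exact: Pn.
split=> //= i; rewrite -/j -/p -/d ed; case: (i =P j) => [->|ne]; first by split.
by have [h1 h2] := em i; rewrite T2m //; split=> // n /h2 <-; exact: T2m.
Qed.

Lemma start_step (T : nat -> wcell) (s : hconf M) X :
  X = (inr true : uM) /\ hs s = hlim M \/ X = (inr false : uM) /\ hs s = hstart M ->
  (forall j, hp s j = 0) -> (forall k t, T k (iwc t) = ht s k t) ->
  exists u', @stp UX (MConf T 0 X) u' /\ srel s u'.
Proof.
move=> eX ep ec; exists (MConf (updm T 0 (allm (T 0))) 0 (Go (hs s))); split.
  by split; [case: eX => -[-> _]|case: eX => -[-> ->]].
split=> //=.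
  by move=> k t; rewrite /updm; case: eqP => [->|_]; rewrite ?allm_c ec.
by move=> j; rewrite ep; split=> //; rewrite /updm /= allm_m.
Qed.

Lemma hsim_path s t v u : @tpath HX s t v -> srel s u -> exists u' w, @tpath UX u u' w /\ srel t u'.
Proof.
move=> p R; have [|||u' [w [pw R' _ _ _]]] := @forward_sim HX UX srel skap (fun _ => None) _ _ _ s t v p u R.
- by move=> a c [_ _ ec _]; split=> // -[t' k]; exact: ec.
- move=> a c d Ra [nf ->]; have [u' [w [pw R' wP]]] := sim_hstep Ra nf.
  by exists u', w.
- move=> f g gf _.
  have [|||u' [st R']] := @start_step (tp (@lmc UX g)) (@lmc HX f) (inr true).
  + by left.
  + by [].
  + by move=> k t'; rewrite -[LHS]/(@bit UX (lmc g) (skap (t', k))) bit_lmc gf.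
  exists u', (@bit UX (@lmc UX g)); split=> //; first by right; exact: tpath1.
  by move=> k; rewrite bit_lmc gf.
by exists u', w.
Qed.
End Simulate.

(** * The universal machine *)

Definition triple : finType := (bool * bool * bool)%type.
(** [lSec] marks where sections start, [lEnt e] the entry for the scanned triple [e]; at an entry
    [lOut] and [lMv] tell what to write and how to move, and the [lRun] marks after it count the new
    state in unary. *)
Definition label : finType := (triple + option bool + triple)%type.
Definition lEnt (e : triple) : label := inl (inl e).
Definition lOut (t : option bool) : label := inl (inr t).
Definition lMv : label := inr (false, false, false).
Definition lHalt : label := inr (false, false, true).
Definition lRun : label := inr (false, true, false).
Definition lSec : label := inr (false, true, true).
Definition lStart : label := inr (true, false, false).
Definition lLim : label := inr (true, false, true).
Definition lEnd : label := inr (true, true, false).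

(** [CK] tests for the halting section, [OC] looks at the output, [RD] reads the simulated cell,
    [FD] seeks its entry, [WR] writes and moves, [RN], [AD] and [AE] advance the other head by one
    section per unary mark, [RS] rewinds; [LM] and [ST] seek the section of the limit and the start
    state. *)
Definition hst : finType :=
  (bool * (triple + triple + triple * bool) + bool * bool)%type.
Notation CK b := (inl (b, inl (inl (false, false, false)))).
Notation OC b := (inl (b, inl (inl (false, false, true)))).
Notation RD b := (inl (b, inl (inl (false, true, false)))).
Notation RN b := (inl (b, inl (inl (false, true, true)))).
Notation AD b := (inl (b, inl (inl (true, false, false)))).
Notation AE b := (inl (b, inl (inl (true, false, true)))).
Notation RS b := (inl (b, inl (inl (true, true, _)))).
Notation RSt b := (inl (b, inl (inl (true, true, false)))).
Notation FD b e := (inl (b, inl (inr e))).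
Notation WR b e mv := (inl (b, inr (e, mv))).
Notation LM := (inr (false, false)).
Notation ST := (inr (false, true)).
Notation ACC := (inr (true, false)).
Notation REJ := (inr (true, true)).

(* Head [None] is the simulated head.  Head [Some b] stands in the program at
   the section of the current state; the successor state is given in unary,
   and while [Some b] walks along it, [Some (~~ b)] passes from section to
   section, after which the two exchange their roles. *)
Definition uhd (q : hst) : option bool :=
  match q with
  | RD _ | WR _ _ _ => None
  | OC b | AD b | AE b => Some (~~ b)
  | CK b | RN b | RS b | FD b _ => Some b
  | _ => Some false
  end.

(** [OC] contains the reversal needed for the diagonal argument: output 1 leads to rejection, output
    0 to acceptance. It reads through the idle head, which rests at cell 0. *)
Definition hdel (q : hst) (l : label -> bool) (c : pcell) : hst * pcell * option bool :=
  match q with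
  | CK b => if l lHalt then (OC b, c, None) else (RD b, c, None)
  | OC b => (if c (Some true) then REJ else ACC, c, None)
  | RD b => (FD b (cellf c), c, None)
  | FD b e => if l (lEnt e)
              then (WR b (cellf (fun t => l (lOut t))) (l lMv), c, Some true)
              else (FD b e, c, Some true)
  | WR b e mv => (RN b, cf_cell e, Some mv)
  | RN b => if l lRun then (AD b, c, Some true)
            else (RSt b, c, None)
  | AD b => (AE b, c, Some true)
  | AE b => if l lSec then (RN b, c, None) else (AE b, c, Some true)
  | RS b => if l lEnd then (CK (~~ b), c, None)
            else (RSt b, c, Some false)
  | LM => if l lLim then (CK false, c, None) else (LM, c, Some true)
  | ST => if l lStart then (CK false, c, None) else (ST, c, Some true)
  | _ => (q, c, None)
  end.

Definition univ : hmach label (option bool) := @HMach label (option bool) hst ST LM ACC REJ uhd hdel.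

Section Program.
Variables (p : ittm) (ro : nat -> label -> bool) (B : nat) (entpos : nat -> triple -> nat).
Let tgt (q : 'I_(dst p)) (e : triple) : nat := (dtrans p (q, e)).1.1.
Let newc (q : 'I_(dst p)) (e : triple) : cell := (dtrans p (q, e)).1.2.
Let mov (q : 'I_(dst p)) (e : triple) : bool := (dtrans p (q, e)).2.

Hypothesis ro_end : forall k, ro k lEnd = (k == 0).
Hypothesis ro_halt : forall q : 'I_(dst p), ro (B * q) lHalt = (q == dst_halt p).
Hypothesis ent_gt : forall (q : 'I_(dst p)) e, B * q <= entpos q e.
Hypothesis ro_ent : forall (q : 'I_(dst p)) e, ro (entpos q e) (lEnt e).
Hypothesis ro_nent : forall (q : 'I_(dst p)) e k, B * q <= k < entpos q e -> ro k (lEnt e) = false.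
Hypothesis ro_out : forall (q : 'I_(dst p)) e t, ro (entpos q e) (lOut t) = cf_cell (newc q e) t.
Hypothesis ro_mv : forall (q : 'I_(dst p)) e, ro (entpos q e) lMv = mov q e.
Hypothesis ro_run : forall (q : 'I_(dst p)) e i, i < tgt q e -> ro (entpos q e + i.+1) lRun.
Hypothesis ro_nrun : forall (q : 'I_(dst p)) e, ro (entpos q e + (tgt q e).+1) lRun = false.
Hypothesis B_gt0 : 0 < B.
Hypothesis ro_sec : forall i, ro (B * i) lSec.
Hypothesis ro_nsec : forall i j, 0 < j < B -> ro (B * i + j) lSec = false.
Hypothesis ro_start : ro (B * dst_start p) lStart.
Hypothesis ro_nstart : forall k, k < B * dst_start p -> ro k lStart = false.
Hypothesis ro_lim : ro (B * dst_limit p) lLim.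
Hypothesis ro_nlim : forall k, k < B * dst_limit p -> ro k lLim = false.

Local Notation HX := (hsys univ ro).
Local Notation PX := (nsys (ittm_as_nittm p)).
Local Notation hc := (hconf univ).

Definition hpos (b : bool) (h s n : nat) : option bool -> nat :=
  fun j => if j is Some b' then (if b' == b then s else n) else h.
Definition mkh (T : nat -> pcell) b h s n (q : hst) : conf HX := @HConf _ _ univ T (hpos b h s n) q.

Lemma hpos_flip b h s n : hpos b h s n = hpos (~~ b) h n s.
Proof. by apply: funext => -[[]|]; case: b. Qed.

Lemma hp_eq (f g : option bool -> nat) : f None = g None -> (forall b, f (Some b) = g (Some b)) -> f = g.
Proof. by move=> h1 h2; apply: funext => -[b|]. Qed.

Lemma step_S (b : bool) T h s n q q' d : ~~ @hfinal _ _ univ q -> uhd q = Some b ->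
  hdel q (ro s) (T s) = (q', T s, d) ->
  @stp HX (mkh T b h s n q) (mkh T b h (if d is Some mv then mvh mv s else s) n q').
Proof.
move=> nf uq e; split=> //; rewrite /hnext /mkh /= uq /= eqxx e /= updm_id; congr HConf.
by apply: hp_eq => // -[]; case: b {uq e}; rewrite /= ?eqxx.
Qed.

Lemma step_N (b : bool) T h s n q q' d : ~~ @hfinal _ _ univ q -> uhd q = Some (~~ b) ->
  hdel q (ro n) (T n) = (q', T n, d) ->
  @stp HX (mkh T b h s n q) (mkh T b h s (if d is Some mv then mvh mv n else n) q').
Proof.
by rewrite /mkh !(hpos_flip b); move=> h1 h2 h3; exact: (step_S h s h1 h2 h3).
Qed.

Lemma step_H (b : bool) T h s n q q' c d : ~~ @hfinal _ _ univ q -> uhd q = None ->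
  hdel q (ro h) (T h) = (q', c, d) ->
  @stp HX (mkh T b h s n q) (mkh (updm T h c) b (if d is Some mv then mvh mv h else h) s n q').
Proof.
move=> nf uq e; split=> //; rewrite /hnext /mkh /= uq /= e /=; congr HConf.
by apply: hp_eq => // -[]; case: b {uq e}.
Qed.

Arguments step_S {b T h s n q q' d}.
Arguments step_N {b T h s n q q' d}.
Arguments step_H {b T h s n q q' c d}.

Section Walk.
Variable P : conf HX -> Prop.

Lemma walk_S b T h s n q (k : nat) : (forall s, P (mkh T b h s n q)) ->
  ~~ @hfinal _ _ univ q -> uhd q = Some b ->
  (forall i c, s <= i < s + k -> hdel q (ro i) c = (q, c, Some true)) ->
  star P (mkh T b h s n q) (mkh T b h (s + k) n q).
Proof.
move=> PT nf uq; elim: k => [|k IH] H; first by rewrite addn0; exact: star0.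
apply: star_trans (IH _) _.
  by move=> i c /andP [h1 h2]; apply: H; rewrite h1 addnS ltnS ltnW.
apply: star1 => //; rewrite addnS; apply: (step_S (d := Some true)) => //.
by apply: H; rewrite leq_addr addnS ltnSn.
Qed.

Lemma walk_N b T h s n q (k : nat) : (forall n, P (mkh T b h s n q)) ->
  ~~ @hfinal _ _ univ q -> uhd q = Some (~~ b) ->
  (forall i c, n <= i < n + k -> hdel q (ro i) c = (q, c, Some true)) ->
  star P (mkh T b h s n q) (mkh T b h s (n + k) q).
Proof.
move=> PT nf uq H; rewrite /mkh !(hpos_flip b); apply: walk_S => // i.
by rewrite /mkh -(hpos_flip b); exact: PT.
Qed.

(** The rewound head becomes the idle one at cell 0, while the other already stands at the new
    section; this restores the shape of [prel] with [b] negated. *)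
Lemma walk_home b T h s n : (forall s q, P (mkh T b h s n q)) ->
  star P (mkh T b h s n (RSt b)) (mkh T (~~ b) h n 0 (CK (~~ b))).
Proof.
move=> PT; elim: s => [|s IH].
  apply: star1 => //; rewrite [mkh T (~~ b) _ _ _ _]/mkh -hpos_flip.
  by apply: (step_S (d := None)) => //=; rewrite ro_end.
apply: starS IH => //; apply: (step_S (d := Some false)) => //=.
by rewrite ro_end.
Qed.

Lemma walk_lim T n : (forall s q, P (mkh T false 0 s n q)) ->
  star P (mkh T false 0 0 n LM) (mkh T false 0 (B * dst_limit p) n (CK false)).
Proof.
move=> PT; rewrite -[X in star _ _ (mkh _ _ _ X _ _)]add0n.
apply: star_trans (@walk_S _ _ _ _ _ _ (B * dst_limit p) _ _ _ _) _ => //.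
  by move=> i c /andP [_ h] /=; rewrite ro_nlim.
by apply: star1 => //; apply: (step_S (d := None)) => //=; rewrite add0n ro_lim.
Qed.

Lemma walk_start T n : (forall s q, P (mkh T false 0 s n q)) ->
  star P (mkh T false 0 0 n ST) (mkh T false 0 (B * dst_start p) n (CK false)).
Proof.
move=> PT; rewrite -[X in star _ _ (mkh _ _ _ X _ _)]add0n.
apply: star_trans (@walk_S _ _ _ _ _ _ (B * dst_start p) _ _ _ _) _ => //.
  by move=> i c /andP [_ h] /=; rewrite ro_nstart.
by apply: star1 => //; apply: (step_S (d := None)) => //=; rewrite add0n ro_start.
Qed.

Lemma walk_run b T h (q : 'I_(dst p)) e : (forall s n q, P (mkh T b h s n q)) ->
  star P (mkh T b h (entpos q e).+1 0 (RN b)) (mkh T b h (entpos q e + (tgt q e).+1) (B * tgt q e) (RN b)).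
Proof.
move=> PT.
suff H i : i <= tgt q e -> star P (mkh T b h (entpos q e).+1 0 (RN b)) (mkh T b h (entpos q e + i.+1) (B * i) (RN b)).
  exact: H.
elim: i => [|i IH] it; first by rewrite addn1 muln0; exact: star0.
apply: star_trans (IH (ltnW it)) _.
apply: (starS (t := mkh T b h (entpos q e + i.+2) (B * i) (AD b))) => //.
  by rewrite (addnS _ i.+1); apply: (step_S (d := Some true)) => //=; rewrite ro_run.
apply: (starS (t := mkh T b h (entpos q e + i.+2) (B * i).+1 (AE b))) => //.
  by apply: (step_N (d := Some true)).
(* [AD] has moved one cell off the start of section [i], so [B.-1] moves remain to the start of
   section [i.+1]. *)
apply: (star_trans (@walk_N _ _ _ _ _ _ B.-1 _ _ _ _)) => //.
  move=> n c /andP [h1 h2] /=; suff -> : ro n lSec = false by [].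
  have -> : n = B * i + (n - B * i) by rewrite subnKC // ltnW.
  apply: ro_nsec; rewrite subn_gt0 h1 /= ltn_subLR; last exact: ltnW.
  by move: h2; rewrite addSnnS prednK.
rewrite addSnnS prednK // -mulnSr.
by apply: star1 => //; apply: (step_N (d := None)) => //=; rewrite ro_sec.
Qed.
End Walk.

Definition prel (s : snapshot (dst p)) (u : conf HX) : Prop :=
  exists b, u = mkh (fun k t => sbit s (t, k)) b (s_head s) (B * s_state s) 0 (CK b).

Lemma sim_pstep (s t : snapshot (dst p)) u : prel s u -> @stp PX s t ->
  exists u' w, [/\ tpath u u' w, prel t u' & forall k, w k -> sbit s k || sbit t k].
Proof.
move=> [b ->] [nh [ins [tr et]]]; rewrite /= in tr nh.
set T := fun k t => sbit s (t, k).
pose e : triple := cell_at s.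
pose q := s_state s.
have eT : cellf (T (s_head s)) = e by [].
have edt : dtrans p (q, e) = ins by [].
pose T' := updm T (s_head s) (cf_cell (newc q e)).
have tE : (fun k t0 => sbit t (t0, k)) = T'.
  rewrite et; apply: funext => k; apply: funext => t0.
  rewrite /T' /newc edt /updm /T; case: ins {tr edt et} => [[q' [[a1 a2] a3]] mv].
  by rewrite /sbit /= /upd; case: t0 => [[]|]; case: eqP.
have th : s_head t = mvh (mov q e) (s_head s).
  by rewrite et /mov edt; case: ins {tr edt et} => [[q' [[a1 a2] a3]] mv].
have ts : s_state t = tgt q e :> nat.
  by rewrite et /tgt edt; case: ins {tr edt et} => [[q' [[a1 a2] a3]] mv].
pose P (c : conf HX) := forall k, hbit c k -> sbit s k || sbit t k.
have PT b' h s' n X : P (mkh T b' h s' n X) by move=> [t0 k]; rewrite /hbit /T /= => ->.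
have PT' b' h s' n X : P (mkh T' b' h s' n X).
  by move=> [t0 k]; rewrite /hbit /= -tE => ->; rewrite orbT.
pose u' := mkh T' (~~ b) (s_head t) (B * s_state t) 0 (CK (~~ b)).
have st : star P (mkh T b (s_head s) (B * q) 0 (RD b)) u'.
  apply: (starS (t := mkh T b (s_head s) (B * q) 0 (FD b e))) => //.
    have := @step_H b T (s_head s) (B * q) 0 (RD b) (FD b e) (T (s_head s)) None erefl erefl erefl.
    by rewrite updm_id.
  have eent : B * q + (entpos q e - B * q) = entpos q e by rewrite subnKC.
  apply: star_trans (@walk_S _ _ _ _ _ _ _ (entpos q e - B * q) _ _ _ _) _ => //.
    by move=> i c; rewrite eent => h /=; rewrite (ro_nent h).
  rewrite eent.
  apply: (starS (t := mkh T b (s_head s) (entpos q e).+1 0 (WR b (newc q e) (mov q e)))) => //.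
    apply: (step_S (d := Some true)) => //=; rewrite ro_ent ro_mv.
    have -> : (fun t0 => ro (entpos q e) (lOut t0)) = cf_cell (newc q e) by apply: funext => t0; rewrite ro_out.
    by rewrite cf_cellK.
  apply: (starS (t := mkh T' b (s_head t) (entpos q e).+1 0 (RN b))) => //.
    rewrite th; exact: (step_H (d := Some (mov q e))).
  apply: (star_trans (walk_run (P := P) q e _)) => //.
  apply: (starS (t := mkh T' b (s_head t) (entpos q e + (tgt q e).+1) (B * tgt q e) (RSt b))) => //.
    by apply: (step_S (d := None)) => //=; rewrite ro_nrun.
  by rewrite /u' ts; apply: walk_home.
have s1 : @stp HX (mkh T b (s_head s) (B * q) 0 (CK b)) (mkh T b (s_head s) (B * q) 0 (RD b)).
  by apply: (step_S (d := None)) => //=; rewrite ro_halt; case: eqP.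
have [w [pw wP]] := plus_tpath (PT _ _ _ _ _) s1 st.
exists u', w; split=> //; first by exists (~~ b); rewrite /u' tE.
by move=> k /wP [c]; exact.
Qed.

Lemma sim_ppath s t v u : @tpath PX s t v -> prel s u -> exists u' w, tpath u u' w /\ prel t u'.
Proof.
move=> pa R; have [|||u' [w [pw R' _ _ _]]] := @forward_sim PX HX prel id (fun _ => None) _ _ _ s t v pa u R.
- by move=> a c [b ->]; split=> // -[t' k].
- by move=> a c d Ra st; have [u' [w [pw R' wP]]] := sim_pstep Ra st; exists u', w.
- move=> f g gf _; have egf : g = f by apply: funext.
  have e0 : @lmc HX g = mkh (fun k t => f (t, k)) false 0 0 0 LM.
    by rewrite egf /mkh; congr HConf; apply: hp_eq => // b; rewrite /=; case: ifP.
  pose P (c : conf HX) := forall k, hbit c k -> f k.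
  have PT : forall s q, P (mkh (fun k t => f (t, k)) false 0 s 0 q) by move=> s' q [t' k].
  have [w [ow wP]] := star_opath (walk_lim PT).
  exists (mkh (fun k t => f (t, k)) false 0 (B * dst_limit p) 0 (CK false)), w; split.
  + by rewrite e0.
  + exists false; congr mkh; apply: funext => k; apply: funext => t'.
    by rewrite -[RHS]/(@bit PX (@lmc PX f) (t', k)) bit_lmc.
  + by move=> k /wP [c]; exact.
  + by [].
by exists u', w.
Qed.

Lemma sim_halt (s : snapshot (dst p)) u : prel s u -> s_state s = dst_halt p ->
  exists u' w, @opath HX u u' w /\ hs u' = if s_out s 0 then REJ else ACC.
Proof.
move=> [b ->] es; pose T : nat -> pcell := fun k t => sbit s (t, k).
have st : star (S := HX) (fun _ => True) (mkh T b (s_head s) (B * s_state s) 0 (CK b))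
   (mkh T b (s_head s) (B * s_state s) 0 (if s_out s 0 then REJ else ACC)).
  apply: (starS (t := mkh T b (s_head s) (B * s_state s) 0 (OC b))) => //.
    by apply: (step_S (d := None)) => //=; rewrite ro_halt es eqxx.
  apply: star1 => //; apply: (step_N (d := None)) => //.
have [w [ow _]] := star_opath st.
by exists (mkh T b (s_head s) (B * s_state s) 0 (if s_out s 0 then REJ else ACC)), w.
Qed.
End Program.

(** * Layout of a program and the diagonal input *)

Lemma divn_uniq d q r q' r' : r < d -> r' < d -> d * q + r = d * q' + r' -> q = q' /\ r = r'.
Proof.
move=> h h' e; have d0 : 0 < d by exact: leq_ltn_trans h.
have e1 : (d * q + r) %/ d = (d * q' + r') %/ d by rewrite e.
have e2 : (d * q + r) %% d = (d * q' + r') %% d by rewrite e.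
move: e1 e2; rewrite ![d * _]mulnC !divnMDl // !divn_small // !addn0.
by rewrite !modnMDl !modn_small.
Qed.

Section Layout.
Variable p : ittm.
Let E := (dst p).+2.
(** One cell for the marks of the section, then a field of length [(dst p).+2] per triple, with room
    for the entry cell, fewer than [dst p] unary marks and an unmarked cell ending them. *)
Definition secw := (#|triple| * (dst p).+2).+1.
Definition entpos (q : nat) (e : triple) : nat := secw * q + (enum_rank e * (dst p).+2).+1.

Lemma ent_off (e : triple) i : i < E -> enum_rank e * E + i < #|triple| * E.
Proof.
move=> h; have := ltn_ord (enum_rank e); rewrite -(leq_pmul2r (m := E)) //.
by apply: leq_trans; rewrite mulSn addnC ltn_add2r.
Qed.

(** Positions are read in mixed radix as section, field and offset, so distinct entries never share
    a cell. *)
Lemma entpos_inj q e i q' e' i' : i < E -> i' < E ->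
  entpos q e + i = entpos q' e' + i' -> [/\ q = q', e = e' & i = i'].
Proof.
move=> hi hi'; rewrite /entpos -[LHS]addnA -[RHS]addnA => eq.
have o1 : (enum_rank e * (dst p).+2).+1 + i < secw := ent_off e hi.
have o2 : (enum_rank e' * (dst p).+2).+1 + i' < secw := ent_off e' hi'.
have [-> [eq']] := divn_uniq o1 o2 eq.
rewrite ![_ * E]mulnC in eq'.
by have [/val_inj/enum_rank_inj -> ->] := divn_uniq hi hi' eq'.
Qed.

Lemma entpos_inj0 q e q' e' : entpos q e = entpos q' e' -> q = q' /\ e = e'.
Proof. by move=> h; have [] := @entpos_inj q e 0 q' e' 0 isT isT (congr1 (addn^~ 0) h). Qed.

Definition prog (k : nat) (l : label) : bool :=
  match l with
  | inl (inl e) => `[< exists q : 'I_(dst p), k = entpos q e >]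
  | inl (inr t) => `[< exists (q : 'I_(dst p)) e, k = entpos q e /\
                        cf_cell (dtrans p (q, e)).1.2 t >]
  | inr (false, false, false) => `[< exists (q : 'I_(dst p)) e, k = entpos q e /\ (dtrans p (q, e)).2 >]
  | inr (false, false, true) => k == secw * dst_halt p
  | inr (false, true, false) => `[< exists (q : 'I_(dst p)) e i,
                        i < (dtrans p (q, e)).1.1 /\ k = entpos q e + i.+1 >]
  | inr (false, true, true) => secw %| k
  | inr (true, false, false) => k == secw * dst_start p
  | inr (true, false, true) => k == secw * dst_limit p
  | inr (true, true, false) => k == 0
  | _ => false
  end.

Lemma prog_halt (q : 'I_(dst p)) : prog (secw * q) lHalt = (q == dst_halt p).
Proof. by rewrite /= eqn_pmul2l. Qed.

Lemma prog_ent (q : 'I_(dst p)) e : prog (entpos q e) (lEnt e).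
Proof. by apply/asboolP; exists q. Qed.

Lemma prog_nent (q : 'I_(dst p)) e k : secw * q <= k < entpos q e -> prog k (lEnt e) = false.
Proof.
move=> /andP [h1 h2]; apply/negbTE/asboolPn => -[q' ek].
have lt : q' < q by move: h2; rewrite ek /entpos ltn_add2r ltn_pmul2l.
move: h1; rewrite leqNgt ek => /negP; apply.
have o := @ent_off e 0 isT; rewrite addn0 in o.
apply: (@leq_trans (secw * q'.+1)); last by rewrite leq_pmul2l.
by rewrite /entpos (mulnSr _ q') ltn_add2l; exact: o.
Qed.

Lemma prog_out (q : 'I_(dst p)) e t : prog (entpos q e) (lOut t) = cf_cell (dtrans p (q, e)).1.2 t.
Proof.
apply/asboolP/idP => [[q' [e' [/entpos_inj0 [/val_inj -> ->]]]] //|h].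
by exists q, e.
Qed.

Lemma prog_mv (q : 'I_(dst p)) e : prog (entpos q e) lMv = (dtrans p (q, e)).2.
Proof.
apply/asboolP/idP => [[q' [e' [/entpos_inj0 [/val_inj -> ->]]]] //|h].
by exists q, e.
Qed.

Lemma prog_run (q : 'I_(dst p)) e i : i < (dtrans p (q, e)).1.1 -> prog (entpos q e + i.+1) lRun.
Proof. by move=> h; apply/asboolP; exists q, e, i. Qed.

Lemma prog_nrun (q : 'I_(dst p)) e : prog (entpos q e + (dtrans p (q, e)).1.1.+1) lRun = false.
Proof.
apply/negbTE/asboolPn => -[q' [e' [i [lt eq]]]].
have lt1 := ltn_ord (dtrans p (q, e)).1.1; have lt2 := ltn_ord (dtrans p (q', e')).1.1.
have s1 : (dtrans p (q, e)).1.1.+1 < (dst p).+2 := leqW lt1.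
have s2 : i.+1 < (dst p).+2 := leqW (ltn_trans lt lt2).
have [/val_inj e1 e2 [e3]] := entpos_inj s1 s2 eq.
by move: lt; rewrite -e1 -e2 -e3 ltnn.
Qed.

Lemma prog_sec i : prog (secw * i) lSec. Proof. by rewrite /= dvdn_mulr. Qed.

Lemma prog_nsec i j : 0 < j < secw -> prog (secw * i + j) lSec = false.
Proof. by move=> /andP [h1 h2]; rewrite /= dvdn_addr ?dvdn_mulr // gtnNdvd. Qed.

End Layout.

Definition universal : umach label (markT (option bool)) := simM univ lEnd.
Local Notation J := (slot label (markT (option bool))).
Local Notation j0 := (inl (inl true) : J).

(** This makes [n %/ #|J|] smaller than a positive [n], on which the recursion behind [diag]
    rests. *)
Lemma slot_gt1 : 1 < #|J|.
Proof. by rewrite /slot !card_sum card_bool. Qed.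

(** * The diagonal real and undecidability *)

Section Diagonal.
Variable p : ittm.

(* In one slot of each block the input repeats itself, so that the universal
   machine, which takes the simulated input from there, runs [p] on [diag]. *)
Fixpoint diag_rec (f n : nat) : bool :=
  if f is f'.+1 then
    match sl j0 (n %% #|J|) with
    | inl (inl true) => diag_rec f' (n %/ #|J|)
    | inr l => prog p (n %/ #|J|) l
    | _ => false
    end
  else false.
Definition diag (n : nat) : bool := diag_rec n.+1 n.

Lemma diag_recS f n : diag_rec f.+1 n = match sl j0 (n %% #|J|) with
    | inl (inl true) => diag_rec f (n %/ #|J|)
    | inr l => prog p (n %/ #|J|) l
    | _ => false
    end.
Proof. by []. Qed.

Lemma diag_stable f n : n < f -> diag_rec f n = diag n.
Proof.
elim/ltn_ind: n f => n IH [//|f] nf.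
case: n IH nf => [|n] IH nf; rewrite /diag (diag_recS f); last first.
  rewrite (diag_recS n.+1).
  have lt : n.+1 %/ #|J| < n.+1 by rewrite ltn_Pdiv // slot_gt1.
  by case: (sl _ _) => [[[]|]|] //; rewrite (IH _ lt _ lt) (IH _ lt f (leq_trans lt nf)).
rewrite (diag_recS 0).
case e0 : (sl _ _) => [[[]|]|] //; rewrite div0n.
(* Division does not decrease 0: if position 0 lies in the self-referring slot, its value is [false]
   for every amount of fuel. *)
by elim: f {IH nf} => // f IHf; rewrite diag_recS e0 div0n.
Qed.

Lemma diag_self k : diag (#|J| * k + rk j0) = diag k.
Proof.
case: (posnP (#|J| * k + rk j0)) => [e|gt0].
  by move/eqP: e; rewrite addn_eq0 muln_eq0 gtn_eqF ?(ltnW slot_gt1) //= => /andP [/eqP -> /eqP ->]; rewrite muln0.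
have dv := @divk J j0 k _ (rk_lt j0); have md := @modk J k _ (rk_lt j0).
rewrite {1}/diag diag_recS md rkK dv diag_stable // -{1}dv.
by rewrite ltn_Pdiv // slot_gt1.
Qed.

Lemma diag_prog k l : rox (markT (option bool)) diag k l = prog p k l.
Proof.
have dv := @divk J j0 k _ (rk_lt (inr l : J)); have md := @modk J k _ (rk_lt (inr l : J)).
by rewrite /rox /diag diag_recS md rkK dv.
Qed.

Lemma ro_diag : @rox label (markT (option bool)) diag = prog p.
Proof. by apply: funext => k; apply: funext => l; exact: diag_prog. Qed.

Local Notation PX := (nsys (ittm_as_nittm p)).

Lemma psys_det : deterministic PX.
Proof. by move=> s t t' [_ [i [/= <- ->]]] [_ [i' [/= <- ->]]]. Qed.

(** The given well-order is arbitrary. If no countable computation reached a halting configuration,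
    the machine would loop, contradicting the halting run; so one is reached, and by determinism it
    is the last configuration of the run. *)
Lemma halting_opath x W (lt : W -> W -> Prop) (c : W -> snapshot (dst p)) top :
  halting_computation (ittm_as_nittm p) x lt c top ->
  exists v, @opath PX (initial (ittm_as_nittm p) x) (c top) v.
Proof.
move=> h; have [run tpb [bot cb bt] ha] := halting_run h.
have haltP (s : snapshot (dst p)) : s_state s = dst_halt p -> @halted PX s by move=> e t [].
pose init := initial (ittm_as_nittm p) x.
case: (EM (exists s v, @opath PX init s v /\ s_state s = dst_halt p)) => [[s [v [ps es]]]|nh].
  exists v; suff -> : c top = s by [].
  case: ps => [[e _]|ps].
    case: (bt top) => [<-|bt']; first by rewrite cb.
    case: run => wo st _; have [d bd _] := succ_exists wo bt'.
    by case: (haltP _ es (c d)); rewrite -e /init -cb; exact: st.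
  have [e [_ ce _]] := follow psys_det run tpb (haltP _ ha) ps cb.
  case: (tpb e) => [<-//|et]; case: run => wo st _; have [d ed _] := succ_exists wo et.
  by case: (haltP _ es (c d)); rewrite -ce; exact: st.
exfalso; have [|A [v0 [v [p0 pl vA]]]] := @nonhalting_loop PX init.
  move=> t v pt; exists (@apply_instr (dst p) t (dtrans p (s_state t, cell_at t))); split.
    by move=> e; apply: nh; exists t, v.
  by eexists; split.
exact: (run_no_loop psys_det run tpb (haltP _ ha) cb p0 pl vA).
Qed.

(** Two simulations are composed, of [p] by the machine with several heads and of that by
    [universal]; [diag] supplies the table of [p] as labels and itself as the simulated input. *)
Lemma diag_simulation s v : @opath PX (initial (ittm_as_nittm p) diag) s v ->
  s_state s = dst_halt p -> ureach diag (if s_out s 0 then urej universal else uacc universal).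
Proof.
move=> ps es; have ro_end k : prog p k lEnd = (k == 0) by [].
pose T0 : nat -> pcell := fun k t => sbit (initial (ittm_as_nittm p) diag) (t, k).
pose h0 : hconf univ := mkh (prog p) T0 false 0 0 0 ST.
have [u0 [st0 R0]] : exists u', @stp (usys universal (prog p)) (uinit universal diag) u' /\ srel (lend := lEnd) h0 u'.
  apply: (@start_step _ _ univ lEnd (prog p)); first by right.
    by move=> [b|] //=; case: ifP.
  by move=> k [[]|]; rewrite ffunE //= diag_self.
have sE0 : prog p (secw p * dst_start p) lStart by rewrite /= eqxx.
have sN0 k : k < secw p * dst_start p -> prog p k lStart = false by move=> h; rewrite /= ltn_eqF.
have lE0 : prog p (secw p * dst_limit p) lLim by rewrite /= eqxx.
have lN0 k : k < secw p * dst_limit p -> prog p k lLim = false by move=> h; rewrite /= ltn_eqF.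
have ent (q : 'I_(dst p)) e : secw p * q <= entpos p q e by rewrite leq_addr.
pose h1 : hconf univ := mkh (prog p) T0 false 0 (secw p * dst_start p) 0 (CK false).
have [w1 [o1 _]] := star_opath (@walk_start p (prog p) (secw p) sE0 sN0 (fun _ => True) T0 0 (fun _ _ => I)).
have R1 : @prel p (prog p) (secw p) (initial (ittm_as_nittm p) diag) h1 by exists false.
have [h2 [w2 [o2 R2]]] : exists h w, @opath (hsys univ (prog p)) h1 h w /\ @prel p (prog p) (secw p) s h.
  case: ps => [[<- _]|ps]; first by exists h1, (fun _ => false); split=> //; left.
  have [h [w [pw R]]] := sim_ppath ro_end (@prog_halt p) ent (@prog_ent p) (@prog_nent p)
    (@prog_out p) (@prog_mv p) (@prog_run p) (@prog_nrun p) isT (@prog_sec p) (@prog_nsec p)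
    lE0 lN0 ps R1.
  by exists h, w; split=> //; right.
have [h3 [w3 [o3 e3]]] := sim_halt (@prog_halt p) R2 es.
have o123 := opath_trans (opath_trans o1 o2) o3.
have [u3 [w4 [p3 R3]]] : exists u w, @opath (usys universal (prog p)) u0 u w /\ srel (lend := lEnd) h3 u.
  case: o123 => [[e _]|ph].
    by exists u0, (fun _ => false); split; [left|rewrite -e].
  have [u [w [pw R]]] := hsim_path (lend := lEnd) ro_end ph R0.
  by exists u, w; split=> //; right.
exists u3, (orf (@bit (usys universal (prog p)) (uinit universal diag)) w4); rewrite ro_diag; split.
  by right; apply: tpath_otrans p3; exact: tpath1.
by case: R3 => -> _ _ _; rewrite e3; case: ifP.
Qed.
End Diagonal.

Lemma universal_acc_lim : uacc universal <> ulim universal. Proof. by []. Qed.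
Lemma universal_rej_lim : urej universal <> ulim universal. Proof. by []. Qed.
Lemma universal_acc_rej : uacc universal <> urej universal. Proof. by []. Qed.

(** If a decider [p] outputs 1 on [diag p], this real is accepted by the choice of [p] but rejected
    by the simulation. If [p] outputs 0, the simulation accepts, so [p] should have output 1. *)
Theorem accepted_undecidable : ~ ittm_decidable (accepted universal).
Proof.
move=> [p dec]; have [[W [lt [c [top hc]]]] out] := dec (diag p).
have [v pv] := halting_opath hc; have [oa ao] := out W lt c top hc.
have es : s_state (c top) = dst_halt p by have [_ _ _ ] := halting_run hc.
have := diag_simulation pv es; case eo : (s_out (c top) 0) => h.
  exact: (accepted_rejected universal_acc_rej (oa eo) h).
by have := ao h; rewrite /outputs_one eo.
Qed.

Theorem theorem2p2 :
  ~ (forall A : real -> Prop,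
       ittm_decidable A <-> (nittm_recognizable A /\ co_nittm_recognizable A)).
Proof.
move=> H; apply: accepted_undecidable; apply/H; split.
  exact: accepted_nd universal_acc_lim.
exact: accepted_cond universal_rej_lim universal_acc_rej.
Qed.
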